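(* Let $R$ be a generalized Golod ring and let $d_R(t)\in\mathbb Z[t]$ be its associated polynomial (defined in the context). If $d_R(1)\neq 0$, then $R$ satisfies Tor-vanishing.
   Context: All rings are commutative Noetherian local rings with $1\neq 0$, and all modules are finitely generated. Let $R$ be a local ring with maximal ideal $\mathfrak m$ and residue field $k=R/\mathfrak m$. Tor-vanishing: $R$ satisfies Tor-vanishing if for all finitely generated $R$-modules $M,N$, $\operatorname{Tor}^R_i(M,N)=0$ for all $i\gg0$ implies that $M$ or $N$ has finite projective dimension. Acyclic closure: the acyclic closure $R\langle X\rangle$ of $k$ over $R$ is the DG $R$-algebra resolution of $k$ obtained from $R$ by Tate's process of killing cycles in a minimal way: one adjoins exterior variables in odd degrees and divided power variables in even degrees, the degree $1$ variables being mapped by the differential onto a minimal generating set of $\mathfrak m$, and, for $n\ge 1$, the degree $n+1$ variables being mapped to cycles whose classes form a minimal generating set of $H_n(R\langle X_{\le n}\rangle)$. Here $R\langle X_{\le n}\rangle$ is the DG subalgebra generated by the variables of degree at most $n$. Let $e_j$ be the number of variables of degree $j$ in $X$. Trivial Massey operation: let $U$ be such a DG algebra with augmentation $U\to k$, and set $\overline a=(-1)^{d+1}a$ for $a\in U_d$ (extended additively). $U$ admits a trivial Massey operation if to each finite sequence $v_1,\dots,v_n$ ($n\ge 1$) of elements of $\widetilde H(U)=\ker(H(U)\to k)$ one can assign an element $\gamma(v_1,\dots,v_n)\in\ker(U\to k)$ such that (i) $\gamma(v)$ is a cycle representing the homology class $v$ for each $v\in\widetilde H(U)$, and (ii) $d\gamma(v_1,\dots,v_n)=\sum_{j=1}^{n-1}\overline{\gamma(v_1,\dots,v_j)}\,\gamma(v_{j+1},\dots,v_n)$.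 Generalized Golod ring: $R$ is generalized Golod (of level $\le q$, where $q\geq 1$) if $R\langle X_{\le q}\rangle$ admits a trivial Massey operation; $R$ is generalized Golod if this holds for some $q$. The polynomial $d_R(t)$: let $R$ be generalized Golod of level $\le q$, $U=R\langle X_{\le q}\rangle$, $h(t)=\sum_{i\ge0}\dim_k H_i(U)\,t^i$ and $v(t)=\prod_{0<2i\le q}(1-t^{2i})^{e_{2i}}$ (empty product $=1$). By a theorem of Avramov, $u(t)=v(t)h(t)$ is a polynomial in $\mathbb Z[t]$. Define $d_R(t)=(1+t)v(t)-t\,u(t)=v(t)\bigl(1+t-t\,h(t)\bigr)\in\mathbb Z[t]$. Avramov's theorem also gives that $d_R(t)P^R_M(t)\in\mathbb Z[t]$ for every finitely generated $R$-module $M$, where $P^R_M(t)=\sum_n\dim_k\operatorname{Tor}^R_n(k,M)t^n$, and that $d_R(t)P^R_k(t)=\prod_{0\le 2i+1\le q}(1+t^{2i+1})^{e_{2i+1}}$. *)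

(* Defs.v *)
From HB Require Import structures.
From mathcomp Require Import all_boot all_order all_algebra.
From mathcomp Require Import boolp classical_sets.

Set Implicit Arguments.
Unset Strict Implicit.
Unset Printing Implicit Defensive.

Import GRing.Theory.
Local Open Scope ring_scope.
Local Open Scope classical_set_scope.

Definition is_ideal (R : comUnitRingType) (I : set R) : Prop :=
  I 0 /\ forall a x y, I x -> I y -> I (a * x + y).

(* [res : R -> k] is the projection onto the residue field.  The non-units of
   [R] are the kernel of a morphism to a field, hence form the unique maximal
   ideal. *)
Record noetherian_local (R : comUnitRingType) (k : fieldType)
    (res : {rmorphism R -> k}) : Prop := NoetherianLocal {
  res_surj : forall y : k, exists r : R, res r = y;
  res_ker : forall r : R, res r = 0 <-> r \isn't a GRing.unit;
  ideal_fg : forall I : set R, is_ideal I ->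
    exists (n : nat) (g : 'I_n -> R), (forall i, I (g i)) /\
      forall x, I x -> exists c : 'I_n -> R, x = \sum_i c i * g i }.

Definition finitely_generated (R : comUnitRingType) (M : lmodType R) : Prop :=
  exists (n : nat) (g : 'I_n -> M),
    forall x, exists c : 'I_n -> R, x = \sum_i c i *: g i.

(* The resolution  ... -> R^(b 2) -> R^(b 1) -> R^(b 0) -> M -> 0, with
   matrices acting on row vectors from the right. *)
Record free_resolution (R : comUnitRingType) (M : lmodType R) := FreeResolution {
  fr_rank : nat -> nat;
  fr_diff : forall i, 'M[R]_(fr_rank i.+1, fr_rank i);
  fr_aug : {linear 'rV[R]_(fr_rank 0) -> M};
  fr_aug_surj : forall y : M, exists v, fr_aug v = y;
  fr_exact0 : forall v, fr_aug v = 0 <-> exists w, v = w *m fr_diff 0;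
  fr_exactS : forall i (v : 'rV[R]_(fr_rank i.+1)),
    v *m fr_diff i = 0 <-> exists w, v = w *m fr_diff i.+1 }.

Section Tensor.
Variables (R : comUnitRingType) (M : lmodType R) (F : free_resolution M).
Variable N : lmodType R.

(* R^n (x) N is identified with N^n. *)
Definition tensor_diff (i : nat) (y : {ffun 'I_(fr_rank F i.+1) -> N}) :
    {ffun 'I_(fr_rank F i) -> N} :=
  [ffun l => \sum_j fr_diff F i j l *: y j].

Definition tensor_exact (i : nat) : Prop :=
  match i with
  | 0 => forall y, exists w, y = tensor_diff (i := 0) w
  | i'.+1 => forall y, tensor_diff (i := i') y = 0 ->
      exists w, y = tensor_diff (i := i'.+1) w
  end.
End Tensor.

(* Tor_i(M, N) = 0.  For M finitely generated over a Noetherian ring, a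
   resolution by finite free modules exists, and the homology of F (x) N does
   not depend on it. *)
Definition Tor_eq0 (R : comUnitRingType) (M N : lmodType R) (i : nat) : Prop :=
  exists F : free_resolution M, tensor_exact F N i.

Definition projective (R : comUnitRingType) (P : lmodType R) : Prop :=
  forall (A B : lmodType R) (g : {linear A -> B}) (f : {linear P -> B}),
    (forall y, exists x, g x = y) -> exists h : {linear P -> A}, forall p, g (h p) = f p.

Definition finite_projdim (R : comUnitRingType) (M : lmodType R) : Prop :=
  exists (P : nat -> lmodType R) (d : forall i, {linear P i.+1 -> P i})
      (eps : {linear P 0 -> M}) (n : nat),
    [/\ (forall i, projective (P i)),
        (forall i, (n < i)%N -> forall x : P i, x = 0),
        (forall y, exists x, eps x = y),
        (forall x, eps x = 0 <-> exists w, x = d 0 w)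
      & (forall i x, d i x = 0 <-> exists w, x = d i.+1 w)].

Definition Tor_vanishing (R : comUnitRingType) : Prop :=
  forall M N : lmodType R, finitely_generated M -> finitely_generated N ->
    (exists s, forall i, (s <= i)%N -> Tor_eq0 M N i) ->
    finite_projdim M \/ finite_projdim N.

(* Graded-commutative DG algebras, graded by nat, differential of degree -1.
   [dg_comp i] is the projection onto the component of degree [i], and
   [dg_bound a] bounds the degrees occurring in [a]. *)
Record dgAlgebra (R : comUnitRingType) := DGAlgebra {
  dg_sort :> algType R;
  dg_comp : nat -> {linear dg_sort -> dg_sort};
  dg_bound : dg_sort -> nat;
  dg_diff : {linear dg_sort -> dg_sort};
  dg_comp_comp : forall i j a,
    dg_comp i (dg_comp j a) = if i == j then dg_comp i a else 0;
  dg_comp_sum : forall a, a = \sum_(i < dg_bound a) dg_comp i a;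
  dg_one : dg_comp 0 1 = 1;
  dg_mul : forall i j a b, dg_comp i a = a -> dg_comp j b = b ->
    dg_comp (i + j)%N (a * b) = a * b;
  dg_comm : forall i j a b, dg_comp i a = a -> dg_comp j b = b ->
    a * b = (-1) ^+ (i * j)%N * (b * a);
  dg_odd_sqr : forall i a, odd i -> dg_comp i a = a -> a * a = 0;
  dg_diff0 : forall a, dg_comp 0 a = a -> dg_diff a = 0;
  dg_diffS : forall i a, dg_comp i.+1 a = a -> dg_comp i (dg_diff a) = dg_diff a;
  dg_diff_diff : forall a, dg_diff (dg_diff a) = 0;
  dg_leibniz : forall i a b, dg_comp i a = a ->
    dg_diff (a * b) = dg_diff a * b + (-1) ^+ i * (a * dg_diff b) }.

Section DGTheory.
Variables (R : comUnitRingType) (k : fieldType) (res : {rmorphism R -> k}).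
Variable A : dgAlgebra R.

Definition homogeneous (i : nat) : set A := [set a | dg_comp A i a = a].

Definition dg_bar (a : A) : A :=
  \sum_(i < dg_bound a) (-1) ^+ i.+1 * dg_comp A i a.

(* In what follows [U] is (the carrier of) a DG subalgebra of [A]. *)
Definition cycles (U : set A) (i : nat) : set A :=
  [set a | [/\ U a, homogeneous i a & dg_diff A a = 0]].

Definition boundaries (U : set A) (i : nat) : set A :=
  [set a | exists b, [/\ U b, homogeneous i.+1 b & a = dg_diff A b]].

(* The classes of the [g i], for [i] satisfying [P], generate Z/B. *)
Definition generates (Z B : set A) (n : nat) (P : pred 'I_n) (g : 'I_n -> A) : Prop :=
  forall z, Z z -> exists c : 'I_n -> R, B (z - \sum_(i | P i) c i *: g i).

Definition minimal_generators (Z B : set A) (n : nat) (g : 'I_n -> A) : Prop :=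
  [/\ (forall i, Z (g i)),
      generates Z B xpredT g
    & forall i, ~ generates Z B (predC1 i) g].

(* The R-module Z/B is isomorphic to k^n. *)
Definition dim_residue (Z B : set A) (n : nat) : Prop :=
  exists phi : A -> 'rV[k]_n,
    [/\ (forall a b, Z a -> Z b -> phi (a + b) = phi a + phi b),
        (forall r a, Z a -> phi (r *: a) = res r *: phi a),
        (forall w, exists2 a, Z a & phi a = w)
      & forall a, Z a -> (phi a = 0 <-> B a)].

(* The kernel of U -> k, when the degree 0 component of [A] is R. *)
Definition augmentation_kernel (U : set A) : set A :=
  [set a | U a /\ exists2 r : R, res r = 0 & dg_comp A 0 a = r%:A].

(* Homology classes are the cosets of the boundaries. *)
Definition homology_class (U : set A) (z : A) : set A :=
  [set a | exists2 b, U b & a = z + dg_diff A b].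

(* The kernel of H(U) -> k. *)
Definition reduced_homology (U : set A) : set (set A) :=
  [set v | exists z, [/\ augmentation_kernel U z, dg_diff A z = 0
                       & v = homology_class U z]].

Definition trivial_Massey_operation (U : set A) : Prop :=
  exists gamma : seq (set A) -> A,
    [/\ (forall s : seq (set A), (0 < size s)%N ->
           (forall v, v \in s -> reduced_homology U v) ->
           augmentation_kernel U (gamma s)),
        (forall v, reduced_homology U v -> v (gamma [:: v]))
      & (forall s : seq (set A), (0 < size s)%N ->
           (forall v, v \in s -> reduced_homology U v) ->
           dg_diff A (gamma s) =
             \sum_(1 <= j < size s)
               dg_bar (gamma (take j s)) * gamma (drop j s))].

(* [e j] variables of degree [j]; [x j i m] is the m-th divided power of the
   i-th of them.  For odd [j] there are no divided powers, and [x j i m] is 0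
   for m > 1. *)
Variables (e : nat -> nat) (x : forall j, 'I_(e j) -> nat -> A).

Definition variables (n : nat) := {j : 'I_n.+1 & 'I_(e j)}.

Definition admissible (n : nat) (m : {ffun variables n -> nat}) : bool :=
  [forall v : variables n, odd (nat_of_ord (tag v)) ==> (m v <= 1)%N].

Definition monomial (n : nat) (m : {ffun variables n -> nat}) : A :=
  \prod_(v : variables n) x (tagged v) (m v).

(* R<X_{<= n}> *)
Definition truncation (n : nat) : set A :=
  [set a | exists (s : seq {ffun variables n -> nat})
                  (c : {ffun variables n -> nat} -> R),
     all (@admissible n) s /\ a = \sum_(m <- s) c m *: monomial m].

Definition monomials_free (n : nat) : Prop :=
  forall (s : seq {ffun variables n -> nat})
         (c : {ffun variables n -> nat} -> R),
    uniq s -> all (@admissible n) s ->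
    \sum_(m <- s) c m *: monomial m = 0 -> forall m, m \in s -> c m = 0.

End DGTheory.

(* The relations on the variables, together with the divided monomials being a
   basis, determine the DG algebra from the cycles [dg_diff (x j i 1)]. *)
Record acyclicClosure (R : comUnitRingType) (k : fieldType)
    (res : {rmorphism R -> k}) := AcyclicClosure {
  ac_alg :> dgAlgebra R;
  ac_num : nat -> nat;
  ac_var : forall j, 'I_(ac_num j) -> nat -> ac_alg;
  ac_num0 : ac_num 0 = 0%N;
  ac_var0 : forall j (i : 'I_(ac_num j)), ac_var i 0 = 1;
  ac_var_odd : forall j (i : 'I_(ac_num j)) m,
    odd j -> (1 < m)%N -> ac_var i m = 0;
  ac_var_homogeneous : forall j (i : 'I_(ac_num j)) m,
    homogeneous (j * m)%N (ac_var i m);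
  ac_var_mul : forall j (i : 'I_(ac_num j)) m n,
    ac_var i m * ac_var i n = ac_var i (m + n)%N *+ 'C((m + n)%N, m);
  ac_var_diff : forall j (i : 'I_(ac_num j)) m, ~~ odd j ->
    dg_diff ac_alg (ac_var i m.+1) = dg_diff ac_alg (ac_var i 1) * ac_var i m;
  ac_free : forall n, monomials_free ac_var n;
  ac_span : forall a, exists n, truncation ac_var n a;
  ac_min1 : minimal_generators
    [set a : ac_alg | exists2 r : R, res r = 0 & a = r%:A] [set 0]
    (fun i : 'I_(ac_num 1) => dg_diff ac_alg (ac_var i 1));
  ac_minS : forall n, (1 <= n)%N -> minimal_generators
    (cycles (truncation ac_var n) n) (boundaries (truncation ac_var n) n)
    (fun i : 'I_(ac_num n.+1) => dg_diff ac_alg (ac_var i 1)) }.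

Section GeneralizedGolod.
Variables (R : comUnitRingType) (k : fieldType) (res : {rmorphism R -> k}).
Variable A : acyclicClosure res.

(* R is generalized Golod of level <= q; this does not depend on the acyclic
   closure [A], which is unique up to isomorphism. *)
Definition generalized_Golod (q : nat) : Prop :=
  (1 <= q)%N /\ trivial_Massey_operation res (truncation (@ac_var _ _ _ A) q).

Definition Golod_v (q : nat) : {poly int} :=
  \prod_(1 <= i < q.+1 | (2 * i <= q)%N) (1 - 'X^(2 * i)%N) ^+ ac_num A (2 * i)%N.

(* u(t) = v(t) h(t) as power series, where h_i = dim_k H_i(R<X_{<= q}>); the
   n-th coefficient of the product only involves h_0, ..., h_n. *)
Definition is_Golod_u (q : nat) (u : {poly int}) : Prop :=
  exists h : nat -> nat,
    (forall i, dim_residue res (cycles (truncation (@ac_var _ _ _ A) q) i)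
                 (boundaries (truncation (@ac_var _ _ _ A) q) i) (h i)) /\
    (forall n, u`_n = (Golod_v q * \poly_(i < n.+1) (h i)%:R)`_n).

(* [d] is the polynomial d_R(t) attached to the level q *)
Definition is_Golod_polynomial (q : nat) (d : {poly int}) : Prop :=
  exists2 u, is_Golod_u q u & d = (1 + 'X) * Golod_v q - 'X * u.

End GeneralizedGolod.

(* Main.v *)
(* Let U = R<X_{<=q}>, h its Hilbert series in homology, V(t) = t (h(t) - 1),
   v the product attached to the even variables, so that d = v (1 - V).
   A trivial Massey operation turns U tensored with the tensor algebra on the
   reduced homology of U into a free resolution of k; it yields a resolution
   of k which is a cone with subcomplex U and quotient a sum of shifts of an
   arbitrary resolution F of k, one for each basis element of the reduced
   homology.  Its long exact sequence shows that, for a minimal complex with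
   Betti series r, the series B = (1 - V) r has coefficients bounded by
   dim H_n(U (x) M) + dim H_{n-1}(U (x) M).  Filtering U by the divided
   monomials in the variables of degree at least 2 bounds these dimensions, so
   that v(t) sum_n |B_n| t^n is bounded on [0,1).

   If Tor_i(M,N) = 0 for large i, then a syzygy of M tensored with N has Betti
   series r'' = r r', hence (1 - V) B'' = B B'.  If all partial sums of V(1) are
   at most 1, put rho = 1; otherwise choose rho in (0,1) with V(rho) = 1, so
   that, say, B(rho) = 0.  In both cases the partial sums of V(rho) are at most
   1, which gives r_n rho^n <= sum_{m<=n} B_m rho^m and then the convergence of
   r on [0,1).  As d r = v B is bounded and d(1) <> 0, r is bounded at 1; its
   coefficients being natural numbers, they vanish eventually. *)

From Stdlib Require Reals Lra Lia.
From Coquelicot Require Coquelicot.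

(** * Power series with nonnegative coefficients *)

Module PowerSeries.
Import Stdlib.Reals.Reals Stdlib.micromega.Lra Stdlib.micromega.Lia Coquelicot.Coquelicot.
Local Open Scope R_scope.

(** Splitting off the last letter of a word presents the twisted tensor product as a cone of maps
    from shifted copies of itself to U. Each copy may be replaced by F, through a comparison map
    over k; the twisted tensor product is thus used only for its acyclicity, and coefficients are
    taken only in complexes with a finite basis in every degree. The obstacle in the analysis is
    that nothing is known beforehand about the radius of convergence of r = B/(1 - V), which may
    have a pole inside the unit interval, where V = 1. The product relation forces B or B' to vanish
    at that point, and this zero cancels the pole. The factor v makes the estimates uniform up to t
    = 1, because it cancels the poles produced by the divided powers of the even variables. The
    convergence of V itself comes from the same estimate with coefficients R. A minimal complex
    exact in positive degrees resolves its own cokernel, so syzygies and tensor products are handled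
    as complexes, without naming the modules. *)

Definition inside_unit (a : nat -> R) := forall x, 0 <= x < 1 -> Rbar_lt (Rabs x) (CV_radius a).

Lemma inside_unit_bounded (a : nat -> R) :
  (forall t, 0 <= t < 1 -> exists M, forall n, Rabs (a n * t ^ n) <= M) -> inside_unit a.
Proof.
intros H x Hx.
destruct (H ((1 + x) / 2)) as [M HM]; [lra|].
destruct (CV_radius_bounded a) as [ub _].
apply Rbar_lt_le_trans with (Finite ((1 + x) / 2)).
- simpl; rewrite Rabs_pos_eq; lra.
- apply ub; now exists M.
Qed.

Lemma is_lim_partial_sums (a : nat -> R) x : Rbar_lt (Rabs x) (CV_radius a) ->
  is_lim_seq (sum_f_R0 (fun i => a i * x ^ i)) (PSeries a x).
Proof.
intros H; apply CV_radius_inside, PSeries_correct, is_pseries_R in H.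
apply is_lim_seq_ext with (2 := H).
intros n; now rewrite <- sum_n_Reals.
Qed.

Lemma partial_sum_le_PSeries (a : nat -> R) x n : (forall i, 0 <= a i) -> 0 <= x ->
  Rbar_lt (Rabs x) (CV_radius a) -> sum_f_R0 (fun i => a i * x ^ i) n <= PSeries a x.
Proof.
intros a0 x0 H; apply (is_lim_seq_incr_compare _ _ (is_lim_partial_sums a x H)).
intros m; simpl.
enough (0 <= a (S m) * x ^ S m) by (simpl in *; lra).
apply Rmult_le_pos; [apply a0 | now apply pow_le].
Qed.

Lemma CV_radius_finite_support (a : nat -> R) N x : (forall n, (N < n)%nat -> a n = 0) ->
  Rbar_lt (Rabs x) (CV_radius a).
Proof.
intros a0; destruct (CV_radius_bounded a) as [ub _].
apply Rbar_lt_le_trans with (Finite (Rabs x + 1)); [simpl; lra|].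
apply ub; exists (sum_f_R0 (fun n => Rabs (a n * (Rabs x + 1) ^ n)) N); intros n.
assert (P : forall m, 0 <= sum_f_R0 (fun n => Rabs (a n * (Rabs x + 1) ^ n)) m).
{ intros m; apply cond_pos_sum; intros; apply Rabs_pos. }
destruct (Nat.le_gt_cases n N) as [le|lt].
- clear a0; induction le.
  + destruct n; simpl; [lra|].
    specialize (P n); simpl in *; lra.
  + simpl; pose proof (Rabs_pos (a (S m) * ((Rabs x + 1) * (Rabs x + 1) ^ m))); lra.
- rewrite a0, Rmult_0_l, Rabs_R0 by easy; apply P.
Qed.

Lemma PSeries_finite_support (a : nat -> R) N x : (forall n, (N < n)%nat -> a n = 0) ->
  PSeries a x = sum_f_R0 (fun i => a i * x ^ i) N.
Proof.
intros a0.
pose proof (is_lim_partial_sums a x (CV_radius_finite_support a N x a0)) as L.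
apply is_lim_seq_unique in L.
rewrite (is_lim_seq_unique _ (sum_f_R0 (fun i => a i * x ^ i) N)) in L.
- injection L; auto.
- apply is_lim_seq_ext_loc with (u := fun _ => sum_f_R0 (fun i => a i * x ^ i) N).
  + exists N; intros n le; induction le; [easy|].
    simpl; rewrite <- IHle, a0 by lia; ring.
  + apply is_lim_seq_const.
Qed.

(** A partial sum is the power series of the truncated sequence, whose radius of convergence exceeds
    every [x], so the continuity of power series applies. *)
Lemma continuous_partial_sum (a : nat -> R) n x :
  continuity_pt (fun t => sum_f_R0 (fun i => a i * t ^ i) n) x.
Proof.
pose (b i := if Nat.leb i n then a i else 0).
assert (b0 : forall i, (n < i)%nat -> b i = 0).
{ intros i Hi; unfold b; destruct (Nat.leb_spec i n); [lia|easy]. }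
assert (E : forall t, PSeries b t = sum_f_R0 (fun i => a i * t ^ i) n).
{ intros t; rewrite (PSeries_finite_support b n t b0); apply sum_eq.
  intros i Hi; unfold b; destruct (Nat.leb_spec i n); [easy|lia]. }
intros eps Heps.
destruct (PSeries_continuity b x (CV_radius_finite_support b n x b0) eps Heps) as [al [al0 H]].
exists al; split; [easy|]; intros y Hy; rewrite <- !E; now apply H.
Qed.

Lemma limit_left_le (f : R -> R) C t0 : continuity_pt f 1 -> t0 < 1 ->
  (forall t, t0 <= t < 1 -> f t <= C) -> f 1 <= C.
Proof.
intros cf t01 H; apply Rnot_lt_le; intros lt.
destruct (cf (f 1 - C)) as [al [al0 Hal]]; [lra|].
pose (t := Rmax t0 (1 - al / 2)).
assert (t1 : t < 1) by (unfold t; apply Rmax_lub_lt; lra).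
assert (tt : t0 <= t) by apply Rmax_l.
assert (ta : 1 - al / 2 <= t) by apply Rmax_r.
specialize (H t (conj tt t1)).
assert (D : Rabs (f t - f 1) < f 1 - C).
{ apply (Hal t); split; [split; [exact I|lra]|].
  simpl; unfold R_dist; rewrite Rabs_left; lra. }
apply Rabs_def2 in D; lra.
Qed.

Section Dichotomy.
Variables (W V D : nat -> R) (N : nat).
Definition unit_minus (s : nat -> R) (n : nat) := match n with O => 1 | _ => 0 end - s n.
Notation phi := (unit_minus V).
Notation w := (fun t => sum_f_R0 (fun i => W i * t ^ i) N).
(** The constant is uniform in [t] and [n]; the weight, which may vanish at 1, absorbs the growth.
    Partial sums are used so that convergence need not be assumed: it follows on [0,1), where the
    weight is positive. *)
Definition tameR (s : nat -> R) := exists C, forall t n, 0 <= t -> t < 1 ->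
  w t * sum_f_R0 (fun i => Rabs (s i) * t ^ i) n <= C.

Hypothesis w_pos : forall t, 0 <= t < 1 -> 0 < w t.
Hypothesis W0 : forall n, (N < n)%nat -> W n = 0.
Hypothesis D0 : forall n, (N < n)%nat -> D n = 0.
Hypothesis V_ge0 : forall n, 0 <= V n.
Hypothesis V0 : V 0%nat = 0.
Hypothesis V_tame : tameR V.
Hypothesis DE : forall n, D n = PS_mult W phi n.
Hypothesis D1 : sum_f_R0 D N <> 0.

Lemma term_le_sum (a : nat -> R) t n : 0 <= t ->
  Rabs (a n * t ^ n) <= sum_f_R0 (fun i => Rabs (a i) * t ^ i) n.
Proof.
intros t0; rewrite Rabs_mult, (Rabs_pos_eq (t ^ n)) by now apply pow_le.
destruct n as [|n]; [simpl; lra|].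
enough (0 <= sum_f_R0 (fun i => Rabs (a i) * t ^ i) n) by (simpl in *; lra).
apply cond_pos_sum; intros i; apply Rmult_le_pos; [apply Rabs_pos | now apply pow_le].
Qed.

Lemma tame_partial_sum_bounded (a : nat -> R) t : tameR a -> 0 <= t < 1 ->
  exists M, 0 <= M /\ forall n, sum_f_R0 (fun i => Rabs (a i) * t ^ i) n <= M.
Proof.
intros [C H] Ht; pose proof (w_pos t Ht) as wt; exists (C / w t).
assert (B : forall n, sum_f_R0 (fun i => Rabs (a i) * t ^ i) n <= C / w t).
{ intros n; apply Rmult_le_reg_l with (w t); [easy|].
  replace (w t * (C / w t)) with C by (field; lra).
  apply H; lra. }
split; [|easy].
apply Rle_trans with (2 := B 0%nat); simpl; pose proof (Rabs_pos (a 0%nat)); lra.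
Qed.

Lemma tame_inside_unit (a : nat -> R) : tameR a -> inside_unit a.
Proof.
intros Ha; apply inside_unit_bounded; intros t Ht.
destruct (tame_partial_sum_bounded a t Ha Ht) as [M [_ HM]]; exists M; intros n.
apply Rle_trans with (2 := HM n), term_le_sum; lra.
Qed.

Lemma PSeries_phi x : 0 <= x < 1 -> Rbar_lt (Rabs x) (CV_radius phi) /\
  PSeries phi x = 1 - PSeries V x.
Proof.
intros Hx; pose (u n := match n with O => 1 | _ => 0 end).
assert (u0 : forall n, (0 < n)%nat -> u n = 0) by (intros [|n] Hn; [lia|easy]).
assert (E : forall n, PS_plus u (PS_opp V) n = phi n).
{ intros n; unfold PS_plus, PS_opp, unit_minus; unfold plus, opp; simpl; unfold u; ring. }
pose proof (CV_radius_finite_support u 0 x u0) as Ru.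
pose proof (tame_inside_unit V V_tame x Hx) as RV.
split.
- rewrite <- (CV_radius_ext _ _ E); apply Rbar_lt_le_trans with (2 := CV_radius_plus _ _).
  rewrite CV_radius_opp; now apply Rbar_min_case.
- rewrite <- (PSeries_ext _ _ x E), PSeries_plus.
  + rewrite PSeries_opp, (PSeries_finite_support u 0 x u0); simpl; ring.
  + now apply CV_radius_inside.
  + now apply ex_pseries_opp, CV_radius_inside.
Qed.

Section OneSequence.
Variables (r B : nat -> R).
Hypothesis r_ge0 : forall n, 0 <= r n.
Hypothesis BE : forall n, B n = r n - PS_mult r V n.
Hypothesis B_tame : tameR B.

(** Summation by columns: r_k x^k is multiplied by those terms of 1 - V whose index is at most n -
    k. In this form every summand is nonnegative once the partial sums of V at [x] are at most 1. *)
Lemma partial_sums_B x n : sum_f_R0 (fun m => B m * x ^ m) n =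
  sum_f_R0 (fun k => r k * x ^ k * (1 - sum_f_R0 (fun i => V i * x ^ i) (n - k))) n.
Proof.
induction n as [|n IH].
- simpl; rewrite BE; unfold PS_mult; simpl; ring.
- rewrite tech5, IH, tech5, Nat.sub_diag.
  rewrite (sum_eq (fun k => r k * x ^ k * (1 - sum_f_R0 (fun i => V i * x ^ i) (S n - k)))
    (fun k => r k * x ^ k * (1 - sum_f_R0 (fun i => V i * x ^ i) (n - k)) -
      (r k * V (S n - k)%nat) * x ^ S n)).
  2:{ intros k Hk; replace (S n - k)%nat with (S (n - k)) by lia; rewrite tech5.
      replace (x ^ S n) with (x ^ k * x ^ S (n - k)) by (rewrite <- pow_add; f_equal; lia).
      ring. }
  rewrite minus_sum, <- scal_sum, BE; unfold PS_mult; rewrite (tech5 _ n), Nat.sub_diag.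
  simpl; ring.
Qed.

(** All summands of [partial_sums_B] are nonnegative, and the one for k = n is r_n x^n itself
    because V_0 = 0. *)
Lemma term_le_partial_sum x n : 0 <= x ->
  (forall m, sum_f_R0 (fun i => V i * x ^ i) m <= 1) ->
  r n * x ^ n <= sum_f_R0 (fun m => B m * x ^ m) n.
Proof.
intros x0 H; rewrite partial_sums_B.
assert (P : forall k m, 0 <= r k * x ^ k * (1 - sum_f_R0 (fun i => V i * x ^ i) m)).
{ intros k m; specialize (H m); apply Rmult_le_pos; [|lra].
  apply Rmult_le_pos; [apply r_ge0 | now apply pow_le]. }
destruct n as [|n]; [simpl; rewrite V0; lra|].
rewrite tech5, Nat.sub_diag; replace (sum_f_R0 (fun i => V i * x ^ i) 0) with 0
  by (simpl; rewrite V0; ring).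
enough (0 <= sum_f_R0 (fun k => r k * x ^ k * (1 - sum_f_R0 (fun i => V i * x ^ i) (S n - k))) n) by lra.
apply cond_pos_sum; intros k; apply P.
Qed.

(** The identity d r = w B bounds r(t) for [t] near 1, uniformly. Since r has nonnegative
    coefficients, the bound passes to its partial sums at [t], and these, being polynomials, carry
    it to t = 1. *)
Lemma bounded_of_inside_unit : inside_unit r -> exists C, forall n, sum_f_R0 r n <= C.
Proof.
intros Hr; destruct B_tame as [C HC].
assert (E : forall t, 0 <= t < 1 -> sum_f_R0 (fun i => D i * t ^ i) N * PSeries r t = w t * PSeries B t).
{ intros t Ht; destruct (PSeries_phi t Ht) as [Rphi Ephi].
  rewrite <- (PSeries_finite_support D N t D0), (PSeries_ext _ _ t DE).
  rewrite PSeries_mult, (PSeries_finite_support W N t W0), Ephi; [|now apply CV_radius_finite_support with N|easy].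
  assert (EB : PSeries B t = PSeries r t - PSeries r t * PSeries V t).
  { rewrite <- PSeries_mult; [|now apply Hr|now apply tame_inside_unit].
    rewrite <- PSeries_minus.
    - apply PSeries_ext; intros n; rewrite BE; unfold PS_minus, PS_plus, PS_opp, plus, opp; simpl; ring.
    - now apply CV_radius_inside, Hr.
    - apply ex_pseries_mult; [now apply Hr | now apply tame_inside_unit]. }
  rewrite EB; ring. }
assert (Bd : forall t, 0 <= t < 1 -> Rabs (w t * PSeries B t) <= C).
{ intros t Ht; pose proof (w_pos t Ht) as wt.
  rewrite Rabs_mult, (Rabs_pos_eq (w t)) by lra.
  pose proof (is_lim_partial_sums B t (tame_inside_unit B B_tame t Ht)) as L.
  apply is_lim_seq_abs in L; apply (is_lim_seq_scal_l _ (w t)) in L.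
  refine (is_lim_seq_le _ (fun _ => C) _ _ _ L (is_lim_seq_const C)).
  intros n; apply Rle_trans with (2 := HC t n ltac:(lra) ltac:(lra)).
  apply Rmult_le_compat_l; [lra|].
  apply Rle_trans with (1 := Rsum_abs _ _), Req_le, sum_eq; intros i _.
  rewrite Rabs_mult, (Rabs_pos_eq (t ^ i)); [easy | apply pow_le; lra]. }
set (f t := sum_f_R0 (fun i => D i * t ^ i) N) in *.
assert (f1 : f 1 = sum_f_R0 D N).
{ apply sum_eq; intros i _; rewrite pow1; ring. }
(* Half of |f(1)| remains a lower bound for |f| on an interval to the left of 1. *)
pose (del := Rabs (f 1) / 2).
assert (del0 : 0 < del).
{ unfold del; rewrite f1; pose proof (Rabs_pos_lt _ D1); lra. }
destruct (continuous_partial_sum D N 1 del del0) as [al [al0 Hal]].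
pose (t0 := Rmax 0 (1 - al / 2)).
assert (t01 : t0 < 1) by (unfold t0; apply Rmax_lub_lt; lra).
assert (fd : forall t, t0 <= t < 1 -> del <= Rabs (f t)).
{ intros t Ht; assert (ta : 1 - al / 2 <= t) by (apply Rle_trans with t0; [apply Rmax_r|lra]).
  assert (Dd : Rabs (f t - f 1) < del).
  { apply (Hal t); split; [split; [exact I|lra]|].
    simpl; unfold R_dist; rewrite Rabs_left; lra. }
  pose proof (Rabs_triang_inv (f 1) (f t)) as T; rewrite (Rabs_minus_sym (f 1) (f t)) in T.
  unfold del in *; lra. }
exists (C / del); intros n.
replace (sum_f_R0 r n) with (sum_f_R0 (fun i => r i * 1 ^ i) n)
  by (apply sum_eq; intros; rewrite pow1; ring).
apply (limit_left_le (fun t => sum_f_R0 (fun i => r i * t ^ i) n) (C / del) t0);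
  [apply continuous_partial_sum|easy|].
intros t Ht; assert (Ht' : 0 <= t < 1) by (split; [apply Rle_trans with t0; [apply Rmax_l|lra]|lra]).
apply Rle_trans with (PSeries r t); [apply partial_sum_le_PSeries; [easy|lra|now apply Hr]|].
assert (P0 : 0 <= PSeries r t).
{ apply Rle_trans with (2 := partial_sum_le_PSeries r t 0 r_ge0 (proj1 Ht') (Hr t Ht')).
  simpl; specialize (r_ge0 0%nat); lra. }
apply Rmult_le_reg_l with del; [easy|].
replace (del * (C / del)) with C by (field; lra).
apply Rle_trans with (2 := Bd t Ht'); rewrite <- E by easy.
rewrite Rabs_mult, (Rabs_pos_eq (PSeries r t)) by easy.
apply Rmult_le_compat_r; [easy|now apply fd].
Qed.

(** At x = 1, [term_le_partial_sum] bounds r_n by the sum of the |B_m| with m at most n. Multiplying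
    by t^n, which is at most t^m, turns this into the bounded sum of the |B_m| t^m. *)
Lemma inside_unit_of_V_le1 : (forall n, sum_f_R0 V n <= 1) -> inside_unit r.
Proof.
intros H; apply inside_unit_bounded; intros t Ht.
destruct (tame_partial_sum_bounded B t B_tame Ht) as [M [_ HM]]; exists M; intros n.
rewrite Rabs_pos_eq by (apply Rmult_le_pos; [apply r_ge0 | apply pow_le; lra]).
apply Rle_trans with (2 := HM n).
assert (L : r n <= sum_f_R0 (fun m => Rabs (B m)) n).
{ assert (T := term_le_partial_sum 1 n ltac:(lra)).
  rewrite pow1, Rmult_1_r in T; apply Rle_trans with (1 := T ltac:(intros m; apply Rle_trans with (2 := H m), Req_le, sum_eq; intros; rewrite pow1; ring)).
  apply sum_Rle; intros i _; rewrite pow1, Rmult_1_r; apply Rle_abs. }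
apply Rle_trans with (sum_f_R0 (fun m => Rabs (B m)) n * t ^ n).
- apply Rmult_le_compat_r; [apply pow_le; lra|easy].
- rewrite Rmult_comm, scal_sum; apply sum_Rle; intros i Hi.
  apply Rmult_le_compat_l; [apply Rabs_pos|].
  replace n with (i + (n - i))%nat by lia; rewrite pow_add.
  rewrite <- (Rmult_1_r (t ^ i)) at 2; apply Rmult_le_compat_l; [apply pow_le; lra|].
  rewrite <- (pow1 (n - i)); apply pow_incr; lra.
Qed.

(** Since B(rho) = 0, a partial sum of B at rho is minus a tail. For t in (rho, 1) the numbers |B_m|
    t^m are bounded, so this tail is O((rho/t)^n); hence r_n rho^n is O((rho/t)^n), which says that
    r_n t^n is bounded. *)
Lemma inside_unit_of_root rho : 0 < rho < 1 -> PSeries V rho = 1 -> PSeries B rho = 0 ->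
  inside_unit r.
Proof.
intros Hrho HV HB; apply inside_unit_bounded.
assert (big : forall t, rho < t < 1 -> exists M, forall n, Rabs (r n * t ^ n) <= M).
{ intros t Ht; destruct (tame_partial_sum_bounded B t B_tame ltac:(lra)) as [K [K0 HK]].
  pose (s := rho / t).
  assert (s0 : 0 < s) by (apply Rdiv_lt_0_compat; lra).
  assert (s1 : s < 1) by (apply Rmult_lt_reg_r with t; unfold s; [lra|]; field_simplify; lra).
  assert (rs : rho = s * t) by (unfold s; field; lra).
  assert (BK : forall m, Rabs (B m * rho ^ m) <= K * s ^ m).
  { intros m; rewrite rs, Rpow_mult_distr.
    replace (B m * (s ^ m * t ^ m)) with ((B m * t ^ m) * s ^ m) by ring.
    rewrite Rabs_mult, (Rabs_pos_eq (s ^ m)) by (apply pow_le; lra).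
    apply Rmult_le_compat_r; [apply pow_le; lra|].
    apply Rle_trans with (2 := HK m), term_le_sum; lra. }
  (* A geometric bound for the terms between [n] and [n + j]. When [j] tends to infinity the partial
     sum on the right tends to B(rho) = 0. *)
  assert (tail : forall n j, sum_f_R0 (fun m => B m * rho ^ m) n <=
    sum_f_R0 (fun m => B m * rho ^ m) (n + j) + K * (s ^ S n - s ^ S (n + j)) / (1 - s)).
  { intros n j; induction j as [|j IH].
    - rewrite Nat.add_0_r; replace (s ^ S n - s ^ S n) with 0 by ring; lra.
    - rewrite Nat.add_succ_r, tech5; apply Rle_trans with (1 := IH).
      specialize (BK (S (n + j))); apply Rabs_le_between in BK.
      replace (K * (s ^ S n - s ^ S (S (n + j))) / (1 - s)) with
        (K * (s ^ S n - s ^ S (n + j)) / (1 - s) + K * s ^ S (n + j)) by (simpl; field; lra).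
      lra. }
  exists (K * s / (1 - s)); intros n.
  rewrite Rabs_pos_eq by (apply Rmult_le_pos; [apply r_ge0 | apply pow_le; lra]).
  assert (L : r n * rho ^ n <= K * s ^ S n / (1 - s)).
  { apply Rle_trans with (1 := term_le_partial_sum rho n ltac:(lra)
      ltac:(intros m; rewrite <- HV; apply partial_sum_le_PSeries; [easy|lra|apply tame_inside_unit; [easy|lra]])).
    pose proof (is_lim_partial_sums B rho (tame_inside_unit B B_tame rho ltac:(lra))) as Lm.
    rewrite HB in Lm; apply (is_lim_seq_incr_n _ n) in Lm.
    pose proof (is_lim_seq_plus' _ (fun _ => K * s ^ S n / (1 - s)) _ _ Lm (is_lim_seq_const _)) as L2.
    rewrite Rplus_0_l in L2.
    refine (is_lim_seq_le (fun _ => sum_f_R0 (fun m => B m * rho ^ m) n) _ _ _ _ (is_lim_seq_const _) L2).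
    intros j; rewrite (Nat.add_comm j n); apply Rle_trans with (1 := tail n j).
    apply Rplus_le_compat_l; unfold Rdiv; apply Rmult_le_compat_r.
    - apply Rlt_le, Rinv_0_lt_compat; lra.
    - apply Rmult_le_compat_l; [easy|].
      assert (0 <= s ^ S (n + j)) by (apply pow_le; lra); lra. }
  assert (sn : 0 < s ^ n) by (apply pow_lt; lra).
  apply Rmult_le_reg_r with (s ^ n); [easy|].
  replace (r n * t ^ n * s ^ n) with (r n * rho ^ n) by (rewrite rs, Rpow_mult_distr; ring).
  replace (K * s / (1 - s) * s ^ n) with (K * s ^ S n / (1 - s)) by (simpl; field; lra).
  easy. }
intros t Ht.
(* The midpoint between max(rho, t) and 1 lies in (rho, 1) and is at least [t], so the bound there
   also covers [t] at most rho. *)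
destruct (big ((1 + Rmax rho t) / 2)) as [M HM].
{ pose proof (Rmax_l rho t); assert (Rmax rho t < 1) by (apply Rmax_lub_lt; lra); lra. }
exists M; intros n; apply Rle_trans with (2 := HM n).
rewrite !Rabs_mult; apply Rmult_le_compat_l; [apply Rabs_pos|].
assert (t <= (1 + Rmax rho t) / 2) by (pose proof (Rmax_r rho t); lra).
rewrite !Rabs_pos_eq by (apply pow_le; lra); apply pow_incr; lra.
Qed.
End OneSequence.

(** A partial sum exceeding 1 at t = 1 still exceeds 1 at some t < 1, by continuity; as V(0) = 0,
    the intermediate value theorem gives the root. *)
Lemma V_le1_or_root : (forall n, sum_f_R0 V n <= 1) \/ exists rho, 0 < rho < 1 /\ PSeries V rho = 1.
Proof.
destruct (Classical_Prop.classic (forall n, sum_f_R0 V n <= 1)) as [H|H]; [now left|right].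
apply Classical_Pred_Type.not_all_ex_not in H; destruct H as [n Hn].
assert (big : exists t, 0 < t < 1 /\ 1 < sum_f_R0 (fun i => V i * t ^ i) n).
{ apply Classical_Prop.NNPP; intros no; apply Hn.
  replace (sum_f_R0 V n) with (sum_f_R0 (fun i => V i * 1 ^ i) n)
    by (apply sum_eq; intros; rewrite pow1; ring).
  apply (limit_left_le (fun t => sum_f_R0 (fun i => V i * t ^ i) n) 1 (1 / 2));
    [apply continuous_partial_sum|lra|].
  intros t Ht; apply Rnot_lt_le; intros lt; apply no; exists t; split; [lra|easy]. }
destruct big as [t [Ht lt]].
assert (Vt : 1 < PSeries V t).
{ apply Rlt_le_trans with (1 := lt), partial_sum_le_PSeries; [easy|lra|apply tame_inside_unit; [easy|lra]]. }
assert (cont : forall a, 0 <= a <= t -> continuity_pt (fun x => PSeries V x - 1) a).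
{ intros a Ha; apply continuity_pt_minus; [|now apply continuity_pt_const].
  apply PSeries_continuity, tame_inside_unit; [easy|lra]. }
destruct (Ranalysis5.IVT_interv (fun x => PSeries V x - 1) 0 t cont) as [z [Hz z0]]; try lra.
{ rewrite PSeries_0, V0; lra. }
exists z; split; [|lra].
destruct (Req_dec z 0) as [e|ne]; [|lra].
rewrite e, PSeries_0, V0 in z0; lra.
Qed.

(** All three of [B], [B'], [B''] converge at the root, so evaluating the hypothesis on [B''] there
    gives B(rho) B'(rho) = 0. If the partial sums of V stay at most 1, the sequence [r] is bounded
    without such a choice. *)
Theorem bounded_dichotomy (r r' B B' B'' : nat -> R) :
  (forall n, 0 <= r n) -> (forall n, 0 <= r' n) ->
  (forall n, B n = r n - PS_mult r V n) -> (forall n, B' n = r' n - PS_mult r' V n) ->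
  (forall n, PS_mult phi B'' n = PS_mult B B' n) ->
  tameR B -> tameR B' -> tameR B'' ->
  (exists C, forall n, sum_f_R0 r n <= C) \/ (exists C, forall n, sum_f_R0 r' n <= C).
Proof.
intros r0 r0' BE BE' BB Bt Bt' Bt''.
destruct V_le1_or_root as [H|[rho [Hrho HV]]].
- left; apply bounded_of_inside_unit with B; auto; now apply inside_unit_of_V_le1 with B.
- assert (Hr : 0 <= rho < 1) by lra.
  destruct (PSeries_phi rho Hr) as [Rphi Ephi].
  assert (E : PSeries B rho * PSeries B' rho = 0).
  { rewrite <- PSeries_mult by now apply tame_inside_unit.
    rewrite <- (PSeries_ext _ _ rho BB), PSeries_mult, Ephi, HV; [ring|easy|now apply tame_inside_unit]. }
  apply Rmult_integral in E; destruct E as [E|E]; [left|right].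
  + apply bounded_of_inside_unit with B; auto; now apply inside_unit_of_root with B rho.
  + apply bounded_of_inside_unit with B'; auto; now apply inside_unit_of_root with B' rho.
Qed.
End Dichotomy.

End PowerSeries.

From HB Require Import structures.
Require Import Defs.
From mathcomp Require Import all_boot all_order all_algebra.
From mathcomp Require Import boolp classical_sets functions reals Rstruct.
From mathcomp Require Import finmap zify ring.
From mathcomp.multinomials Require Import monalg.
Import PowerSeries.

Set Implicit Arguments.
Unset Strict Implicit.
Unset Printing Implicit Defensive.

Import Order.TTheory GRing.Theory Num.Theory.
Local Open Scope ring_scope.

(** * Dimension bounds over a local ring *)

Lemma dependent_choice (T : Type) (P : nat -> T -> Prop) (Q : nat -> T -> T -> Prop) :
  (exists x, P 0 x) ->
  (forall n x, P n x -> exists y, P n.+1 y /\ Q n x y) ->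
  exists f : nat -> T, forall n, P n (f n) /\ Q n (f n) (f n.+1).
Proof.
move=> [x0 P0] step.
have /choice[nxt nxtP] : forall p : nat * T, exists y,
    P p.1 p.2 -> P p.1.+1 y /\ Q p.1 p.2 y.
  move=> [n x] /=; have [/step[y Hy]|nP] := pselect (P n x); first by exists y.
  by exists x => /nP.
pose f := fix f n := if n is n'.+1 then nxt (n', f n') else x0.
have Pf n : P n (f n) by elim: n => [|n IH] //=; have [] := nxtP (n, f n) IH.
by exists f => n; split; [exact: Pf|have [] := nxtP (n, f n) (Pf n)].
Qed.

Section Submodules.
Variable R : comUnitRingType.
Implicit Types X Y W : lmodType R.

Definition submod X (B : X -> Prop) : Prop :=
  B 0 /\ forall a x y, B x -> B y -> B (a *: x + y).

Section SubmodTheory.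
Variables (X : lmodType R) (B : X -> Prop).
Hypothesis sB : submod B.

Lemma submod0 : B 0. Proof. exact: sB.1. Qed.
Lemma submodD x y : B x -> B y -> B (x + y).
Proof. by move=> Bx By; have := sB.2 1 x y Bx By; rewrite scale1r. Qed.
Lemma submodZ a x : B x -> B (a *: x).
Proof. by move=> Bx; have := sB.2 a x 0 Bx submod0; rewrite addr0. Qed.
Lemma submodN x : B x -> B (- x).
Proof. by rewrite -scaleN1r; apply: submodZ. Qed.
Lemma submodB x y : B x -> B y -> B (x - y).
Proof. by move=> Bx /submodN; apply: submodD. Qed.
Lemma submod_sum (I : Type) (r : seq I) (P : pred I) (F : I -> X) :
  (forall i, P i -> B (F i)) -> B (\sum_(i <- r | P i) F i).
Proof. by move=> BF; apply: big_ind => //; [exact: submod0|exact: submodD]. Qed.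
Lemma submod_sum_seq (I : eqType) (r : seq I) (F : I -> X) :
  (forall i, i \in r -> B (F i)) -> B (\sum_(i <- r) F i).
Proof. by move=> BF; rewrite big_seq; apply: submod_sum. Qed.
Lemma submod_subK x y : B (x - y) -> B y -> B x.
Proof. by move=> Bxy By; rewrite -(subrK y x); apply: submodD. Qed.
End SubmodTheory.

End Submodules.

Section LocalRing.
Variables (R : comUnitRingType) (k : fieldType) (res : {rmorphism R -> k}).
Hypothesis hR : noetherian_local res.

Lemma res_neq0_unit r : res r != 0 -> r \is a GRing.unit.
Proof.
by move=> r0; apply: contraT => /(res_ker hR) re; rewrite re eqxx in r0.
Qed.

Lemma res_lift : exists l : k -> R, cancel l res.
Proof. by have /choice[l lP] := res_surj hR; exists l. Qed.

Section Dimension.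
Implicit Types X Y W : lmodType R.

Definition indep X (B : X -> Prop) (I : finType) (S : {set I}) (g : I -> X) :=
  forall c : I -> R, B (\sum_(i in S) c i *: g i) -> forall i, i \in S -> res (c i) = 0.

(* An upper bound for the dimension of [Z/B], meaningful even when [Z/B] is not
   a vector space over [k]: it bounds the number of elements of [Z] all of
   whose relations modulo [B] have their coefficients in the maximal ideal. *)
Definition dimle X (Z B : X -> Prop) (n : nat) : Prop :=
  forall (I : finType) (S : {set I}) (g : I -> X),
    (forall i, i \in S -> Z (g i)) -> indep B S g -> (#|S| <= n)%N.

(** Unlike [dimle], this makes Z/B a vector space over k with coordinates indexed by the list [S].
    The coordinate function is constrained only on [Z] and on [S], which avoids subtypes for
    both. *)
Definition dimeq X (Z B : X -> Prop) (J : eqType) (S : seq J) : Prop :=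
  exists phi : X -> J -> k,
    [/\ (forall a x y, Z x -> Z y ->
           forall s, s \in S -> phi (a *: x + y) s = res a * phi x s + phi y s),
        (forall w : J -> k, exists2 x, Z x & forall s, s \in S -> phi x s = w s)
      & forall x, Z x -> (B x <-> forall s, s \in S -> phi x s = 0)].

Lemma dimle_mono X (Z B Z' B' : X -> Prop) n n' :
  (forall x, Z' x -> Z x) -> (forall x, B x -> B' x) -> (n <= n')%N ->
  dimle Z B n -> dimle Z' B' n'.
Proof.
move=> ZZ BB nn D I S g Zg ig; apply: leq_trans nn.
by apply: (D I S g) => [i /Zg /ZZ //|c /BB]; exact: ig.
Qed.

Lemma dimle_triv X (Z B : X -> Prop) : submod B -> (forall x, Z x -> B x) -> dimle Z B 0.
Proof.
move=> sB ZB I S g Zg ig; rewrite leqn0 cards_eq0; apply/eqP/setP => i.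
rewrite inE; apply/negP => iS.
have := ig (fun=> 1) _ i iS; rewrite rmorph1 => /(_ _)/eqP; rewrite oner_eq0 => H.
by apply: notF; apply: H; apply: submod_sum => // j jS; rewrite scale1r; apply/ZB/Zg.
Qed.

(* A maximal subfamily [S'] whose image in [C] is independent has size at most
   [c]; correcting the other members by it moves them to the image of [A]. *)
Lemma dimle_exact X Y W (f : {linear X -> Y}) (g : {linear Y -> W})
    (ZA BA : X -> Prop) (ZB BB : Y -> Prop) (ZC BC : W -> Prop) a c :
  submod BB -> submod BC ->
  (forall x, BA x -> BB (f x)) ->
  (forall y, ZB y -> ZC (g y)) -> submod ZB ->
  (forall r w, res r = 0 -> ZC w -> BC (r *: w)) ->
  (forall y, ZB y -> BC (g y) -> exists2 x, ZA x & BB (y - f x)) ->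
  dimle ZA BA a -> dimle ZC BC c -> dimle ZB BB (a + c).
Proof.
move=> sBB sBC fB gZ sZB kC ex dA dC I S y Zy iy.
pose P (T : {set I}) := (T \subset S) && `[< indep BC T (g \o y) >].
have P0 : P finset.set0.
  by rewrite /P finset.sub0set; apply/asboolP => ? _ i; rewrite inE.
have [T /maxsetP[/andP[TS /asboolP iT] maxT]] := ex_maxset (ex_intro P _ P0).
have cT : (#|T| <= c)%N.
  by apply: (dC _ _ (g \o y)) => // i iT'; apply/gZ/Zy/(fintype.subsetP TS).
(* Maximality of [T] gives a relation modulo [BC] on [T] and [i] together. Divided by its
   coefficient at [i], it corrects [y i] by elements of [T] into something coming from [X]. *)
have key i : exists x : X * (I -> R), i \in S :\: T ->
    ZA x.1 /\ BB (y i + \sum_(j in T) x.2 j *: y j - f x.1).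
  have [iST|_] := boolP (i \in S :\: T); last by exists (0, fun=> 0).
  move: (iST); rewrite inE => /andP[iNT iS].
  have nP : ~ indep BC (i |: T) (g \o y).
    move=> iiT; have /maxT : P (i |: T).
      by apply/andP; split; [rewrite finset.subUset finset.sub1set iS|apply/asboolP].
    by move=> /(_ (finset.subsetUr _ _)) eT; rewrite -eT finset.setU11 in iNT.
  have [d [Bd nd]] : exists d : I -> R, BC (\sum_(j in i |: T) d j *: (g \o y) j) /\
     exists2 j, j \in i |: T & res (d j) != 0.
    apply: contrapT => nd; apply: nP => d Bd j jT; apply/eqP/negP => /negP rj.
    by apply: nd; exists d; split => //; exists j.
  rewrite (big_setU1 _ iNT) /= in Bd.
  (* A non-unit coefficient at [i] could be dropped, since the maximal ideal kills [ZC] modulo [BC];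
     this would leave a relation on the independent family [T] with a unit coefficient. *)
  have ui : d i \is a GRing.unit.
    apply: res_neq0_unit; apply/eqP => rdi; case: nd => j; rewrite !inE.
    case/orP=> [/eqP->|jT]; first by rewrite rdi eqxx.
    rewrite (iT d) ?eqxx //.
    have := submodB sBC Bd (kC _ _ rdi (gZ _ (Zy i iS))).
    by rewrite addrAC subrr add0r.
  pose e j := (d i)^-1 * d j.
  have ZBi : ZB (y i + \sum_(j in T) e j *: y j).
    apply: submodD => //; first exact: Zy.
    by apply: submod_sum => // j /(fintype.subsetP TS) jS; apply: submodZ => //; exact: Zy.
  have [|x Zx Bx] := ex _ ZBi; last by exists (x, e).
  have := submodZ sBC (d i)^-1 Bd.
  rewrite scalerDr scalerA mulVr // scale1r scaler_sumr linearD linear_sum.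
  by under eq_bigr do rewrite scalerA; under [X in _ -> BC (_ + X)]eq_bigr do rewrite linearZ.
have /choice[x xP] := key.
rewrite -(cardsID T S) addnC leq_add //; last first.
  by rewrite (leq_trans _ cT) // subset_leq_card // finset.subsetIr.
apply: (dA _ _ (fun i => (x i).1)) => [i /xP[] //|l Bl i iST].
(* A relation among the corrected elements becomes one among the original [y], the coefficients on
   [T] collecting the corrections. *)
pose l' i := if i \in T then \sum_(j in S :\: T) l j * (x j).2 i else l i.
have := iy l' _ i; rewrite /l'; move: (iST); rewrite inE => /andP[/negPf-> iS].
apply=> //; rewrite (big_setID T) /= (finset.setIidPr TS) addrC.
have -> : \sum_(j in S :\: T) l' j *: y j + \sum_(j in T) l' j *: y j =
    \sum_(j in S :\: T) l j *: (y j + \sum_(i in T) (x j).2 i *: y i - f (x j).1)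
    + f (\sum_(j in S :\: T) l j *: (x j).1).
  rewrite linear_sum /= -big_split /=.
  under [RHS]eq_bigr do rewrite linearZ /= -scalerDr subrK scalerDr scaler_sumr.
  rewrite big_split /= exchange_big /=; congr (_ + _).
    by apply: eq_bigr => j; rewrite inE /l' => /andP[/negPf->].
  apply: eq_bigr => j jT; rewrite /l' jT scaler_suml.
  by apply: eq_bigr => i0 _; rewrite scalerA.
apply: submodD => //; last exact: fB.
by apply: submod_sum => // j jST; apply: submodZ => //; have [] := xP j jST.
Qed.

(** A matrix over k with more rows than columns has a nonzero left kernel vector; its entries are
    lifted to R so that they can act on module elements. *)
Lemma exists_row_relation (I : finType) (S : {set I}) n (w : I -> 'I_n -> k) :
  (n < #|S|)%N -> exists c : I -> R,
    (forall j, \sum_(i in S) res (c i) * w i j = 0) /\ exists2 i, i \in S & res (c i) != 0.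
Proof.
move=> nS; have [l lK] := res_lift.
pose A := \matrix_(a < #|S|, b < n) w (enum_val a) b.
have : ~~ row_free A by rewrite -row_leq_rank -ltnNge (leq_ltn_trans (rank_leq_col A)).
rewrite -kermx_eq0 => /rowV0Pn[v /sub_kermxP vA v0].
have [a va] : exists a, v 0 a != 0.
  by move/eqP/rowP/existsNP: v0 => [a /eqP va]; exists a; rewrite mxE in va.
have [i0 i0S] : exists i0, i0 \in S by exists (enum_val a); exact: enum_valP.
exists (fun i => l (v 0 (enum_rank_in i0S i))); split; last first.
  by exists (enum_val a); [exact: enum_valP|rewrite enum_valK_in lK].
move=> j; have /rowP/(_ j) := vA; rewrite !mxE => {2}<-.
rewrite (reindex_onto (enum_val (A := mem S)) (enum_rank_in i0S)) /=; last first.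
  by move=> i iS; rewrite enum_rankK_in.
apply: eq_big => [b|b _]; first by rewrite enum_valP enum_valK_in eqxx.
by rewrite lK enum_valK_in mxE.
Qed.

(** If there were more than [n] elements, some combination of them with a unit coefficient would
    have all its coordinates on the [g j] in the maximal ideal, hence lie in [B]. *)
Lemma dimle_span X (Z B : X -> Prop) n (g : 'I_n -> X) :
  submod B -> (forall i, Z (g i)) ->
  (forall r x, res r = 0 -> Z x -> B (r *: x)) ->
  (forall x, Z x -> exists c : 'I_n -> R, B (x - \sum_i c i *: g i)) ->
  dimle Z B n.
Proof.
move=> sB Zg kB sp I S y Zy iy; rewrite leqNgt; apply/negP => nS.
have /choice[c cP] : forall i, exists c : 'I_n -> R,
    i \in S -> B (y i - \sum_j c j *: g j).
  move=> i; have [/Zy/sp[c Bc]|_] := boolP (i \in S); first by exists c.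
  by exists (fun=> 0).
have [d [dc [i iS]]] := exists_row_relation (fun i j => res (c i j)) nS.
rewrite (iy d) ?eqxx //; apply: (submod_subK sB (y := \sum_(i in S) d i *: \sum_j c i j *: g j)).
  rewrite -sumrB; apply: submod_sum => // i' i'S.
  by rewrite -scalerBr; apply: submodZ => //; apply: cP.
under eq_bigr do rewrite scaler_sumr.
rewrite exchange_big /=; apply: submod_sum => // j _.
under eq_bigr do rewrite scalerA; rewrite -scaler_suml.
apply: kB => //; rewrite raddf_sum /= -[RHS](dc j).
by apply: eq_bigr => i' _; rewrite rmorphM.
Qed.

Lemma dimeq_linear_comb X (Z B : X -> Prop) (phi : X -> k) (I : finType) (S : {set I})
    (c : I -> R) (g : I -> X) :
  submod Z -> (forall a x y, Z x -> Z y -> phi (a *: x + y) = res a * phi x + phi y) ->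
  (forall i, i \in S -> Z (g i)) ->
  phi (\sum_(i in S) c i *: g i) = \sum_(i in S) res (c i) * phi (g i).
Proof.
move=> sZ lin Zg.
have phi0 : phi 0 = 0.
  by have := lin (-1) 0 0 (submod0 sZ) (submod0 sZ); rewrite scaler0 addr0 rmorphN1 mulN1r addNr.
suff [_ //] : Z (\sum_(i in S) c i *: g i) /\
   phi (\sum_(i in S) c i *: g i) = \sum_(i in S) res (c i) * phi (g i).
apply: (big_ind2 (fun x y => Z x /\ phi x = y)) => //; first by split; first exact: submod0.
  move=> x a y b [Zx <-] [Zy <-]; split; first exact: submodD.
  by rewrite -[x]scale1r lin // rmorph1 mul1r scale1r.
move=> i /Zg Zi; split; first exact: submodZ.
by have := lin (c i) (g i) 0 Zi (submod0 sZ); rewrite addr0 phi0 addr0.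
Qed.

Lemma dimeq_le X (Z B : X -> Prop) (J : eqType) (S : seq J) :
  submod Z -> dimeq Z B S -> dimle Z B (size S).
Proof.
move=> sZ [phi [lin _ ker]] I T g Zg ig; rewrite leqNgt; apply/negP => nS.
have [c [cg [i iT]]] := exists_row_relation (fun i j => phi (g i) (tnth (in_tuple S) j)) nS.
rewrite (ig c) ?eqxx //; apply/ker.
  by apply: submod_sum => // i' /Zg; exact: submodZ.
move=> s sS; have /tnthP[j ->] : s \in in_tuple S by [].
by rewrite (@dimeq_linear_comb _ Z B (phi^~ _)) //= => a x y Zx Zy; rewrite lin ?mem_tnth.
Qed.

Lemma dimeq_ge X (Z B : X -> Prop) (J : eqType) (S : seq J) n :
  submod Z -> uniq S -> dimeq Z B S -> dimle Z B n -> (size S <= n)%N.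
Proof.
move=> sZ uS [phi [lin srj ker]] D.
have /choice[g gP] : forall j, exists x, Z x /\ forall s, s \in S -> phi x s = (s == j)%:R.
  by move=> j; have [x] := srj (fun s => (s == j)%:R); exists x.
have := D _ [set: 'I_(size S)] (fun i => g (tnth (in_tuple S) i)).
rewrite cardsT card_ord; apply; first by move=> i _; have [] := gP (tnth (in_tuple S) i).
have Zg i : Z (g (tnth (in_tuple S) i)) by have [] := gP (tnth (in_tuple S) i).
move=> c Bc i _.
have Zs : Z (\sum_(i in [set: 'I_(size S)]) c i *: g (tnth (in_tuple S) i)).
  by apply: submod_sum => // j _; apply: submodZ.
have := (ker _ Zs).1 Bc _ (mem_tnth i (in_tuple S)).
rewrite (@dimeq_linear_comb _ Z B (phi^~ _)) //=; last first.
  by move=> a x y Zx Zy; rewrite lin ?mem_tnth.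
rewrite (bigD1 i) ?inE //= (gP _).2 ?mem_tnth // eqxx mulr1 big1 ?addr0 // => j /andP[_ ji].
rewrite (gP _).2 ?mem_tnth // (inj_eq (tuple_uniqP (in_tuple S) uS)).
by rewrite eq_sym (negPf ji) mulr0.
Qed.

End Dimension.
End LocalRing.

(** * Quotient modules *)

Section QuotientModule.
Variables (R : comUnitRingType) (X : lmodType R) (B : X -> Prop).
Hypothesis sB : submod B.

Definition subpred : {pred X} := fun x => `[< B x >].
Fact subpredP x : reflect (B x) (x \in subpred).
Proof. exact: asboolP. Qed.
Fact subpred_zmod : zmod_closed subpred.
Proof.
split=> [|x y /subpredP Bx /subpredP By]; apply/subpredP; first exact: submod0.
exact: submodB.
Qed.
HB.instance Definition _ := GRing.isZmodClosed.Build X subpred subpred_zmod.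

Definition quotient_module := Quotient.quot subpred.
HB.instance Definition _ := GRing.Zmodule.on quotient_module.

Local Notation Q := quotient_module.
Definition qpi (x : X) : Q := (\pi_(Quotient.quot subpred) x)%qT.
Definition qscale (r : R) (q : Q) : Q := qpi (r *: repr q).

Fact qpi_eq0 x : qpi x = 0 <-> B x.
Proof.
have -> : (0 : Q) = qpi 0 by rewrite /qpi raddf0.
rewrite /qpi; split => [/eqP|Bx].
  by rewrite -Quotient.idealrBE subr0 => /subpredP.
by apply/eqP; rewrite -Quotient.idealrBE subr0; apply/subpredP.
Qed.
Fact qpiB x y : qpi (x - y) = qpi x - qpi y. Proof. exact: raddfB. Qed.
Fact qpiD x y : qpi (x + y) = qpi x + qpi y. Proof. exact: raddfD. Qed.
Fact qpi_repr q : qpi (repr q) = q. Proof. exact: reprK. Qed.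
Fact qpi_eq x y : B (x - y) -> qpi x = qpi y.
Proof. by move/qpi_eq0; rewrite qpiB => /eqP; rewrite subr_eq0 => /eqP. Qed.
Fact qscaleE r x : qscale r (qpi x) = qpi (r *: x).
Proof.
apply: qpi_eq; rewrite -scalerBr; apply: submodZ => //.
by apply/qpi_eq0; rewrite qpiB qpi_repr subrr.
Qed.

Fact qscaleA a b q : qscale a (qscale b q) = qscale (a * b) q.
Proof. by rewrite -(qpi_repr q) !qscaleE scalerA. Qed.
Fact qscale1 : left_id 1 qscale.
Proof. by move=> q; rewrite -(qpi_repr q) qscaleE scale1r. Qed.
Fact qscaleDr : right_distributive qscale +%R.
Proof. by move=> a p q; rewrite -(qpi_repr p) -(qpi_repr q) -qpiD !qscaleE scalerDr qpiD. Qed.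
Fact qscaleDl q : {morph qscale^~ q : a b / a + b}.
Proof. by move=> a b; rewrite -(qpi_repr q) !qscaleE scalerDl qpiD. Qed.
HB.instance Definition _ :=
  GRing.Zmodule_isLmodule.Build R Q qscaleA qscale1 qscaleDr qscaleDl.

Fact qpi_linear : linear qpi.
Proof. by move=> a x y; rewrite qpiD -qscaleE. Qed.
HB.instance Definition _ := GRing.isLinear.Build R X Q *:%R qpi qpi_linear.

End QuotientModule.

Lemma exists_quotient (R : comUnitRingType) (X : lmodType R) (B : X -> Prop) :
  submod B -> exists (Q : lmodType R) (p : {linear X -> Q}),
    (forall q, exists x, p x = q) /\ forall x, p x = 0 <-> B x.
Proof.
move=> sB; exists (quotient_module sB), (qpi sB); split; last exact: qpi_eq0.
by move=> q; exists (repr q); exact: qpi_repr.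
Qed.

(** * Minimal free resolutions over a Noetherian local ring *)

Section Resolutions.
Variables (R : comUnitRingType) (k : fieldType) (res : {rmorphism R -> k}).
Hypothesis hR : noetherian_local res.

(** Induction on [n]: the first coordinates of the elements of [Z] form an ideal, the elements with
    first coordinate 0 form a submodule of a smaller free module, and generators of both are put
    together. *)
Lemma fg_submod_row n (Z : 'rV[R]_n -> Prop) : submod Z ->
  exists m (g : 'M[R]_(m, n)), forall v, Z v <-> exists w, v = w *m g.
Proof.
elim: n Z => [|n IH] Z sZ.
  exists 0, 0 => v; split => _; first by exists 0; apply/rowP => -[].
  by rewrite (_ : v = 0); [exact: submod0|apply/rowP => -[]].
change ('rV[R]_(1 + n) -> Prop) in Z; change (@submod R 'rV[R]_(1 + n) Z) in sZ.
change (exists m (g : 'M[R]_(m, 1 + n)), forall v : 'rV_(1 + n), Z v <-> exists w, v = w *m g).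
pose I (a : R) := exists u, Z (row_mx a%:M u).
have [|p [a [Ia gen]]] := ideal_fg hR (I := I).
  split; first by exists 0; rewrite raddf0 row_mx0; exact: submod0.
  move=> a x y [u Zu] [v Zv]; exists (a *: u + v).
  by rewrite raddfD /= -scale_scalar_mx -add_row_mx -scale_row_mx; apply: sZ.2.
have /choice[u Zu] := Ia.
have [|q [g gP]] := IH (fun v => Z (row_mx 0 v)).
  split; first by rewrite row_mx0; exact: submod0.
  move=> c x y Zx Zy; have := sZ.2 c _ _ Zx Zy.
  by rewrite scale_row_mx add_row_mx scaler0 addr0.
pose A := \matrix_(i < p) row_mx (a i)%:M (u i).
exists (p + q)%N, (col_mx A (row_mx 0 g)) => v; split => [Zv|[w ->]]; last first.
  rewrite -[w]hsubmxK mul_row_col; apply: submodD => //.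
    rewrite mulmx_sum_row; apply: submod_sum => // i _; apply: submodZ => //.
    by rewrite rowK; exact: Zu.
  by rewrite mul_mx_row mulmx0; apply/gP; exists (rsubmx w).
have [|c ec] := gen (lsubmx v 0 0).
  by exists (rsubmx v); rewrite -mx11_scalar hsubmxK.
pose w0 := \row_i c i.
have Z1 : Z (v - w0 *m A).
  apply: submodB => //; rewrite mulmx_sum_row; apply: submod_sum => // i _.
  by apply: submodZ => //; rewrite rowK; exact: Zu.
have l0 : lsubmx (v - w0 *m A) = 0.
  rewrite [LHS]mx11_scalar -[RHS](raddf0 (@scalar_mx R 1)); congr (_%:M).
  rewrite linearB /= [LHS]mxE ec.
  apply/eqP; rewrite [X in _ + X]mxE subr_eq0 !mxE; apply/eqP.
  apply: eq_bigr => i _; rewrite !mxE; congr (_ * _).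
  by case: splitP => // j _; rewrite ord1 mxE eqxx.
have /gP[w1 ew1] : Z (row_mx 0 (rsubmx (v - w0 *m A))) by rewrite -l0 hsubmxK.
exists (row_mx w0 w1); rewrite mul_row_col mul_mx_row mulmx0 -ew1 -l0 hsubmxK.
by rewrite addrC subrK.
Qed.

(** A relation with a unit coefficient would express one generator by the others, against the
    minimality of their number. *)
Lemma min_gens_row n (Z : 'rV[R]_n -> Prop) : submod Z ->
  exists m (g : 'M[R]_(m, n)), (forall v, Z v <-> exists w : 'rV_m, v = w *m g) /\
    forall w : 'rV_m, w *m g = 0 -> forall i, res (w 0 i) = 0.
Proof.
move=> sZ; pose P m := `[< exists g : 'M[R]_(m, n), forall v, Z v <-> exists w : 'rV_m, v = w *m g >].
have exP : exists m, P m.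
  by have [m [g gP]] := fg_submod_row sZ; exists m; apply/asboolP; exists g.
case: (ex_minnP exP) => m /asboolP[g gP] minm; exists m, g; split=> // w w0 i.
apply/eqP; apply: contraT => /(res_neq0_unit hR) ui; exfalso.
case: m i g w gP minm w0 ui => [[] //|m] i g w gP minm w0 ui.
suff /minm : P m by rewrite ltnn.
have sum_lift (u : 'rV[R]_m.+1) : u *m g = u 0 i *: row i g + col' i u *m row' i g.
  rewrite mulmx_sum_row (bigD1_ord i) //=; congr (_ + _).
  by rewrite mulmx_sum_row; apply: eq_bigr => j _; rewrite mxE row_rowsub.
apply/asboolP; exists (row' i g) => v; rewrite gP; split=> [[u ->]|[u ->]].
  pose u' := u - (u 0 i / w 0 i) *: w; exists (col' i u').
  have : u' *m g = u *m g by rewrite mulmxBl -scalemxAl w0 scaler0 subr0.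
  by rewrite sum_lift !mxE divrK // subrr scale0r add0r.
exists (\row_j oapp (u 0) 0 (unlift i j)); rewrite sum_lift mxE unlift_none scale0r add0r.
by congr (_ *m _); apply/rowP => j; rewrite !mxE liftK.
Qed.

(** The state of the iteration is the last differential together with its size, since the size
    changes at each step. As [syz_next] reuses the number of rows as number of columns, consecutive
    ranks agree by computation and [syz_diff] is well typed. *)
Definition syz_state := {ba : nat * nat & 'M[R]_(ba.1, ba.2)}.

Lemma exists_syz (s : syz_state) : exists mg : {m : nat & 'M[R]_(m, (projT1 s).1)},
  (forall v : 'rV_(projT1 s).1, v *m projT2 s = 0 <-> exists w : 'rV_(projT1 mg), v = w *m projT2 mg) /\
  forall w : 'rV_(projT1 mg), w *m projT2 mg = 0 -> forall i, res (w 0 i) = 0.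
Proof.
case: s => [[b a] D] /=.
have [|m [g gP]] := @min_gens_row _ (fun v => v *m D = 0).
  by split=> [|c x y Dx Dy]; rewrite ?mul0mx // mulmxDl -scalemxAl Dx Dy scaler0 addr0.
by exists (existT _ m g).
Qed.

Definition syz_next (s : syz_state) : syz_state :=
  let mg := projT1 (cid (exists_syz s)) in
  existT _ (projT1 mg, (projT1 s).1) (projT2 mg).

Definition syz_rank s n := (projT1 (iter n syz_next s)).2.
Definition syz_diff s n : 'M[R]_(syz_rank s n.+1, syz_rank s n) :=
  projT2 (iter n syz_next s).

Lemma syz_exact s n (v : 'rV_(syz_rank s n.+1)) : v *m syz_diff s n = 0 <-> exists w : 'rV_(syz_rank s n.+2), v = w *m syz_diff s n.+1.
Proof. exact: (projT2 (cid (exists_syz (iter n syz_next s)))).1. Qed.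

Definition min_presentation (s : syz_state) :=
  forall w : 'rV_(projT1 s).1, w *m projT2 s = 0 -> forall i, res (w 0 i) = 0.

(** Each row of a differential is a relation among the rows of the preceding one, whose relations
    have coefficients in the maximal ideal. *)
Lemma syz_minimal s n i j : min_presentation s -> res (syz_diff s n.+1 i j) = 0.
Proof.
move=> ms; have mn : min_presentation (iter n syz_next s).
  by case: n {i j} => // n; exact: (projT2 (cid (exists_syz (iter n syz_next s)))).2.
have := mn (row i (syz_diff s n.+1)) _ j; rewrite mxE; apply.
by apply/syz_exact; exists (delta_mx 0 i); rewrite rowE.
Qed.

Definition row_comb (M : lmodType R) n (g : 'I_n -> M) (v : 'rV[R]_n) : M :=
  \sum_i v 0 i *: g i.
Fact row_comb_linear (M : lmodType R) n (g : 'I_n -> M) : linear (row_comb g).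
Proof.
move=> a u v; rewrite /row_comb scaler_sumr -big_split; apply: eq_bigr => i _ /=.
by rewrite !mxE scalerDl scalerA.
Qed.
HB.instance Definition _ (M : lmodType R) n (g : 'I_n -> M) :=
  GRing.isLinear.Build R 'rV[R]_n M *:%R (row_comb g) (row_comb_linear g).

(** With as few generators as possible in every degree, a unit entry in a differential would make a
    generator redundant. *)
Lemma exists_minimal_resolution (M : lmodType R) : finitely_generated M ->
  exists F : free_resolution M, forall i a b, res (fr_diff F i a b) = 0.
Proof.
move=> fgM; pose P n := `[< exists g : 'I_n -> M,
  forall x, exists c : 'I_n -> R, x = \sum_i c i *: g i >].
have exP : exists n, P n by case: fgM => n H; exists n; apply/asboolP.
case: (ex_minnP exP) => n /asboolP[g gP] minn.
have ming (w : 'rV_n) : row_comb g w = 0 -> forall i, res (w 0 i) = 0.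
  move=> w0 i; apply/eqP; apply: contraT => /(res_neq0_unit hR) ui; exfalso.
  case: n i g w gP minn w0 ui => [[] //|n] i g w gP minn w0 ui.
  suff /minn : P n by rewrite ltnn.
  apply/asboolP; exists (g \o lift i) => x; have [c ->] := gP x.
  exists (fun j => c (lift i j) - c i / w 0 i * w 0 (lift i j)).
  have := w0; rewrite /row_comb (bigD1_ord i) //= => e0.
  rewrite (bigD1_ord i) //= -[c i](divrK ui) -scalerA -(addr0_eq (etrans (addrC _ _) e0)).
  rewrite scalerN scaler_sumr addrC -sumrB.
  by apply: eq_bigr => j _; rewrite divrK // scalerBl scalerA.
have sK : submod (fun v => row_comb g v = 0).
  split=> [|a x y /= x0 y0]; first exact: linear0.
  by rewrite linearP /= x0 y0 scaler0 addr0.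
have [m [D [DP minD]]] := min_gens_row sK.
pose s : syz_state := existT _ (m, n) D.
have ex0 v : row_comb g v = 0 <-> exists w, v = w *m syz_diff s 0 by exact: DP.
have srj y : exists v, row_comb g v = y.
  have [c ->] := gP y; exists (\row_i c i).
  by apply: eq_bigr => i _; rewrite mxE.
exists (@FreeResolution _ M (syz_rank s) (syz_diff s) (row_comb g) srj ex0 (@syz_exact s)).
case=> [|i] a b /=; last exact: syz_minimal.
have := ming (row a D) _ b; rewrite mxE; apply.
by apply/DP; exists (delta_mx 0 a); rewrite rowE.
Qed.

Lemma fg_submod (M : lmodType R) n (h : 'I_n -> M) (Z : M -> Prop) : submod Z ->
  (forall x, Z x -> exists c : 'I_n -> R, x = \sum_i c i *: h i) ->
  exists m (g : 'I_m -> M), (forall i, Z (g i)) /\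
    forall x, Z x -> exists c : 'I_m -> R, x = \sum_i c i *: g i.
Proof.
move=> sZ gen; have [|m [g gP]] := @fg_submod_row n (fun v => Z (row_comb h v)).
  split=> [|a x y Zx Zy]; first by rewrite linear0; exact: submod0.
  by rewrite linearP /=; apply: sZ.2.
exists m, (fun i => row_comb h (row i g)); split=> [i|x Zx].
  by apply/gP; exists (delta_mx 0 i); rewrite rowE.
have [c ec] := gen x Zx.
have ex : x = row_comb h (\row_i c i).
  by rewrite ec; apply: eq_bigr => i _; rewrite mxE.
have /gP[w ew] : Z (row_comb h (\row_i c i)) by rewrite -ex.
exists (w 0); rewrite ex ew mulmx_sum_row linear_sum.
by apply: eq_bigr => i _; rewrite linearZ.
Qed.

End Resolutions.

(** * Complexes of free modules *)

Section FreeComplexes.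
Variable R : comUnitRingType.

(* A complex of finite free modules: [fib n] is a basis in degree [n], and
   [cD s t] is the coefficient of [t] in the differential of [s].  A function
   [ix W -> M] stands for an element of the tensor product of [W] and [M]. *)
Record cx := Cx {
  ix : eqType;
  cdeg : ix -> nat;
  fib : nat -> seq ix;
  cD : ix -> ix -> R;
  fib_uniq : forall n, uniq (fib n);
  fib_deg : forall n t, t \in fib n -> cdeg t = n;
  cDD : forall n s u, s \in fib n.+2 -> u \in fib n ->
    \sum_(t <- fib n.+1) cD s t * cD t u = 0 }.

Section Coefficients.
Variables (W : cx) (M : lmodType R).
Implicit Types y w : ix W -> M.

Definition dn n y (t : ix W) : M := \sum_(s <- fib W n.+1) cD s t *: y s.

(** An element of degree [n] is a function on the whole index type of which only the values on
    [fib W n] count; hence the congruence lemmas [Cyc_eq] and [Bnd_eq]. *)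
Definition Cyc n y : Prop :=
  if n is n'.+1 then forall t, t \in fib W n' -> dn n' y t = 0 else True.
Definition Bnd n y : Prop := exists w, forall t, t \in fib W n -> y t = dn n w t.

Lemma eq_dn n y w t : (forall s, s \in fib W n.+1 -> y s = w s) -> dn n y t = dn n w t.
Proof. by move=> e; apply: eq_big_seq => s /e ->. Qed.

Lemma dn_linear n : linear (dn n).
Proof.
move=> a y w; apply/funext => t; rewrite /dn [RHS]/GRing.add /= [in RHS]/GRing.scale /=.
rewrite scaler_sumr -big_split /=; apply: eq_bigr => s _.
by rewrite scalerDr !scalerA mulrC.
Qed.
Lemma dnP n a y w t : dn n (a *: y + w) t = a *: dn n y t + dn n w t.
Proof. by rewrite dn_linear. Qed.
Lemma dn0 n t : dn n 0 t = 0.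
Proof. by rewrite /dn big1 // => s _; rewrite scaler0. Qed.

Lemma dnZ n a y t : dn n (a *: y) t = a *: dn n y t.
Proof. by rewrite -[a *: y]addr0 dnP dn0 addr0. Qed.

Lemma dn_dn n y t : t \in fib W n -> dn n (dn n.+1 y) t = 0.
Proof.
move=> tn; rewrite /dn; under eq_bigr do rewrite scaler_sumr.
rewrite exchange_big big_seq big1 // => u un.
under eq_bigr do rewrite scalerA; rewrite -scaler_suml.
rewrite (_ : \sum_(s <- _) _ = 0) ?scale0r // -[RHS](cDD un tn).
by apply: eq_bigr => s _; rewrite mulrC.
Qed.

Lemma submod_Cyc n : submod (Cyc n).
Proof.
case: n => [|n]; split=> // [t _|a y w Cy Cw t tn]; first exact: dn0.
by rewrite dnP Cy // Cw // scaler0 addr0.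
Qed.

Lemma submod_Bnd n : submod (Bnd n).
Proof.
split; first by exists 0 => t _; rewrite dn0.
by move=> a y y' [w yw] [w' yw']; exists (a *: w + w') => t tn; rewrite dnP -yw // -yw'.
Qed.

Lemma Cyc_eq n y w : (forall t, t \in fib W n -> y t = w t) -> Cyc n y -> Cyc n w.
Proof. by case: n => // n e Cy t tn; rewrite -(Cy t tn); apply: eq_dn => s /e ->. Qed.
Lemma Bnd_eq n y w : (forall t, t \in fib W n -> y t = w t) -> Bnd n y -> Bnd n w.
Proof. by move=> e [z ez]; exists z => t tn; rewrite -e // ez. Qed.
Lemma Bnd_Cyc n y : Bnd n y -> Cyc n y.
Proof.
case: n => // n [w yw] t tn; rewrite -[RHS](dn_dn w tn).
by apply: eq_dn => s /yw.
Qed.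

End Coefficients.

Definition exact_at (W : cx) (M : lmodType R) n := forall y, @Cyc W M n y -> Bnd n y.

Record resolves (W : cx) (N : lmodType R) (e : ix W -> N) : Prop := Resolves {
  rs_surj : forall x : N, exists c : ix W -> R, x = \sum_(t <- fib W 0) c t *: e t;
  rs_ker : forall c : ix W -> R, \sum_(t <- fib W 0) c t *: e t = 0 <-> @Bnd W R^o 0 c;
  rs_exact : forall n, exact_at W R^o n.+1 }.

(** * Total complexes and the balancing of Tor *)

Section Total.
Variables (A B : cx) (ta si : nat -> nat -> R).

(* [ta] and [si] are the signs in front of the two partial differentials. *)
Definition good_signs := forall i j,
  [/\ ta i j * ta i j = 1, si i j * si i j = 1 & si i.+1 j * ta i j + ta i j.+1 * si i j = 0].

Implicit Types z w : ix A -> ix B -> R^o.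

Definition dA i z a b : R^o := dn i (fun a' => z a' b) a.
Definition dB j z a b : R^o := dn j (z a) b.
Definition dTot i j z a b := ta i j * dA i z a b + si i j * dB j z a b.

Definition tcyc n z := forall i j, (i + j).+1 = n ->
  forall a b, a \in fib A i -> b \in fib B j -> dTot i j z a b = 0.
Definition tbnd n z := exists w, forall i j, (i + j)%N = n ->
  forall a b, a \in fib A i -> b \in fib B j -> z a b = dTot i j w a b.

Hypothesis sgn : good_signs.

Lemma dA_dB i j z a b : dA i (dB j z) a b = dB j (dA i z) a b.
Proof.
rewrite /dA /dB /dn; under eq_bigr do rewrite scaler_sumr.
rewrite exchange_big /=; apply: eq_bigr => s _; rewrite scaler_sumr.
by apply: eq_bigr => s' _; rewrite !scalerA mulrC.
Qed.

Lemma dTot_eq i j z w a b : a \in fib A i -> b \in fib B j ->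
  (forall a', a' \in fib A i.+1 -> z a' b = w a' b) ->
  (forall b', b' \in fib B j.+1 -> z a b' = w a b') ->
  dTot i j z a b = dTot i j w a b.
Proof.
by move=> ai bj e e'; rewrite /dTot /dA /dB (eq_dn _ e) (eq_dn _ e').
Qed.

Lemma dTotP i j c z w a b :
  dTot i j (c *: z + w) a b = c * dTot i j z a b + dTot i j w a b.
Proof.
rewrite /dTot /dA /dB.
have -> : (fun a' => (c *: z + w) a' b) = c *: (fun a' => z a' b) + (fun a' => w a' b) by [].
have -> : (c *: z + w) a = c *: z a + w a by [].
by rewrite !dnP /GRing.scale /=; ring.
Qed.

Lemma tcycP n c z w : tcyc n z -> tcyc n w -> tcyc n (c *: z + w).
Proof. by move=> Cz Cw i j e a b ai bj; rewrite dTotP Cz // Cw // mulr0 addr0. Qed.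

Lemma tbndP n c z w : tbnd n z -> tbnd n w -> tbnd n (c *: z + w).
Proof.
move=> [z' Ez] [w' Ew]; exists (c *: z' + w') => i j e a b ai bj.
by rewrite dTotP -(Ez i j) // -(Ew i j).
Qed.

(** The bidegree is read off from the indices, so that one function serves for the total
    differential in all bidegrees. *)
Definition dtot w : ix A -> ix B -> R^o := fun a b => dTot (cdeg a) (cdeg b) w a b.

Lemma dtotE i j w a b : a \in fib A i -> b \in fib B j -> dtot w a b = dTot i j w a b.
Proof. by move=> /fib_deg ai /fib_deg bj; rewrite /dtot ai bj. Qed.

Lemma tbnd_dtot n w : tbnd n (dtot w).
Proof. by exists w => i j _ a b ai bj; rewrite (dtotE _ ai bj). Qed.

Lemma tcyc_dtot n w : tcyc n (dtot w).
Proof.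
move=> i j _ a b ai bj; rewrite /dTot.
have -> : dA i (dtot w) a b = si i.+1 j * dA i (dB j w) a b.
  rewrite /dA (@eq_dn _ _ _ _ (fun a' => ta i.+1 j *: dn i.+1 (fun a'' => w a'' b) a' +
     si i.+1 j *: dB j w a' b)); last by move=> a' ai'; rewrite (dtotE _ ai' bj).
  by rewrite [LHS](dnP _ (ta i.+1 j) (dn i.+1 (w^~ b)) (si i.+1 j *: (dB j w)^~ b)) dn_dn //
     dnZ scaler0 add0r.
have -> : dB j (dtot w) a b = ta i j.+1 * dA i (dB j w) a b.
  rewrite dA_dB /dB (@eq_dn _ _ _ _ (fun b' => si i j.+1 *: dn j.+1 (w a) b' +
     ta i j.+1 *: dA i w a b')); last by move=> b' bj'; rewrite (dtotE _ ai bj') addrC.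
  by rewrite [LHS](dnP _ (si i j.+1) (dn j.+1 (w a)) (ta i j.+1 *: dA i w a)) dn_dn //
     dnZ scaler0 add0r.
have [_ _ e] := sgn i j.
by rewrite !mulrA -mulrDl (mulrC (ta i j)) (mulrC (si i j)) e mul0r.
Qed.

End Total.

End FreeComplexes.

Section TotalAugmented.
Variables (R : comUnitRingType) (A B : cx R) (ta si : nat -> nat -> R).
Variables (N : lmodType R) (e : ix B -> N).
Hypotheses (sgn : good_signs ta si) (resB : resolves e).

Notation tcyc := (tcyc ta si).
Notation tbnd := (tbnd ta si).
Notation dTot := (dTot ta si).
Notation dtot := (dtot ta si).
Implicit Types z w : ix A -> ix B -> R^o.

Definition augment z (a : ix A) : N := \sum_(b <- fib B 0) z a b *: e b.

Lemma augmentP c z w : augment (c *: z + w) = c *: augment z + augment w.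
Proof.
apply/funext => a; rewrite /augment /= [RHS]/GRing.add /= [in RHS]/GRing.scale /=.
rewrite scaler_sumr -big_split /=; apply: eq_bigr => b _.
by rewrite -[X in X *: _]/(c * z a b + w a b) scalerDl scalerA.
Qed.

Lemma augment_Bnd0 (c : ix B -> R^o) : Bnd 0 c -> \sum_(b <- fib B 0) c b *: e b = 0.
Proof. by move/(rs_ker resB). Qed.

Lemma augment_dA i z a : augment (dA i z) a = dn i (augment z) a.
Proof.
rewrite /augment /dA /dn; under eq_bigr do rewrite scaler_suml.
rewrite exchange_big /=; apply: eq_bigr => s _.
by rewrite scaler_sumr; apply: eq_bigr => b _; rewrite scalerA.
Qed.

Lemma augment_dTot i w a : a \in fib A i ->
  \sum_(b <- fib B 0) dTot i 0 w a b *: e b =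
  \sum_(b <- fib B 0) (ta i 0 * dA i w a b) *: e b.
Proof.
move=> ai; rewrite /dTot; under eq_bigr do rewrite scalerDl.
rewrite big_split /= [X in _ + X](_ : _ = 0) ?addr0 //.
under eq_bigr do rewrite -scalerA; rewrite -scaler_sumr augment_Bnd0 ?scaler0 //.
by exists (w a).
Qed.

Lemma tbnd_augment n z : tbnd n z -> Bnd n (augment z).
Proof.
case=> w Ew; exists (fun a => ta n 0 *: augment w a) => a an.
rewrite -[X in dn n X]/(ta n 0 *: augment w) dnZ -augment_dA /augment.
rewrite (eq_big_seq (fun b => dTot n 0 w a b *: e b)) => [|b b0]; last first.
  by rewrite (Ew n 0%N) ?addn0.
rewrite augment_dTot // scaler_sumr; apply: eq_bigr => b _.
by rewrite scalerA.
Qed.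

Lemma tcyc_augment n z : tcyc n z -> Cyc n (augment z).
Proof.
case: n => // n Cz a an; rewrite -augment_dA /augment.
have [tt _ _] := sgn n 0.
rewrite -[LHS]scale1r -tt -scalerA scaler_sumr.
under eq_bigr do rewrite scalerA.
by rewrite -augment_dTot // big_seq big1 ?scaler0 // => b b0; rewrite Cz ?addn0 ?scale0r.
Qed.

(** One step of the chase in the double complex. The first nonzero component of [z], in [B]-degree
    [kk], is a boundary in the direction of [B]; subtracting the total boundary of a preimage
    removes it and disturbs only [B]-degree [kk.+1]. *)
Lemma tbnd_step n kk z : (kk <= n)%N ->
  (forall i j a b, (i + j)%N = n -> (j < kk)%N ->
     a \in fib A i -> b \in fib B j -> z a b = 0) ->
  (forall a, a \in fib A (n - kk) -> Bnd kk (z a)) ->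
  tcyc n z ->
  (forall z', tcyc n z' ->
     (forall i j a b, (i + j)%N = n -> (j <= kk)%N ->
        a \in fib A i -> b \in fib B j -> z' a b = 0) -> tbnd n z') ->
  tbnd n z.
Proof.
move=> kn z0 Bz Cz IH; set i := (n - kk)%N in Bz.
have /choice[w wP] : forall a, exists w : ix B -> R^o, a \in fib A i ->
    forall b, b \in fib B kk -> z a b = dn kk w b.
  move=> a; have [/Bz[w Ew]|_] := boolP (a \in fib A i); first by exists w.
  by exists 0.
pose w1 a b : R^o := if (cdeg a == i) && (cdeg b == kk.+1) then si i kk * w a b else 0.
have Cz' : tcyc n (z - dtot w1).
  rewrite -[z]scale1r -[- _](scaleN1r) addrC.
  by apply: tcycP; [exact: tcyc_dtot|rewrite scale1r].
have -> : z = 1 *: (z - dtot w1) + dtot w1 by rewrite scale1r subrK.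
apply: tbndP; last exact: tbnd_dtot.
apply: IH => // i' j a b ei jk ai bj.
rewrite -[LHS]/(z a b - dtot w1 a b) (dtotE _ _ _ ai bj) /dTot.
have -> : dA i' w1 a b = 0.
  rewrite /dA /dn big_seq big1 // => a' ai'; rewrite /w1 (fib_deg bj).
  by rewrite (_ : (j == kk.+1) = false) ?andbF ?scaler0 //; lia.
rewrite mulr0 add0r; move: jk; rewrite leq_eqVlt => /orP[/eqP ej|jk]; last first.
  rewrite (z0 i' j) // sub0r /dB /dn big_seq big1 ?mulr0 ?oppr0 // => b' bj'.
  rewrite /w1 (fib_deg bj') (_ : (j.+1 == kk.+1) = false) ?andbF ?scaler0 //; lia.
subst j; have ei' : i' = i by rewrite /i; lia.
subst i'; have [_ ss _] := sgn i kk.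
rewrite (_ : dB kk w1 a b = si i kk * z a b) ?mulrA ?ss ?mul1r ?subrr //.
rewrite (wP a ai b bj) /dB /dn mulr_sumr; apply: eq_big_seq => b' bj'.
by rewrite /w1 (fib_deg ai) (fib_deg bj') !eqxx /= /GRing.scale /=; ring.
Qed.

(** Induction on the number of [B]-degrees still to be cleared. The cycle equation makes the lowest
    component a cycle of [B] in positive degree, where [B] is exact. *)
Lemma tbnd_above n z kk : (kk <= n.+1)%N -> (0 < kk)%N -> tcyc n z ->
  (forall i j a b, (i + j)%N = n -> (j < kk)%N ->
     a \in fib A i -> b \in fib B j -> z a b = 0) -> tbnd n z.
Proof.
move=> kn; have [m em] : exists m, m = (n.+1 - kk)%N by exists (n.+1 - kk)%N.
elim: m kk em kn z => [|m IH] kk em kn z k0 Cz z0.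
  exists 0 => i j ij a b ai bj; rewrite (z0 i j) //; last lia.
  by rewrite /dTot /dA /dB -[(fun a' => _)]/(0 : ix A -> R^o) !dn0 !mulr0 addr0.
apply: (@tbnd_step n kk) => //; [lia| |].
  move=> a ak; case: kk k0 em kn z0 ak => // kk _ em kn z0 ak.
  apply: (rs_exact resB) => b bk.
  have := Cz (n - kk.+1)%N kk _ a b ak bk; rewrite /dTot.
  rewrite (_ : dA _ z a b = 0) ?mulr0 ?add0r => [H|]; last first.
    rewrite /dA /dn big_seq big1 // => a' ak'.
    by rewrite (z0 (n - kk.+1).+1 kk) ?scaler0 //; lia.
  have [_ ss _] := sgn (n - kk.+1)%N kk.
  by rewrite -[LHS]mul1r -ss -mulrA [X in _ * X]H ?mulr0 //; lia.
by move=> z' Cz' z0'; apply: (IH kk.+1) => //; lia.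
Qed.

(* Together with [tcyc_augment_lift], the augmentation of [B] induces an
   isomorphism from the homology of the total complex to that of [A (x) N]. *)
Lemma tbnd_of_augment n z : tcyc n z -> Bnd n (augment z) -> tbnd n z.
Proof.
move=> Cz [y yP].
have /choice[c cP] := fun x => rs_surj resB x.
(* The chain bounding the augmentation is lifted to bidegree [(n.+1, 0)]. After its total boundary
   is subtracted, the component in [B]-degree 0 has augmentation 0 and is therefore a boundary in
   [B]. *)
pose w a b : R^o := if (cdeg a == n.+1) && (cdeg b == 0%N) then ta n 0 * c (y a) b else 0.
have Cz' : tcyc n (z - dtot w).
  rewrite -[z]scale1r -[- _](scaleN1r) addrC.
  by apply: tcycP; [exact: tcyc_dtot|rewrite scale1r].
have -> : z = 1 *: (z - dtot w) + dtot w by rewrite scale1r subrK.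
apply: tbndP; last exact: tbnd_dtot.
apply: (@tbnd_step n 0) => //; last by move=> z' Cz'' z0; apply: (@tbnd_above n z' 1).
rewrite subn0 => a an; apply/(rs_ker resB).
rewrite (eq_big_seq (fun b => z a b *: e b - (ta n 0 * dA n w a b) *: e b)).
  have [tt _ _] := sgn n 0.
  rewrite sumrB; apply/eqP; rewrite subr_eq0; apply/eqP.
  rewrite -[LHS]/(augment z a) yP //.
  under [RHS]eq_bigr do rewrite -scalerA.
  rewrite -scaler_sumr -[X in _ *: X]/(augment (dA n w) a) augment_dA /dn scaler_sumr.
  apply: eq_big_seq => a' an'; rewrite [in LHS](cP (y a')) /augment !scaler_sumr.
  apply: eq_big_seq => b b0; rewrite /w (fib_deg an') (fib_deg b0) !eqxx /= !scalerA.
  by congr (_ *: _); rewrite -[LHS]mul1r -tt; ring.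
move=> b b0; rewrite -scalerBl; congr (_ *: _); rewrite -[LHS]/(z a b - dtot w a b).
rewrite (dtotE _ _ _ an b0) /dTot (_ : dB _ _ _ _ = 0) ?mulr0 ?addr0 //.
rewrite /dB /dn big_seq big1 // => b' b1.
by rewrite /w (fib_deg b1) andbF scaler0.
Qed.

(** The components of the lift are chosen by increasing [B]-degree, each one cancelling the
    differential of the preceding one in the direction of [A]. In [B]-degree 0 this is possible
    because [y] is a cycle, later because [B] is exact. *)
Lemma tcyc_augment_lift n y : Cyc n y ->
  exists z, tcyc n z /\ forall a, a \in fib A n -> y a = augment z a.
Proof.
move=> Cy; have /choice[c cP] := fun x => rs_surj resB x.
suff H kk : (kk <= n)%N -> exists z, (forall i j, (i + j).+1 = n -> (j < kk)%N ->
     forall a b, a \in fib A i -> b \in fib B j -> dTot i j z a b = 0) /\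
   forall a, a \in fib A n -> y a = augment z a.
  have [z [eqz augz]] := H n (leqnn n).
  by exists z; split=> // i j ij a b; apply: eqz => //; lia.
elim: kk => [|kk IH] kn.
  by exists (fun a => c (y a)); split=> // a _; exact: cP.
have [|z [eqz augz]] := IH; first lia.
have [i en] : exists i, n = (i.+1 + kk)%N by exists (n - kk.+1)%N; lia.
have /choice[u uP] : forall a, exists u : ix B -> R^o, a \in fib A i ->
    forall b, b \in fib B kk -> dA i z a b = dn kk u b.
  move=> a; have [ai|_] := boolP (a \in fib A i); last by exists 0.
  suff [u uP] : Bnd kk (dA i z a) by exists u.
  case: kk en eqz {kn IH} => [|kk] en eqz.
    apply/(rs_ker resB); rewrite -[LHS]/(augment (dA i z) a) augment_dA.
    move: Cy; rewrite en addn0 => /(_ a ai) <-.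
    by apply: eq_dn => a' ai'; rewrite augz // en addn0.
  apply: (rs_exact resB) => b bk.
  rewrite -[LHS]/(dB kk (dA i z) a b) -dA_dB /dA.
  rewrite (@eq_dn _ _ _ _ _ (- (si i.+1 kk * ta i.+1 kk) *: dn i.+1 (z^~ b))).
    by rewrite dnZ dn_dn // scaler0.
  move=> a' ai'; have e1 : (i.+1 + kk).+1 = n by lia.
  have := eqz i.+1 kk e1 _ a' b ai' bk; rewrite /dTot ltnSn.
  move=> /(_ isT)/addr0_eq E; have [_ ss _] := sgn i.+1 kk.
  rewrite -[LHS]mul1r -ss -mulrA -[RHS]/(- (si i.+1 kk * ta i.+1 kk) * dA i.+1 z a' b).
  by rewrite -[X in _ * X]E mulrN mulNr mulrA.
pose z' a b : R^o := if (cdeg a == i) && (cdeg b == kk.+1)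
  then - (si i kk * ta i kk) * u a b else z a b.
exists z'; split=> [i' j ij jn a b ai bj|a an]; last first.
  rewrite augz //; apply: eq_big_seq => b b0; rewrite /z' (fib_deg b0).
  by rewrite andbF.
have [ej|ej] := eqVneq j kk; last first.
  rewrite -[RHS](eqz i' j ij _ a b ai bj); last by lia.
  by apply: dTot_eq => // x /fib_deg dx; rewrite /z' dx ?(fib_deg bj) (_ : (_ == kk.+1) = false) ?andbF //; lia.
subst j; have ei' : i' = i by lia.
subst i'; rewrite /dTot.
have -> : dA i z' a b = dA i z a b.
  apply: eq_dn => x /fib_deg dx; rewrite /z' dx (_ : (i.+1 == i) = false) //; lia.
have -> : dB kk z' a b = - (si i kk * ta i kk) * dA i z a b.
  rewrite (uP a ai b bj) -[RHS]/(- (si i kk * ta i kk) *: _) -dnZ.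
  by apply: eq_dn => x /fib_deg dx; rewrite /z' dx (fib_deg ai) !eqxx.
have [_ ss _] := sgn i kk.
by rewrite mulrA mulrN mulrA ss mul1r mulNr subrr.
Qed.
End TotalAugmented.

Section Swap.
Variables (R : comUnitRingType) (A B : cx R) (ta si : nat -> nat -> R).

Definition swap_sign (f : nat -> nat -> R) i j := f j i.

(** Transposing the double complex changes its sign convention, which is why the lemmas on total
    complexes take the signs as parameters. *)
Lemma good_signs_swap : good_signs ta si -> good_signs (swap_sign si) (swap_sign ta).
Proof.
move=> sgn i j; have [tt ss e] := sgn j i; split=> //.
by rewrite /swap_sign -[RHS]e addrC mulrC [ta j i * _]mulrC [in RHS]mulrC; ring.
Qed.

Lemma tcyc_swap n (z : ix A -> ix B -> R^o) :
  tcyc ta si n z -> tcyc (swap_sign si) (swap_sign ta) n (fun b a => z a b).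
Proof. by move=> Cz j i ij b a bj ai; rewrite /dTot addrC; apply: (Cz i j) => //; lia. Qed.

Lemma tbnd_swap n (z : ix A -> ix B -> R^o) :
  tbnd ta si n z -> tbnd (swap_sign si) (swap_sign ta) n (fun b a => z a b).
Proof.
case=> w Ew; exists (fun b a => w a b) => j i ij b a bj ai.
by rewrite /dTot addrC; apply: (Ew i j) => //; lia.
Qed.

End Swap.

Section StandardSigns.
Variable R : comUnitRingType.
Definition sone (i j : nat) : R := 1.
Definition salt (i j : nat) : R := (-1) ^+ i.
Lemma good_standard : good_signs sone salt.
Proof.
move=> i j; rewrite /sone /salt mulr1; split=> //.
  by rewrite -exprMn mulrNN mulr1 expr1n.
by rewrite exprS mulN1r mulr1 mul1r addNr.
Qed.
End StandardSigns.

Section Balance.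
Variables (R : comUnitRingType) (A B : cx R) (M N : lmodType R).
Variables (eA : ix A -> M) (eB : ix B -> N).
Hypotheses (resA : resolves eA) (resB : resolves eB).

Lemma exact_at_total n (ta si : nat -> nat -> R) : good_signs ta si ->
  exact_at A N n <-> forall z : ix A -> ix B -> R^o, tcyc ta si n z -> tbnd ta si n z.
Proof.
move=> sgn; split=> [ex z Cz|ex y Cy].
  apply: (tbnd_of_augment sgn resB Cz); apply: ex.
  exact: (tcyc_augment sgn resB).
have [z [Cz yz]] := tcyc_augment_lift sgn resB Cy.
apply: (Bnd_eq (y := augment eB z)) => [t /yz //|].
by apply: (tbnd_augment resB); exact: ex.
Qed.
End Balance.

(** Both sides are equivalent to exactness of the same total complex. *)
Lemma exact_at_sym (R : comUnitRingType) (A B : cx R) (M N : lmodType R)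
    (eA : ix A -> M) (eB : ix B -> N) n :
  resolves eA -> resolves eB -> exact_at A N n -> exact_at B M n.
Proof.
move=> resA resB; have sgn := good_standard R.
move=> /(exact_at_total A resB n sgn) ex.
apply/(exact_at_total B resA n (good_signs_swap sgn)) => z Cz.
exact: (tbnd_swap (ex _ (tcyc_swap Cz))).
Qed.

(** Going through a resolution of the other module, by balancing twice, dispenses with comparison
    maps between the two resolutions of [M]. *)
Lemma exact_at_indep (R : comUnitRingType) (A A' B : cx R) (M N : lmodType R)
    (eA : ix A -> M) (eA' : ix A' -> M) (eB : ix B -> N) n :
  resolves eA -> resolves eA' -> resolves eB -> exact_at A' N n -> exact_at A N n.
Proof.
move=> rA rA' rB ex; apply: (exact_at_sym rB rA).
exact: (exact_at_sym rA' rB).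
Qed.

(** * Tor with the residue field *)

Section ResidueModule.
Variables (R : comUnitRingType) (k : fieldType) (res : {rmorphism R -> k}).

(** The alias keeps [res] in the type, from which the scalar action of R is then inferred. *)
Definition residue_module of {rmorphism R -> k} : Type := k.
Local Notation K := (residue_module res).
HB.instance Definition _ := GRing.Zmodule.on K.

Fact res_scaleA (a b : R) (x : k) : res a * (res b * x) = res (a * b) * x.
Proof. by rewrite rmorphM mulrA. Qed.
Fact res_scale1 (x : k) : res 1 * x = x. Proof. by rewrite rmorph1 mul1r. Qed.
Fact res_scaleDr (a : R) (x y : k) : res a * (x + y) = res a * x + res a * y.
Proof. exact: mulrDr. Qed.
Fact res_scaleDl (x : k) (a b : R) : res (a + b) * x = res a * x + res b * x.
Proof. by rewrite rmorphD mulrDl. Qed.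
HB.instance Definition _ := GRing.Zmodule_isLmodule.Build R K
  res_scaleA res_scale1 res_scaleDr res_scaleDl.

Definition one_residue : K := (1 : k).
Lemma scale_residue (a : R) (x : K) : a *: x = (res a * (x : k) : k). Proof. by []. Qed.

Hypothesis hR : noetherian_local res.

Lemma resolves_residue (W : cx R) (t0 : ix W) :
  fib W 0 = [:: t0] ->
  (forall c : ix W -> R^o, Bnd 0 c <-> res (c t0) = 0) ->
  (forall n, exact_at W R^o n.+1) -> resolves (fun _ : ix W => one_residue).
Proof.
move=> f0 B0 ex; split=> // [x|c].
  have [r <-] := res_surj hR x; exists (fun=> r).
  by rewrite f0 big_seq1 scale_residue mulr1.
by rewrite f0 big_seq1 scale_residue mulr1; exact: iff_sym.
Qed.

Section TorResidue.
Variables (P W : cx R) (M : lmodType R) (eP : ix P -> M) (eW : ix W -> K).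
Hypotheses (resP : resolves eP) (resW : resolves eW).
Hypothesis minP : forall n s t, s \in fib P n.+1 -> t \in fib P n -> res (cD s t) = 0.

Lemma dn_residue n (y : ix P -> K) t : t \in fib P n -> dn n y t = 0.
Proof.
move=> tn; rewrite /dn big_seq big1 // => s sn.
by rewrite scale_residue (minP sn tn) mul0r.
Qed.

Lemma Cyc_residue n (y : ix P -> K) : Cyc n y.
Proof. by case: n => // n t; exact: dn_residue. Qed.

Lemma Bnd_residue n (y : ix P -> K) : Bnd n y <-> forall t, t \in fib P n -> y t = 0.
Proof.
split=> [[w yw] t tn|y0]; first by rewrite yw // dn_residue.
by exists 0 => t tn; rewrite dn0 y0.
Qed.

(** By balancing, the homology of W (x) M is that of P (x) k, and the latter complex has zero
    differential since [P] is minimal. Hence the basis of [P] in degree [n] indexes a basis of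
    Tor_n(k, M). *)
Lemma Tor_residue_dimeq n :
  dimeq res (@Cyc R W M n) (@Bnd R W M n) (fib P n).
Proof.
have sgn := good_standard R; have sgn' := good_signs_swap sgn.
pose aug1 := augment (A := P) eW; pose aug2 (z : ix P -> ix W -> R^o) := augment eP (fun b a => z a b).
(* [zz] lifts a cycle to a cycle of the total complex, whose augmentation on the other side gives
   the coordinates; [eq_aug] shows that they do not depend on the lift. *)
have /choice[zz zzP] : forall y : ix W -> M, exists z : ix P -> ix W -> R^o, Cyc n y ->
    tcyc (sone R) (salt R) n z /\ forall t, t \in fib W n -> y t = aug2 z t.
  move=> y; have [Cy|nC] := pselect (Cyc n y); last by exists 0 => /nC.
  have [z [Cz yz]] := tcyc_augment_lift sgn' resP Cy.
  by exists (fun a b => z b a) => _; split=> //; exact: tcyc_swap Cz.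
have uniq_z z y : tcyc (sone R) (salt R) n z ->
    (forall t, t \in fib W n -> y t = aug2 z t) ->
    Bnd n y <-> forall t, t \in fib P n -> aug1 z t = 0.
  move=> Cz yz; have Bz : Bnd n y <-> Bnd n (aug2 z).
    by split; apply: Bnd_eq => t /yz.
  rewrite Bz -Bnd_residue; split=> Bd.
    apply: (tbnd_augment resW (ta := sone R) (si := salt R)).
    exact: (tbnd_swap (tbnd_of_augment sgn' resP (tcyc_swap Cz) Bd)).
  have := tbnd_swap (tbnd_of_augment sgn resW Cz Bd).
  exact: (tbnd_augment resP).
have eq_aug z z' : tcyc (sone R) (salt R) n z -> tcyc (sone R) (salt R) n z' ->
    (forall t, t \in fib W n -> aug2 z t = aug2 z' t) ->
    forall s, s \in fib P n -> aug1 z s = aug1 z' s.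
  move=> Cz Cz' e s sn; have Cd := tcycP (-1) Cz' Cz.
  have [H _] := uniq_z _ _ Cd (fun t _ => erefl).
  have : aug1 (-1 *: z' + z) s = 0.
    apply: H => //; exists 0 => t tn; rewrite dn0 /aug2.
    rewrite -[fun _ => _]/(-1 *: (fun b a => z' a b) + (fun b a => z a b)) augmentP.
    by rewrite -[LHS]/(-1 *: aug2 z' t + aug2 z t) e // scaleN1r addNr.
  rewrite /aug1 augmentP -[LHS]/(-1 *: augment eW z' s + augment eW z s) scaleN1r addrC.
  by move/eqP; rewrite subr_eq0 => /eqP.
exists (fun y => aug1 (zz y)); split=> [a x y Cx Cy s sn|w|y Cy].
- have [Czx ex] := zzP _ Cx; have [Czy ey] := zzP _ Cy.
  have [Cz ez] := zzP _ ((submod_Cyc W M n).2 a x y Cx Cy).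
  rewrite (eq_aug _ _ Cz (tcycP a Czx Czy)) // => [|t tn].
    by rewrite /aug1 augmentP.
  rewrite -ez // /aug2 -[fun _ => _]/(a *: (fun b a => zz x a b) + (fun b a => zz y a b)).
  by rewrite augmentP -[RHS]/(a *: aug2 (zz x) t + aug2 (zz y) t) -ex // -ey.
- have [z [Cz wz]] := tcyc_augment_lift sgn resW (@Cyc_residue n w).
  have Cy : Cyc n (aug2 z) by apply: (tcyc_augment sgn' resP (tcyc_swap Cz)).
  exists (aug2 z) => // s sn; rewrite (wz s sn).
  have [Czz yzz] := zzP _ Cy.
  by apply: eq_aug => // t tn; rewrite -yzz.
- by have [Cz yz] := zzP y Cy; exact: uniq_z.
Qed.
End TorResidue.
End ResidueModule.

(** * Minimal complexes and the reduction to Betti numbers *)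

Section MatrixComplexes.
Variables (R : comUnitRingType) (rk : nat -> nat) (D : forall n, 'M[R]_(rk n.+1, rk n)).
Hypothesis DD : forall n, D n.+1 *m D n = 0.

(** Entries at natural numbers, with value 0 out of range, so that the single index type [nat * nat]
    serves in all degrees. *)
Definition mentry p q (A : 'M[R]_(p, q)) (a b : nat) : R :=
  oapp (fun i => oapp (A i) 0 (insub b)) 0 (insub a).

Lemma mentryE p q (A : 'M[R]_(p, q)) (i : 'I_p) (j : 'I_q) : mentry A i j = A i j.
Proof. by rewrite /mentry !valK. Qed.

Definition mfib n : seq (nat * nat) := [seq (n, val i) | i <- enum 'I_(rk n)].
Definition mD (s t : nat * nat) : R := mentry (D t.1) s.2 t.2.

Lemma mfib_uniq n : uniq (mfib n).
Proof. by rewrite map_inj_uniq ?enum_uniq // => i j [/val_inj]. Qed.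
Lemma mfib_deg n t : t \in mfib n -> t.1 = n.
Proof. by case/mapP => i _ ->. Qed.
Lemma mem_mfib n (i : 'I_(rk n)) : (n, val i) \in mfib n.
Proof. by apply: map_f; rewrite mem_enum. Qed.
Lemma big_mfib (M : nmodType) n (f : nat * nat -> M) :
  \sum_(t <- mfib n) f t = \sum_(i < rk n) f (n, val i).
Proof. by rewrite big_map big_enum. Qed.
Lemma size_mfib n : size (mfib n) = rk n.
Proof. by rewrite size_map size_enum_ord. Qed.

Lemma mDD n s u : s \in mfib n.+2 -> u \in mfib n ->
  \sum_(t <- mfib n.+1) mD s t * mD t u = 0.
Proof.
case/mapP => i _ -> /mapP[j _ ->]; rewrite big_mfib /mD /=.
have /matrixP/(_ i j) := DD n; rewrite !mxE => {2}<-.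
by apply: eq_bigr => l _; rewrite !mentryE.
Qed.

Definition mcx : cx R := Cx mfib_uniq mfib_deg mDD.

Lemma dn_mcx (M : lmodType R) n (y : ix mcx -> M) (j : 'I_(rk n)) :
  dn n y (n, val j) = \sum_i D n i j *: y (n.+1, val i).
Proof. by rewrite /dn big_mfib; apply: eq_bigr => i _; rewrite /= /mD mentryE. Qed.

Lemma exact_at_mcx (M : lmodType R) n : exact_at mcx M n.+1 <->
  forall y : 'I_(rk n.+1) -> M, (forall j, \sum_i D n i j *: y i = 0) ->
    exists w : 'I_(rk n.+2) -> M, forall i, y i = \sum_j D n.+1 j i *: w j.
Proof.
split=> ex y Cy.
  have [|w wP] := ex (fun t => oapp y 0 (insub t.2)).
    move=> t /mapP[j _ ->]; rewrite dn_mcx -[RHS](Cy j).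
    by apply: eq_bigr => i _; rewrite valK.
  exists (fun j => w (n.+2, val j)) => i.
  by have := wP _ (mem_mfib i); rewrite /= valK dn_mcx.
have [|w wP] := ex (fun i => y (n.+1, val i)).
  by move=> j; rewrite -dn_mcx Cy //; exact: mem_mfib.
exists (fun t => oapp w 0 (insub t.2)) => t /mapP[i _ ->].
by rewrite dn_mcx wP; apply: eq_bigr => j _; rewrite valK.
Qed.

Lemma exact_at_mcx_row n :
  (forall v : 'rV_(rk n.+1), v *m D n = 0 -> exists w : 'rV_(rk n.+2), v = w *m D n.+1) ->
  exact_at mcx R^o n.+1.
Proof.
move=> ex; apply/exact_at_mcx => y Cy; have [|w wP] := ex (\row_i y i).
  apply/rowP => j; rewrite !mxE -[RHS](Cy j); apply: eq_bigr => i _.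
  by rewrite mxE mulrC.
exists (w 0) => i; have /rowP/(_ i) := wP; rewrite !mxE => ->.
by apply: eq_bigr => j _; rewrite mulrC.
Qed.

End MatrixComplexes.

Section ResolutionComplexes.
Variables (R : comUnitRingType) (M : lmodType R) (F : free_resolution M).

Fact fr_DD n : fr_diff F n.+1 *m fr_diff F n = 0.
Proof.
apply/row_matrixP => i; rewrite row_mul row0; apply/fr_exactS.
by exists (delta_mx 0 i); rewrite rowE.
Qed.

Definition fr_cx : cx R := mcx fr_DD.
Definition fr_gen (t : ix fr_cx) : M :=
  oapp (fun i : 'I_(fr_rank F 0) => fr_aug F (delta_mx 0 i)) 0 (insub t.2).

Lemma fr_augE (c : ix fr_cx -> R) :
  \sum_(t <- fib fr_cx 0) c t *: fr_gen t = fr_aug F (\row_i c (0%N, val i)).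
Proof.
rewrite big_mfib (row_sum_delta (\row_i c (0%N, val i))) linear_sum.
by apply: eq_bigr => i _; rewrite linearZ /= mxE /fr_gen /= valK.
Qed.

Lemma resolves_fr : resolves fr_gen.
Proof.
split=> [x|c|n].
- have [v <-] := fr_aug_surj F x; exists (fun t => oapp (v 0) 0 (insub t.2)).
  by rewrite fr_augE; congr (fr_aug F _); apply/rowP => i; rewrite mxE valK.
- rewrite fr_augE fr_exact0; split=> [[w ew]|[w ew]].
    exists (fun t => oapp (w 0) 0 (insub t.2)) => t /mapP[i _ ->].
    have /rowP/(_ i) := ew; rewrite !mxE dn_mcx => ->.
    by apply: eq_bigr => j _; rewrite valK /= mulrC.
  exists (\row_i w (1%N, val i)); apply/rowP => i; rewrite !mxE ew ?mem_mfib //.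
  by rewrite dn_mcx; apply: eq_bigr => j _; rewrite mxE mulrC.
- by apply: exact_at_mcx_row => v /fr_exactS.
Qed.

Lemma tensor_exact_at (N : lmodType R) n : tensor_exact F N n.+1 <-> exact_at fr_cx N n.+1.
Proof.
rewrite exact_at_mcx /=; split=> ex y Cy.
  have [|w ew] := ex [ffun i => y i].
    apply/ffunP => j; rewrite !ffunE -[RHS](Cy j).
    by apply: eq_bigr => i _; rewrite ffunE.
  by exists w => i; have /ffunP/(_ i) := ew; rewrite !ffunE.
have [|w ew] := ex y.
  by move=> j; have /ffunP/(_ j) := Cy; rewrite !ffunE.
exists [ffun j => w j]; apply/ffunP => i; rewrite ffunE ew.
by apply: eq_bigr => j _; rewrite ffunE.
Qed.

Variable s : nat.
(** This resolves the syzygy of [M] of order [s]; with [s] large, its Tor with [N] vanishes in all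
    positive degrees. *)
Definition fr_shift : cx R :=
  @mcx R (fun n => fr_rank F (n + s)) (fun n => fr_diff F (n + s)) (fun n => fr_DD (n + s)).

Lemma exact_at_shift (N : lmodType R) n :
  exact_at fr_cx N (n + s).+1 -> exact_at fr_shift N n.+1.
Proof. by move/exact_at_mcx => ex; apply/exact_at_mcx; exact: ex. Qed.

Lemma free_projective n : projective 'rV[R]_n.
Proof.
move=> X Y g f srj; have /choice[h hP] := fun i => srj (f (delta_mx 0 i)).
exists (row_comb h : {linear 'rV[R]_n -> X}) => v.
rewrite linear_sum {2}(row_sum_delta v) linear_sum; apply: eq_bigr => i _.
by rewrite !linearZ /= hP.
Qed.

Lemma finite_projdim_rank0 : (exists n0, forall n, (n0 <= n)%N -> fr_rank F n = 0) ->
  finite_projdim M.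
Proof.
case=> n0 r0; exists (fun n => 'rV[R]_(fr_rank F n)).
exists (fun n => mulmxr (fr_diff F n) : {linear _ -> _}), (fr_aug F), n0; split.
- by move=> n; exact: free_projective.
- by move=> n n0n x; apply/rowP => i; exfalso; case: i => i; rewrite r0 // ltnW.
- exact: fr_aug_surj.
- exact: fr_exact0.
- exact: fr_exactS.
Qed.

End ResolutionComplexes.

(** * The tensor product of two complexes *)

Section TensorComplex.
Variables (R : comUnitRingType) (A B : cx R).

Definition tfib n : seq (ix A * ix B) :=
  [seq p | i <- iota 0 n.+1, p <- [seq (a, b) | a <- fib A i, b <- fib B (n - i)]].
Definition tdeg (p : ix A * ix B) := (cdeg p.1 + cdeg p.2)%N.
Definition tD (p q : ix A * ix B) : R :=
  cD p.1 q.1 * (p.2 == q.2)%:R + (-1) ^+ cdeg p.1 * ((p.1 == q.1)%:R * cD p.2 q.2).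

Lemma mem_tfib n a b : ((a, b) \in tfib n) =
  [&& a \in fib A (cdeg a), b \in fib B (cdeg b) & (cdeg a + cdeg b == n)%N].
Proof.
apply/allpairsPdep/and3P => [[i [p [ii /allpairsP[[a' b'] /= [ai bi ->]] [-> ->]]]]|[ai bi /eqP<-]].
  rewrite mem_iota add0n ltnS in ii.
  by rewrite (fib_deg ai) (fib_deg bi) ai bi subnKC.
exists (cdeg a), (a, b); split=> //; first by rewrite mem_iota ltnS leq_addr.
by apply/allpairsP; exists (a, b); rewrite addKn.
Qed.

Lemma tfib_uniq n : uniq (tfib n).
Proof.
pose blk i := [seq (a, b) | a <- fib A i, b <- fib B (n - i)].
have dblk i p : p \in blk i -> cdeg p.1 = i.
  by case/allpairsP=> -[a b] [/fib_deg ai _ ->].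
have -> : tfib n = flatten [seq blk i | i <- iota 0 n.+1].
  by congr flatten; apply: eq_map => i; rewrite map_id.
move: (iota 0 n.+1) (iota_uniq 0 n.+1); elim=> //= i s IH /andP[iNs us].
rewrite cat_uniq IH // andbT; apply/andP; split.
  by apply: allpairs_uniq; rewrite ?fib_uniq // => -[x1 y1] [x2 y2].
apply/hasPn => p /flatten_mapP[j js /dblk pj]; apply/negP => /dblk pi.
by rewrite -pi pj js in iNs.
Qed.

Lemma tfib_deg n p : p \in tfib n -> tdeg p = n.
Proof. by case: p => a b; rewrite mem_tfib => /and3P[_ _ /eqP]. Qed.

Lemma size_tfib n : size (tfib n) = \sum_(i < n.+1) size (fib A i) * size (fib B (n - i)).
Proof.
rewrite size_flatten /shape -map_comp sumnE big_map -[n.+1]subn0 -/(index_iota 0 n.+1) big_mkord.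
by apply: eq_bigr => i _ /=; rewrite map_id size_allpairs.
Qed.

Lemma big_tfib_l n a' b' (G : ix A -> R) : (a', b') \in tfib n ->
  \sum_(p <- tfib n.+1) G p.1 * (p.2 == b')%:R = \sum_(a <- fib A (cdeg a').+1) G a.
Proof.
rewrite mem_tfib => /and3P[ai bi /eqP en].
rewrite (bigID (fun p => p.2 == b')) /= [X in _ + X]big1 ?addr0; last first.
  by move=> p /negPf->; rewrite mulr0.
rewrite -big_filter (perm_big [seq (a, b') | a <- fib A (cdeg a').+1]).
  by rewrite big_map; apply: eq_bigr => a _; rewrite eqxx mulr1.
apply: uniq_perm; first by rewrite filter_uniq // tfib_uniq.
  by rewrite map_inj_uniq ?fib_uniq // => x y [].
move=> [a b]; rewrite mem_filter mem_tfib /=.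
apply/idP/mapP => [/and4P[/eqP-> aj _ /eqP e]|[x xi [-> ->]]].
  by exists a => //; rewrite (_ : (cdeg a').+1 = cdeg a) //; lia.
by rewrite eqxx bi (fib_deg xi) xi /=; apply/eqP; lia.
Qed.

Lemma big_tfib_r n a' b' (G : ix B -> R) : (a', b') \in tfib n ->
  \sum_(p <- tfib n.+1) (p.1 == a')%:R * G p.2 = \sum_(b <- fib B (cdeg b').+1) G b.
Proof.
rewrite mem_tfib => /and3P[ai bi /eqP en].
rewrite (bigID (fun p => p.1 == a')) /= [X in _ + X]big1 ?addr0; last first.
  by move=> p /negPf->; rewrite mul0r.
rewrite -big_filter (perm_big [seq (a', b) | b <- fib B (cdeg b').+1]).
  by rewrite big_map; apply: eq_bigr => a _; rewrite eqxx mul1r.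
apply: uniq_perm; first by rewrite filter_uniq // tfib_uniq.
  by rewrite map_inj_uniq ?fib_uniq // => x y [].
move=> [a b]; rewrite mem_filter mem_tfib /=.
apply/idP/mapP => [/and4P[/eqP-> _ bj /eqP e]|[x xi [-> ->]]].
  by exists b => //; rewrite (_ : (cdeg b').+1 = cdeg b) //; lia.
by rewrite eqxx ai (fib_deg xi) xi /=; apply/eqP; lia.
Qed.

(** Through this identity the tensor complex inherits both its complex property and its exactness
    from the double complex. *)
Lemma dn_tensor n (z : ix A * ix B -> R^o) a b : (a, b) \in tfib n ->
  \sum_(p <- tfib n.+1) tD p (a, b) * z p =
  dtot (sone R) (salt R) (fun a b => z (a, b)) a b.
Proof.
move=> abn; rewrite /dtot /dTot /dA /dB /dn.
transitivity (\sum_(p <- tfib n.+1) ((cD p.1 a * z (p.1, b)) * (p.2 == b)%:R +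
    (p.1 == a)%:R * ((-1) ^+ cdeg a * (cD p.2 b * z (a, p.2))))).
  apply: eq_bigr => -[a1 b1] _; rewrite /tD /=.
  have [->|_] := eqVneq b1 b; have [->|_] := eqVneq a1 a; rewrite /=; ring.
rewrite big_split /= (big_tfib_l (fun a' => cD a' a * z (a', b)) abn).
rewrite (big_tfib_r (fun b' => (-1) ^+ cdeg a * (cD b' b * z (a, b'))) abn).
by rewrite /sone mul1r -mulr_sumr.
Qed.

Lemma tDD n s u : s \in tfib n.+2 -> u \in tfib n ->
  \sum_(t <- tfib n.+1) tD s t * tD t u = 0.
Proof.
(* The function [z] is the basis vector at [s], so the claim is an entry of the square of the total
   differential. *)
move=> sn un; pose z p : R^o := (p == s)%:R.
have e p : p \in tfib n.+1 -> tD s p = dtot (sone R) (salt R) (fun a b => z (a, b)) p.1 p.2.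
  case: p => a b pn; rewrite -(dn_tensor _ pn) (bigD1_seq s) ?tfib_uniq //=.
  by rewrite /z eqxx mulr1 big1 ?addr0 // => i /negPf->; rewrite mulr0.
under eq_bigr do rewrite mulrC.
rewrite (eq_big_seq _ (fun p pn => congr1 (fun x => tD p u * x) (e p pn))).
case: u un => a b un; rewrite (dn_tensor (fun p => dtot _ _ _ p.1 p.2) un).
have := un; rewrite mem_tfib => /and3P[ai bi /eqP en].
by apply: (tcyc_dtot (good_standard R) (n := n.+1)); rewrite ?en.
Qed.

Definition tensor_cx : cx R := Cx tfib_uniq tfib_deg tDD.

Lemma tensor_cx_minimal (k : fieldType) (res : {rmorphism R -> k}) :
  (forall n s t, s \in fib A n.+1 -> t \in fib A n -> res (cD s t) = 0) ->
  (forall n s t, s \in fib B n.+1 -> t \in fib B n -> res (cD s t) = 0) ->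
  forall n s t, s \in fib tensor_cx n.+1 -> t \in fib tensor_cx n -> res (cD s t) = 0.
Proof.
move=> mA mB n [a b] [a' b']; rewrite /= !mem_tfib => /and3P[ai bi /eqP e] /and3P[ai' bi' /eqP e'].
rewrite /tD /= rmorphD !rmorphM /=.
have -> : res (cD a a') * res (b == b')%:R = 0.
  have [eb|_] := eqVneq b b'; last by rewrite rmorph0 mulr0.
  rewrite (mA (cdeg a')) ?mul0r // (_ : (cdeg a').+1 = cdeg a) //; subst b'; lia.
have [ea|_] := eqVneq a a'; last by rewrite rmorph0 mul0r mulr0 addr0.
rewrite (mB (cdeg b')) ?mulr0 ?addr0 // (_ : (cdeg b').+1 = cdeg b) //; subst a'; lia.
Qed.

Lemma tensor_cx_exact (N : lmodType R) (e : ix B -> N) n :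
  resolves e -> exact_at A N n -> exact_at tensor_cx R^o n.
Proof.
move=> resB /(exact_at_total A resB n (good_standard R)) ex y Cy.
have [|w Ew] := ex (fun a b => y (a, b)).
  case: n Cy {ex} => // n Cy i j [ij] a b ai bj.
  have abn : (a, b) \in tfib n.
    by rewrite mem_tfib (fib_deg ai) (fib_deg bj) ai bj ij /=.
  by rewrite -(dtotE _ _ _ ai bj) -(dn_tensor _ abn) -[RHS](Cy _ abn).
exists (fun p => w p.1 p.2) => -[a b] abn; have := abn; rewrite /= mem_tfib => /and3P[ai bi /eqP e'].
by rewrite [LHS](Ew _ _ e' a b ai bi) /dn (dn_tensor (fun p => w p.1 p.2) abn).
Qed.

End TensorComplex.

(** The cokernel of the last differential is resolved by the complex itself. This lets the bounds
    for Betti numbers of modules apply to every minimal complex, tensor products included. *)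
Lemma exists_coker (R : comUnitRingType) (P : cx R) :
  (forall n, exact_at P R^o n.+1) ->
  exists (M : lmodType R) (e : ix P -> M), resolves e /\ finitely_generated M.
Proof.
move=> ex; have [M [p [srj ker]]] := exists_quotient (submod_Bnd P R^o 0).
pose e (t : ix P) : M := p (fun s => (s == t)%:R).
have eE (c : ix P -> R) : \sum_(t <- fib P 0) c t *: e t = p (c : ix P -> R^o).
  rewrite /e; under eq_bigr do rewrite -linearZ.
  rewrite -linear_sum; apply/eqP; rewrite -subr_eq0 -linearB; apply/eqP/ker.
  exists 0 => t t0; rewrite dn0 -[LHS]/((\sum_(s <- fib P 0) (c s *: fun u => (u == s)%:R : R^o)) t - c t).
  rewrite fct_sumE (bigD1_seq t) ?fib_uniq //= big1 => [|s st].
    by rewrite addr0 -[X in X - _]/(c t * (t == t)%:R) eqxx mulr1 subrr.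
  by rewrite -[LHS]/(c s * (t == s)%:R) eq_sym (negPf st) mulr0.
have srj' (x : M) : exists c : ix P -> R, x = \sum_(t <- fib P 0) c t *: e t.
  by have [c <-] := srj x; exists c; rewrite eE.
exists M, e; split; first by split=> // c; rewrite eE ker.
exists (size (fib P 0)), (fun i => e (tnth (in_tuple (fib P 0)) i)) => x.
have [c ->] := srj' x; exists (fun i => c (tnth (in_tuple (fib P 0)) i)).
by rewrite big_tnth.
Qed.

Definition minimal_cx (R : comUnitRingType) (k : fieldType) (res : {rmorphism R -> k})
    (P : cx R) : Prop :=
  (forall n s t, s \in fib P n.+1 -> t \in fib P n -> res (cD s t) = 0) /\
  forall n, exact_at P R^o n.+1.

Definition betti (R : comUnitRingType) (P : cx R) n := size (fib P n).
Definition conv (a b : nat -> nat) n : nat := \sum_(i < n.+1) a i * b (n - i).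
Definition eventually0 (a : nat -> nat) := exists n0, forall n, (n0 <= n)%N -> a n = 0%N.

(** Separates algebra from analysis: [Good] is to be a growth condition met by every minimal
    complex. It is applied to a syzygy of [M], to [N] and to their tensor product, whose Betti
    sequence is the convolution of the other two. *)
Lemma Tor_vanishing_of_betti (R : comUnitRingType) (k : fieldType)
    (res : {rmorphism R -> k}) (hR : noetherian_local res) (Good : (nat -> nat) -> Prop) :
  (forall P : cx R, minimal_cx res P -> Good (betti P)) ->
  (forall a b, Good a -> Good b -> Good (conv a b) -> eventually0 a \/ eventually0 b) ->
  Tor_vanishing R.
Proof.
move=> good dich M N fgM fgN [s tor0].
have [F minF] := exists_minimal_resolution hR fgM.
have [G minG] := exists_minimal_resolution hR fgN.
have exF n : exact_at (fr_shift F s) N n.+1.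
  apply: exact_at_shift.
  have [|F' /tensor_exact_at exF'] := tor0 (n + s).+1; first lia.
  exact: (exact_at_indep (resolves_fr F) (resolves_fr F') (resolves_fr G) exF').
have min_mcx (rk : nat -> nat) (D : forall n, 'M[R]_(rk n.+1, rk n))
    (DD : forall n, D n.+1 *m D n = 0) : (forall n i j, res (D n i j) = 0) ->
    forall n s t, s \in fib (mcx DD) n.+1 -> t \in fib (mcx DD) n -> res (cD s t) = 0.
  by move=> m n _ _ /mapP[i _ ->] /mapP[j _ ->]; rewrite /= /mD mentryE.
have mA : minimal_cx res (fr_shift F s).
  split=> [|n]; first by apply: (min_mcx _ _ (fun n => fr_DD F (n + s))) => n i j; exact: minF.
  by apply: exact_at_mcx_row => v; have [] := @fr_exactS _ _ F (n + s) v.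
have mB : minimal_cx res (fr_cx G).
  by split=> [|n]; [apply: (min_mcx _ _ (fr_DD G)) => ? ? ?; exact: minG|exact: (rs_exact (resolves_fr G))].
have mC : minimal_cx res (tensor_cx (fr_shift F s) (fr_cx G)).
  split=> [|n]; first exact: (tensor_cx_minimal mA.1 mB.1).
  exact: (tensor_cx_exact (resolves_fr G) (exF n)).
have eC : betti (tensor_cx (fr_shift F s) (fr_cx G)) =
    conv (betti (fr_shift F s)) (betti (fr_cx G)).
  by apply/funext => n; exact: size_tfib.
have := good _ mC; rewrite eC => gC.
have [[n0 H]|[n0 H]] := dich _ _ (good _ mA) (good _ mB) gC.
  left; apply: (finite_projdim_rank0 (F := F)); exists (n0 + s)%N => n ns.
  by have := H (n - s)%N; rewrite /betti size_mfib subnK; [apply; lia|lia].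
right; apply: (finite_projdim_rank0 (F := G)); exists n0 => n /H.
by rewrite /betti size_mfib.
Qed.

(** * Truncations of the acyclic closure *)

Section DGAlgebra.
Variables (R : comUnitRingType) (A : dgAlgebra R).
Notation comp := (dg_comp A).
Notation d := (dg_diff A).
Implicit Types (a b : A) (i j n : nat).

Lemma comp_homogeneous i a : homogeneous i (comp i a).
Proof. by rewrite /homogeneous /= dg_comp_comp eqxx. Qed.

Lemma comp_homog i j a : homogeneous j a -> comp i a = if i == j then a else 0.
Proof. by move=> ja; rewrite -{1}ja dg_comp_comp; case: eqP => // ->. Qed.

Lemma comp_bound i a : (dg_bound a <= i)%N -> comp i a = 0.
Proof.
move=> ba; rewrite {1}(dg_comp_sum a) linear_sum big1 // => j _.
by rewrite dg_comp_comp ifN // gtn_eqF // (leq_trans (ltn_ord j)).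
Qed.

Lemma dg_ind (P : A -> Prop) : P 0 -> (forall a b, P a -> P b -> P (a + b)) ->
  (forall i a, homogeneous i a -> P a) -> forall a, P a.
Proof.
move=> P0 PD Ph a; rewrite (dg_comp_sum a); apply: big_ind => // i _.
by apply: (Ph i); exact: comp_homogeneous.
Qed.

Lemma homogeneous0 i : homogeneous i (0 : A).
Proof. by rewrite /homogeneous /= linear0. Qed.

Lemma homogeneous_lin i r a b : homogeneous i a -> homogeneous i b -> homogeneous i (r *: a + b).
Proof. by rewrite /homogeneous /= => ha hb; rewrite linearP /= ha hb. Qed.

Lemma homogeneousM i j a b : homogeneous i a -> homogeneous j b -> homogeneous (i + j)%N (a * b).
Proof. exact: dg_mul. Qed.

Lemma comp_diff i a : comp i (d a) = d (comp i.+1 a).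
Proof.
elim/dg_ind: a => [|a b IHa IHb|j a ja]; first by rewrite !linear0.
  by rewrite !linearD /= IHa IHb.
case: j ja => [|j] ja; first by rewrite dg_diff0 // (comp_homog _ ja) !linear0.
have jd : homogeneous j (d a) by exact: dg_diffS.
by rewrite (comp_homog _ jd) (comp_homog _ ja) eqSS; case: eqP; rewrite ?linear0.
Qed.

Lemma signM i a : (-1) ^+ i * a = (-1) ^+ i *: a :> A.
Proof. by rewrite -signr_odd -[in RHS]signr_odd; case: (odd i); rewrite ?expr0 ?expr1 ?mulN1r ?scaleN1r ?mul1r ?scale1r. Qed.

(** Components beyond [dg_bound] vanish. As [dg_bound] need not be compatible with sums, the
    linearity of the bar needs a common range of summation. *)
Lemma dg_barE n a : (dg_bound a <= n)%N -> dg_bar a = \sum_(i < n) (-1) ^+ i.+1 *: comp i a.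
Proof.
move=> ba; rewrite /dg_bar (big_ord_widen _ (fun i => (-1) ^+ i.+1 * comp i a) ba).
rewrite [RHS](bigID (fun i : 'I_n => i < dg_bound a)%N) /= [X in _ = _ + X]big1 ?addr0 //.
  by apply: eq_bigr => i _; rewrite signM.
by move=> i; rewrite -leqNgt => /comp_bound ->; rewrite scaler0.
Qed.

Lemma dg_bar_linear : linear (@dg_bar R A).
Proof.
move=> r a b; pose n := maxn (dg_bound (r *: a + b)) (maxn (dg_bound a) (dg_bound b)).
rewrite !(@dg_barE n) /n ?leq_max ?leqnn ?orbT //.
rewrite scaler_sumr -big_split /=; apply: eq_bigr => i _.
by rewrite linearP /= scalerDr !scalerA mulrC.
Qed.
HB.instance Definition _ := GRing.isLinear.Build R A A *:%R (@dg_bar R A) dg_bar_linear.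

Lemma dg_bar_homog i a : homogeneous i a -> dg_bar a = (-1) ^+ i.+1 *: a.
Proof.
move=> ia; pose n := maxn (dg_bound a) i.+1.
have ni : (i < n)%N by rewrite /n leq_max leqnn orbT.
rewrite (@dg_barE n) ?leq_maxl // (bigD1 (Ordinal ni)) //= ia big1 ?addr0 // => j.
rewrite -val_eqE /= => ji; rewrite (comp_homog _ ia) (negPf ji) scaler0 //.
Qed.

Lemma signrS_sqr i : (-1) ^+ i * (-1) ^+ i = 1 :> R.
Proof. by rewrite -exprMn mulrNN mulr1 expr1n. Qed.

Lemma dg_barK a : dg_bar (dg_bar a) = a.
Proof.
elim/dg_ind: a => [|a b IHa IHb|j a ja]; first by rewrite !linear0.
  by rewrite !linearD /= IHa IHb.
by rewrite (dg_bar_homog ja) linearZ /= (dg_bar_homog ja) scalerA signrS_sqr scale1r.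
Qed.

Lemma diff_bar a : d (dg_bar a) = - dg_bar (d a).
Proof.
elim/dg_ind: a => [|a b IHa IHb|j a ja]; first by rewrite !linear0 ?oppr0.
  by rewrite !linearD /= IHa IHb ?opprD.
rewrite (dg_bar_homog ja) linearZ /=.
case: j ja => [|j] ja; first by rewrite dg_diff0 // scaler0 linear0 ?oppr0.
by rewrite (dg_bar_homog (dg_diffS ja)) [in LHS]exprS mulN1r scaleNr.
Qed.

Lemma dg_barM a b : dg_bar (a * b) = - (dg_bar a * dg_bar b).
Proof.
elim/dg_ind: a => [|a a' IHa IHa'|i a ia]; first by rewrite mul0r !linear0 mul0r ?oppr0.
  by rewrite mulrDl !linearD /= IHa IHa' mulrDl ?opprD.
elim/dg_ind: b => [|b b' IHb IHb'|j b jb]; first by rewrite mulr0 !linear0 mulr0 ?oppr0.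
  by rewrite mulrDr !linearD /= IHb IHb' mulrDr ?opprD.
rewrite (dg_bar_homog ia) (dg_bar_homog jb) (dg_bar_homog (homogeneousM ia jb)).
rewrite -scalerAl -scalerAr scalerA -exprD -scaleNr; congr (_ *: _).
by rewrite addSn addnS !exprS !mulN1r opprK.
Qed.

(** Written with the bar, the Leibniz rule contains no degree and so extends to inhomogeneous
    elements, such as the values of a Massey operation. *)
Lemma dg_leibniz_bar a b : d (a * b) = d a * b - dg_bar a * d b.
Proof.
elim/dg_ind: a => [|a a' IHa IHa'|i a ia]; first by rewrite !(mul0r, linear0, addr0).
  rewrite mulrDl linearD IHa IHa' (linearD (dg_diff A)) mulrDl (linearD (@dg_bar R A)) mulrDl.
  by rewrite opprD addrACA.
rewrite (dg_leibniz b ia) (dg_bar_homog ia) signM.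
by rewrite exprS mulN1r scaleNr mulNr opprK -scalerAl.
Qed.

Lemma diff1 : d 1 = 0.
Proof. by rewrite dg_diff0 // dg_one. Qed.

Lemma bar1 : dg_bar (1 : A) = -1.
Proof. by rewrite (dg_bar_homog (dg_one A)) expr1 scaleN1r. Qed.

Lemma homogeneous_diff i a : homogeneous i.+1 a -> homogeneous i (d a).
Proof. exact: dg_diffS. Qed.

End DGAlgebra.

Section Truncation.
Variables (R : comUnitRingType) (k : fieldType) (res : {rmorphism R -> k}).
Variables (A : acyclicClosure res) (q : nat).

Notation T := (variables (ac_num A) q).
Notation expo := {ffun T -> nat}.
Notation d := (dg_diff A).
Notation mono := (@monomial R A _ (@ac_var _ _ _ A) q).
Notation adm := (@admissible _ q).
Implicit Types (v w : T) (m : expo) (a b : A).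

Definition tg v : nat := tag v.
Definition xv v (e : nat) : A := ac_var (tagged v) e.
Definition wt m : nat := \sum_v tg v * m v.

Definition spanned (P : pred expo) a : Prop := exists (s : seq expo) (c : expo -> R),
  all (fun m => adm m && P m) s /\ a = \sum_(m <- s) c m *: mono m.

Lemma spanned_sub (P Q : pred expo) a : (forall m, adm m -> P m -> Q m) -> spanned P a -> spanned Q a.
Proof.
move=> PQ [s [c [/allP sP ->]]]; exists s, c; split=> //; apply/allP => m /sP/andP[am Pm].
by rewrite am PQ.
Qed.

Lemma spanned0 P : spanned P 0.
Proof. by exists [::], (fun=> 0); rewrite big_nil. Qed.

Lemma spanned_mono (P : pred expo) m : adm m -> P m -> spanned P (mono m).
Proof.
by move=> am Pm; exists [:: m], (fun=> 1); rewrite /= am Pm big_seq1 scale1r.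
Qed.

(* Repetitions in the list [s] are counted with multiplicity. *)
Lemma spanned_uniq P a : spanned P a -> exists (s : seq expo) (c : expo -> R),
  [/\ uniq s, all (fun m => adm m && P m) s & a = \sum_(m <- s) c m *: mono m].
Proof.
case=> s [c [/allP sP ->]]; exists (undup s), (fun m => c m *+ count_mem m s); split.
- exact: undup_uniq.
- by apply/allP => m; rewrite mem_undup => /sP.
rewrite -[LHS]big_undup_iterop_count; apply: eq_bigr => m _.
by rewrite -scalerMnl.
Qed.

Lemma spanned_lin P r a b : spanned P a -> spanned P b -> spanned P (r *: a + b).
Proof.
move=> /spanned_uniq[s [c [us /allP sP ->]]] /spanned_uniq[s' [c' [us' /allP sP' ->]]].
exists (undup (s ++ s')), (fun m => r * (if m \in s then c m else 0) + (if m \in s' then c' m else 0)).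
split; first by apply/allP => m; rewrite mem_undup mem_cat => /orP[/sP|/sP'].
under [RHS]eq_bigr do rewrite scalerDl -scalerA.
rewrite big_split -scaler_sumr /=.
have sub (t : seq expo) (f : expo -> R) : uniq t -> {subset t <= undup (s ++ s')} ->
    \sum_(m <- t) f m *: mono m =
    \sum_(m <- undup (s ++ s')) (if m \in t then f m else 0) *: mono m.
  move=> ut tu; rewrite [RHS](bigID (fun m => m \in t)) /= [X in _ = _ + X]big1 ?addr0.
    rewrite (perm_big [seq m <- undup (s ++ s') | m \in t]) /=.
      by rewrite !big_filter; apply: eq_bigr => m ->.
    apply: uniq_perm => //; first exact: filter_uniq (undup_uniq _).
    by move=> m; rewrite mem_filter; case: (boolP (m \in t)) => // /tu ->.
  by move=> m /negPf->; rewrite scale0r.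
by congr (_ *: _ + _); apply: sub => // m mt; rewrite mem_undup mem_cat mt ?orbT.
Qed.

Lemma submod_spanned P : submod (spanned P).
Proof. by split; [exact: spanned0|exact: spanned_lin]. Qed.

Lemma spanned_ind (P : pred expo) (Z : A -> Prop) : submod Z ->
  (forall m, adm m -> P m -> Z (mono m)) -> forall a, spanned P a -> Z a.
Proof.
move=> sZ Zm a [s [c [/allP sP ->]]]; apply: submod_sum_seq => // m /sP/andP[am Pm].
by apply: submodZ => //; exact: Zm.
Qed.

Lemma truncation_spanned a : truncation (@ac_var _ _ _ A) q a <-> spanned predT a.
Proof.
split=> [[s [c [/allP sP ->]]]|[s [c [/allP sP ->]]]]; exists s, c; split=> //.
  by apply/allP => m /sP ->.
by apply/allP => m /sP/andP[].
Qed.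

Lemma xv_homog v e : homogeneous (tg v * e)%N (xv v e).
Proof. exact: ac_var_homogeneous. Qed.

Lemma xv_odd v e : odd (tg v) -> (1 < e)%N -> xv v e = 0.
Proof. exact: ac_var_odd. Qed.

Lemma tg_gt0 v : (0 < tg v)%N.
Proof.
rewrite lt0n /tg; apply/negP => /eqP; case: v => -[j lj] /= x j0; subst j.
by have := x; rewrite (ac_num0 A) => -[].
Qed.

Lemma seq_homog (l : seq T) m :
  homogeneous (\sum_(w <- l) tg w * m w)%N (\prod_(w <- l) xv w (m w)).
Proof.
elim: l => [|v l IH]; first by rewrite !big_nil; exact: dg_one.
by rewrite !big_cons; apply: homogeneousM => //; exact: xv_homog.
Qed.

Lemma mono_homog m : homogeneous (wt m) (mono m).
Proof. by have := seq_homog (index_enum T) m. Qed.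

Definition raise v e m : expo := [ffun w => if w == v then e + m w else m w]%N.

(** Graded commutativity moves the new factor, up to sign, to the place of its own variable, where
    the two divided powers multiply with a binomial coefficient. *)
Lemma xv_seq v e m (l : seq T) : uniq l -> v \in l -> exists r : R,
  xv v e * \prod_(w <- l) xv w (m w) = r *: \prod_(w <- l) xv w (raise v e m w).
Proof.
elim: l => // w l IH /= /andP[wl ul]; rewrite inE => /orP[/eqP vw|vl].
  subst w; exists 'C(e + m v, e)%:R; rewrite !big_cons mulrA ac_var_mul scaler_nat.
  rewrite ffunE eqxx -mulrnAl; congr (_ * _); apply: eq_big_seq => w wl'.
  by rewrite ffunE; case: eqP => // ewv; rewrite -ewv wl' in wl.
have [r E] := IH ul vl; rewrite !big_cons.
exists ((-1) ^+ (tg v * e * (tg w * m w)) * r).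
have nwv : (w == v) = false by apply/negP => /eqP ewv; rewrite ewv vl in wl.
rewrite mulrA (dg_comm (xv_homog v e) (xv_homog w (m w))) signM -scalerAl -mulrA E.
by rewrite -scalerAr scalerA ffunE nwv.
Qed.

Lemma prod_seq0 v (l : seq T) (f : T -> A) : v \in l -> f v = 0 -> \prod_(w <- l) f w = 0.
Proof.
elim: l => // w l IH; rewrite inE big_cons => /orP[/eqP<- ->|vl fv]; first by rewrite mul0r.
by rewrite IH // mulr0.
Qed.

Lemma spanned_xvM (P : pred expo) v e a :
  (forall m, P m -> P (raise v e m)) -> spanned P a -> spanned P (xv v e * a).
Proof.
move=> Pb; apply: (spanned_ind (Z := fun a => spanned P (xv v e * a))) => [|m am Pm].
  split=> [|r x y]; first by rewrite mulr0; exact: spanned0.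
  by rewrite mulrDr -scalerAr; exact: spanned_lin.
have [r] := xv_seq e m (index_enum_uniq T) (mem_index_enum v).
rewrite -[\prod_(w <- _) xv w (m w)]/(mono m) => ->.
rewrite -[\prod_(w <- _) _]/(mono (raise v e m)).
have [ov|ov] := boolP (odd (tg v) && (1 < e + m v)%N).
  case/andP: ov => ov gt1; rewrite (_ : mono _ = 0) ?scaler0; first exact: spanned0.
  apply: (prod_seq0 (mem_index_enum v)); apply: xv_odd => //.
  by rewrite ffunE eqxx.
apply: (submodZ (submod_spanned P)); apply: spanned_mono; last exact: Pb.
apply/forallP => w; rewrite ffunE; have [->|_] := eqVneq w v; last exact: (forallP am).
by apply/implyP => ow; rewrite -/(tg v) in ow; rewrite leqNgt; apply: contra ov => ->; rewrite ow.
Qed.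

Lemma spanned_seqM (P : pred expo) (l : seq T) m a :
  (forall v m', v \in l -> P m' -> m v != 0%N -> P (raise v (m v) m')) ->
  spanned P a -> spanned P ((\prod_(w <- l) xv w (m w)) * a).
Proof.
move=> Pb Sa; elim: l Pb => [|w l IH] Pb; first by rewrite big_nil mul1r.
rewrite big_cons -mulrA; have [m0|m0] := eqVneq (m w) 0%N.
  by rewrite m0 {1}/xv ac_var0 mul1r; apply: IH => v m' vl; apply: Pb; rewrite ?inE ?vl ?orbT.
apply: spanned_xvM; first by move=> m' Pm; apply: Pb; rewrite ?inE ?eqxx.
by apply: IH => v m' vl; apply: Pb; rewrite ?inE ?vl ?orbT.
Qed.

Definition U := spanned predT.

Lemma U_monoM m a : U a -> U (mono m * a).
Proof. by apply: spanned_seqM. Qed.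

Lemma UM a b : U a -> U b -> U (a * b).
Proof.
move=> Ua Ub; move: a Ua; apply: (spanned_ind (Z := fun a => U (a * b))) => [|m _ _]; last exact: U_monoM.
split=> [|r x y]; first by rewrite mul0r; exact: spanned0.
by rewrite mulrDl -scalerAl; exact: spanned_lin.
Qed.

Definition e0 : expo := [ffun=> 0%N].

Lemma mono0 : mono e0 = 1.
Proof. by rewrite /monomial big1 // => v _; rewrite ffunE ac_var0. Qed.

Lemma adm0 : adm e0.
Proof. by apply/forallP => v; rewrite ffunE implybT. Qed.

Lemma U1 : U 1. Proof. by rewrite -mono0; apply: spanned_mono => //; exact: adm0. Qed.

Lemma U_xv v e : U (xv v e).
Proof. by rewrite -[xv v e]mulr1; apply: spanned_xvM => //; exact: U1. Qed.

Lemma truncation_U n a : (n <= q)%N -> truncation (@ac_var _ _ _ A) n a -> U a.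
Proof.
move=> nq [s [c [_ ->]]]; apply: submod_sum => [|m _]; first exact: submod_spanned.
apply: submodZ; first exact: submod_spanned.
apply: (big_ind U) => [|x y|v _]; [exact: U1|exact: UM|].
have nq' : (n.+1 <= q.+1)%N by [].
by have := U_xv (existT _ (widen_ord nq' (tag v)) (tagged v) : T) (m v).
Qed.

Lemma U_comp i a : U a -> U (dg_comp A i a).
Proof.
apply: (spanned_ind (Z := fun a => U (dg_comp A i a))) => [|m am _].
  split=> [|r x y Ux Uy]; first by rewrite linear0; exact: spanned0.
  by rewrite linearP; exact: spanned_lin.
rewrite (comp_homog _ (mono_homog m)); case: eqP => _; last exact: spanned0.
exact: spanned_mono.
Qed.

Lemma diff_gen_degree1 v : tg v = 1%N -> exists2 r : R, res r = 0 & d (xv v 1) = r%:A.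
Proof.
case: v => -[j lj] x j1; rewrite /tg /= in j1 *; subst j.
by have [H _ _] := ac_min1 A; have := H x.
Qed.

(** A variable of degree 1 is sent to a scalar, and any other to a cycle in the truncation at the
    preceding degree. *)
Lemma U_diff_gen v : U (d (xv v 1)).
Proof.
have [t1|t1] := eqVneq (tg v) 1%N.
  have [r _ ->] := diff_gen_degree1 t1; apply: submodZ; [exact: submod_spanned|exact: U1].
have t0 := tg_gt0 v; have tq : (tg v <= q)%N by rewrite -ltnS ltn_ord.
have [n en] : exists n, tg v = n.+2 by exists (tg v).-2; lia.
apply: (@truncation_U n.+1); first lia.
case: v t1 t0 tq en => -[j lj] x _ _ _; rewrite /tg /= => en; subst j.
by have [H _ _] := ac_minS A (ltn0Sn n); have [] := H x.
Qed.

Lemma U_diff_xv v e : U (d (xv v e)).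
Proof.
case: e => [|e]; first by rewrite /xv ac_var0 diff1; exact: spanned0.
have [ov|ev] := boolP (odd (tg v)); last first.
  by rewrite /xv ac_var_diff //; apply: UM; [exact: U_diff_gen|exact: U_xv].
case: e => [|e]; first exact: U_diff_gen.
by rewrite (xv_odd ov) // linear0; exact: spanned0.
Qed.

Lemma U_diff a : U a -> U (d a).
Proof.
apply: (spanned_ind (Z := fun a => U (d a))) => [|m am _].
  split=> [|r x y Ux Uy]; first by rewrite linear0; exact: spanned0.
  by rewrite linearP; exact: spanned_lin.
suff H : forall l : seq T, U (\prod_(w <- l) xv w (m w)) /\ U (d (\prod_(w <- l) xv w (m w))).
  by have [] := H (index_enum T).
elim=> [|w l [IH1 IH2]]; first by rewrite big_nil diff1; split; [exact: U1|exact: spanned0].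
rewrite big_cons; split; first by apply: UM => //; exact: U_xv.
rewrite (dg_leibniz _ (xv_homog w (m w))) signM.
apply: submodD; [exact: submod_spanned| |].
  by apply: UM => //; exact: U_diff_xv.
apply: submodZ; first exact: submod_spanned.
by apply: UM => //; exact: U_xv.
Qed.

Lemma U_bar a : U a -> U (dg_bar a).
Proof.
move=> Ua; rewrite (dg_barE (leqnn _)); apply: (submod_sum (B := U)) => [|i _]; first exact: submod_spanned.
by apply: submodZ; [exact: submod_spanned|exact: U_comp].
Qed.

(** All variables have positive degree, so that exponents in weight [n] are at most [n] and finitely
    many candidates suffice. *)
Definition fibU n : seq expo :=
  [seq m <- [seq [ffun v => val (f v)] | f : {ffun T -> 'I_n.+1}] | adm m && (wt m == n)].

Lemma mem_fibU n m : (m \in fibU n) = adm m && (wt m == n).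
Proof.
rewrite mem_filter; case: (boolP (adm m && _)) => //= /andP[am /eqP en].
apply/mapP; exists [ffun v => inord (m v)]; first by rewrite mem_enum.
apply/ffunP => v; rewrite !ffunE inordK // ltnS -en /wt (bigD1 v) //=.
by rewrite (leq_trans _ (leq_addr _ _)) // leq_pmull // tg_gt0.
Qed.

Lemma fibU_uniq n : uniq (fibU n).
Proof.
apply: filter_uniq; rewrite map_inj_uniq ?enum_uniq // => f g /ffunP e.
by apply/ffunP => v; apply/val_inj; have := e v; rewrite !ffunE.
Qed.

Lemma spanned_fibU (P : pred expo) n a : spanned P a -> homogeneous n a ->
  exists c : expo -> R, (forall m, ~~ P m -> c m = 0) /\ a = \sum_(m <- fibU n) c m *: mono m.
Proof.
move=> Sa <-; pose Z a := exists c : expo -> R, (forall m, ~~ P m -> c m = 0) /\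
  dg_comp A n a = \sum_(m <- fibU n) c m *: mono m.
apply: (spanned_ind (Z := Z)) Sa => [|m am Pm].
  split=> [|r x y [c [c0 Ec]] [c' [c'0 Ec']]].
    by exists (fun=> 0); split=> //; rewrite linear0 big1 // => m _; rewrite scale0r.
  exists (fun m => r * c m + c' m); split=> [m Pm|].
    by rewrite c0 // c'0 // mulr0 addr0.
  rewrite linearP /= Ec Ec' scaler_sumr -big_split; apply: eq_bigr => m _.
  by rewrite scalerDl scalerA.
rewrite /Z (comp_homog _ (mono_homog m)).
case: eqP => en; last first.
  by exists (fun=> 0); split=> //; rewrite big1 // => m' _; rewrite scale0r.
exists (fun m' => (m' == m)%:R); split=> [m' Pm'|].
  by case: eqP => // e; rewrite e Pm in Pm'.
rewrite (bigD1_seq m) ?fibU_uniq ?mem_fibU ?am -?en ?eqxx //= scale1r big1 ?addr0 //.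
by move=> m' /negPf->; rewrite scale0r.
Qed.

Lemma fibU_free n (c : expo -> R) : \sum_(m <- fibU n) c m *: mono m = 0 ->
  forall m, m \in fibU n -> c m = 0.
Proof.
apply: (ac_free (fibU_uniq n)); apply/allP => m.
by rewrite mem_fibU => /andP[].
Qed.

End Truncation.

(** * The filtration of a truncation by the variables of degree at least 2 *)

Section Filtration.
Variables (R : comUnitRingType) (k : fieldType) (res : {rmorphism R -> k}).
Variables (A : acyclicClosure res) (q : nat).

Notation T := (variables (ac_num A) q).
Notation expo := {ffun T -> nat}.
Notation d := (dg_diff A).
Notation mono := (@monomial R A _ (@ac_var _ _ _ A) q).
Notation adm := (@admissible _ q).
Notation U := (@U _ _ _ A q).
Notation fibU := (@fibU _ _ _ A q).
Notation wt := (@wt _ _ _ A q).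
Notation tg := (@tg _ _ _ A q).
Notation xv := (@xv _ _ _ A q).
Notation e0 := (@e0 _ _ _ A q).
Notation spanned := (@spanned _ _ _ A q).
Implicit Types (v w : T) (m l mu : expo) (a b : A).

(** Coordinates in the monomial basis of degree [n], made total by the value 0 off its span; only
    their values on [fibU n] are determined. *)
Definition coefU n a : expo -> R :=
  match pselect (exists c : expo -> R, a = \sum_(m <- fibU n) c m *: mono m) with
  | left ex => projT1 (cid ex)
  | right _ => fun=> 0
  end.

Lemma coefUE n a : U a -> homogeneous n a -> a = \sum_(m <- fibU n) coefU n a m *: mono m.
Proof.
move=> Ua na; have [c [_ ec]] := spanned_fibU Ua na.
rewrite /coefU; case: pselect => [ex|[]]; last by exists c.
exact: (projT2 (cid ex)).
Qed.

Lemma coefU_uniq n a (c : expo -> R) : a = \sum_(m <- fibU n) c m *: mono m ->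
  forall m, m \in fibU n -> coefU n a m = c m.
Proof.
move=> ea m mn; rewrite /coefU; case: pselect => [ex|[]]; last by exists c.
case: (cid ex) => c' /= ea'; apply/eqP; rewrite -subr_eq0; apply/eqP.
apply: (fibU_free (c := fun m => c' m - c m)) mn; under eq_bigr do rewrite scalerBl.
by rewrite sumrB -ea' -ea subrr.
Qed.

Lemma coefU_lin n r a b m : U a -> homogeneous n a -> U b -> homogeneous n b ->
  m \in fibU n -> coefU n (r *: a + b) m = r * coefU n a m + coefU n b m.
Proof.
move=> Ua na Ub nb; apply: (coefU_uniq (c := fun m => r * coefU n a m + coefU n b m)); rewrite {1}(coefUE Ua na) {1}(coefUE Ub nb).
by rewrite scaler_sumr -big_split; apply: eq_bigr => i _; rewrite scalerDl scalerA.
Qed.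

Lemma coefU_sum n (I : eqType) (s : seq I) (c : I -> R) (f : I -> A) m :
  (forall i, i \in s -> U (f i) /\ homogeneous n (f i)) -> m \in fibU n ->
  coefU n (\sum_(i <- s) c i *: f i) m = \sum_(i <- s) c i * coefU n (f i) m.
Proof.
move=> H mn; elim: s H => [|i s IH] H.
  rewrite !big_nil; apply: (coefU_uniq (c := fun=> 0)) mn.
  by rewrite big1 // => ? _; rewrite scale0r.
have [Ui ni] := H i (mem_head _ _).
have Hs j : j \in s -> U (f j) /\ homogeneous n (f j) by move=> js; apply: H; rewrite inE js orbT.
rewrite !big_cons coefU_lin ?IH //.
  apply: (submod_sum_seq (B := U)) => [|j /Hs[Uj _]]; first exact: submod_spanned.
  by apply: submodZ => //; exact: submod_spanned.
apply: (submod_sum_seq (B := homogeneous n : A -> Prop)) => [|j /Hs[_ nj]].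
  by split; [exact: homogeneous0|move=> ? ? ?; exact: homogeneous_lin].
by have := homogeneous_lin (c j) nj (homogeneous0 A n); rewrite addr0.
Qed.

Lemma coefU_mono n m m' : m \in fibU n -> m' \in fibU n -> coefU n (mono m) m' = (m' == m)%:R.
Proof.
move=> mn; apply: (coefU_uniq (c := fun m' => (m' == m)%:R)); rewrite (bigD1_seq m) ?fibU_uniq //= eqxx scale1r big1 ?addr0 //.
by move=> i /negPf->; rewrite scale0r.
Qed.

Lemma coefU_spanned (P : pred expo) n a m : spanned P a -> homogeneous n a -> ~~ P m ->
  m \in fibU n -> coefU n a m = 0.
Proof.
by move=> Sa na Pm mn; have [c [c0 ec]] := spanned_fibU Sa na; rewrite (coefU_uniq ec mn) c0.
Qed.

Lemma fibU_mono n m : m \in fibU n -> U (mono m) /\ homogeneous n (mono m).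
Proof.
rewrite mem_fibU => /andP[am /eqP<-]; split; last exact: mono_homog.
exact: spanned_mono.
Qed.

Definition hi m : expo := [ffun v => if tg v == 1%N then 0%N else m v].
Definition lo m : expo := [ffun v => if tg v == 1%N then m v else 0%N].
Definition madd m m' : expo := [ffun v => (m v + m' v)%N].

Lemma wt_hi m : (wt (hi m) <= wt m)%N.
Proof. by apply: leq_sum => v _; rewrite ffunE; case: eqP => _; rewrite ?muln0. Qed.
Lemma wt_madd m m' : wt (madd m m') = (wt m + wt m')%N.
Proof. by rewrite /wt -big_split; apply: eq_bigr => v _; rewrite ffunE mulnDr. Qed.
Lemma hi_hi m : hi (hi m) = hi m.
Proof. by apply/ffunP => v; rewrite !ffunE; case: eqP. Qed.
Lemma hi_lo m : hi (lo m) = e0.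
Proof. by apply/ffunP => v; rewrite !ffunE; case: eqP. Qed.
Lemma madd_lo_hi m : madd (lo m) (hi m) = m.
Proof. by apply/ffunP => v; rewrite !ffunE; case: eqP; rewrite ?addn0. Qed.
Lemma hi_madd l mu : hi l = e0 -> hi mu = mu -> hi (madd l mu) = mu.
Proof.
move=> /ffunP l0 /ffunP hmu; apply/ffunP => v; have := l0 v; have := hmu v.
by rewrite !ffunE; case: eqP => // _ _ ->.
Qed.
Lemma lo_madd l mu : hi l = e0 -> hi mu = mu -> lo (madd l mu) = l.
Proof.
move=> /ffunP l0 /ffunP hmu; apply/ffunP => v; have := l0 v; have := hmu v.
by rewrite !ffunE; case: eqP => // _ <-; rewrite addn0.
Qed.
Lemma adm_lo m : adm m -> adm (lo m).
Proof.
move=> /forallP am; apply/forallP => v; rewrite ffunE; case: eqP => _; [exact: am|by rewrite implybT].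
Qed.
Lemma adm_hi m : adm m -> adm (hi m).
Proof.
move=> /forallP am; apply/forallP => v; rewrite ffunE; case: eqP => _; [by rewrite implybT|exact: am].
Qed.
Lemma adm_madd l mu : adm l -> adm mu -> hi l = e0 -> hi mu = mu -> adm (madd l mu).
Proof.
move=> /forallP al /forallP amu /ffunP l0 /ffunP hmu; apply/forallP => v.
have := l0 v; have := hmu v; have := al v; have := amu v; rewrite !ffunE.
by case: eqP => [_ _ H <-|_ H _ _ ->] //; rewrite addn0.
Qed.
Lemma wt_lo_hi m : wt m = (wt (lo m) + wt (hi m))%N.
Proof. by rewrite -wt_madd madd_lo_hi. Qed.

(** Variables are enumerated by increasing degree, so those of degree 1 come first. A monomial
    therefore factors into its low and high parts without a sign. *)
Lemma index_enum_split : exists s1 s2 : seq T,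
  [/\ index_enum T = s1 ++ s2, all (fun v => tg v == 1%N) s1 & all (fun v => tg v != 1%N) s2].
Proof.
pose blk (i : 'I_q.+1) := [seq Tagged (fun j : 'I_q.+1 => 'I_(ac_num A j)) x | x <- Finite.enum 'I_(ac_num A i)].
have tblk i v : v \in blk i -> tg v = i by case/mapP => x _ ->.
have -> : index_enum T = flatten [seq blk i | i <- enum 'I_q.+1].
  by rewrite [index_enum T]unlock [in LHS]unlock /tag_enum enumT.
have srt : sorted ltn (map val (enum 'I_q.+1)) by rewrite val_enum_ord iota_ltn_sorted.
elim: (enum 'I_q.+1) srt => [|i s IH] /=; first by exists [::], [::].
move=> srt; have /IH[s1 [s2 [es a1 a2]]] := path_sorted srt.
have /allP mins := order_path_min ltn_trans srt.
have gti v : v \in flatten [seq blk i | i <- s] -> (i < tg v)%N.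
  by case/flatten_mapP => j js /tblk ->; apply: mins; apply: map_f.
case: (ltngtP i 1%N) => i1.
- exists s1, s2; split=> //; rewrite es (_ : blk i = [::]) //.
  apply/nilP/negPn/negP => /eqP; case eb: (blk i) => [|v b] // _.
  have := tg_gt0 v; rewrite (tblk i) ?eb ?mem_head //; lia.
- exists [::], (blk i ++ flatten [seq blk i | i <- s]); split=> //; rewrite all_cat.
  apply/andP; split; apply/allP => v; first by move/tblk => ->; lia.
  by move/gti; lia.
- exists (blk i), (flatten [seq blk i | i <- s]); split=> //; apply/allP => v.
    by move/tblk => ->; apply/eqP.
  by move/gti; lia.
Qed.

Lemma mono_madd l mu : hi l = e0 -> hi mu = mu -> mono (madd l mu) = mono l * mono mu.
Proof.
move=> /ffunP l0 /ffunP hmu; have [s1 [s2 [es /allP a1 /allP a2]]] := index_enum_split.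
rewrite /monomial es !big_cat /=.
have -> : \prod_(v <- s2) ac_var (tagged v) (l v) = 1.
  rewrite big_seq big1 // => v /a2 /negPf v1; have := l0 v; rewrite !ffunE v1 => ->.
  exact: ac_var0.
have -> : \prod_(v <- s1) ac_var (tagged v) (mu v) = 1.
  rewrite big_seq big1 // => v /a1 v1; have := hmu v; rewrite !ffunE v1 => <-.
  exact: ac_var0.
rewrite mulr1 mul1r; congr (_ * _); apply: eq_big_seq => v.
  by move/a1 => v1; have := hmu v; rewrite !ffunE v1 => <-; rewrite addn0.
by move/a2 => /negPf v1; have := l0 v; rewrite !ffunE v1 => ->.
Qed.

Lemma spanned_lowM (P : pred expo) l a : hi l = e0 ->
  spanned (fun m => P (hi m)) a -> spanned (fun m => P (hi m)) (mono l * a).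
Proof.
move=> /ffunP l0; apply: spanned_seqM => v m' _ Pm lv.
rewrite (_ : hi (raise v (l v) m') = hi m') //; apply/ffunP => w; rewrite !ffunE.
case: eqP => // w1; case: eqP => // e; subst w; have := l0 v; rewrite !ffunE.
by case: eqP => // _ e; rewrite e eqxx in lv.
Qed.

(** This is the Koszul complex on the chosen generators of the maximal ideal. *)
Definition lowspan := spanned (fun m => hi m == e0).

Lemma lowspanM a b : lowspan a -> lowspan b -> lowspan (a * b).
Proof.
move=> La Lb; move: a La; apply: (spanned_ind (Z := fun a => lowspan (a * b))).
  split=> [|r x y]; first by rewrite mul0r; exact: spanned0.
  by rewrite mulrDl -scalerAl; exact: spanned_lin.
by move=> m am /eqP m0; exact: (spanned_lowM (P := pred1 e0)).
Qed.

Lemma hi_e0 : hi e0 = e0. Proof. by apply/ffunP => v; rewrite !ffunE; case: eqP. Qed.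

Lemma lowspan1 : lowspan 1.
Proof. by rewrite -(mono0 A q); apply: spanned_mono; [exact: adm0|exact/eqP/hi_e0]. Qed.

Lemma lowspan_xv v e : tg v = 1%N -> lowspan (xv v e) /\ lowspan (d (xv v e)).
Proof.
move=> v1; have Lx : lowspan (xv v e).
  rewrite -[xv v e]mulr1; apply: spanned_xvM; last exact: lowspan1.
  move=> m /eqP/ffunP hm; apply/eqP/ffunP => w; have := hm w; rewrite !ffunE.
  by case: eqP => // w1; case: eqP => // e'; rewrite e' v1 in w1.
split=> //; case: e Lx => [|[|e]] Lx.
- by rewrite /xv ac_var0 diff1; exact: spanned0.
- have [r _ ->] := diff_gen_degree1 v1.
  by apply: submodZ; [exact: submod_spanned|exact: lowspan1].
- by rewrite (xv_odd (v := v)) ?v1 // linear0; exact: spanned0.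
Qed.

Lemma lowspan_diff l : hi l = e0 -> lowspan (d (mono l)).
Proof.
move=> /ffunP l0.
suff H : forall s : seq T, lowspan (\prod_(w <- s) xv w (l w)) /\ lowspan (d (\prod_(w <- s) xv w (l w))).
  by have [] := H (index_enum T).
elim=> [|w s [IH1 IH2]]; first by rewrite big_nil diff1; split; [exact: lowspan1|exact: spanned0].
rewrite big_cons; have [w1|/negPf w1] := eqVneq (tg w) 1%N; last first.
  by have := l0 w; rewrite !ffunE w1 => ->; rewrite {1 3}/xv !ac_var0 !mul1r.
have [Lx Ldx] := lowspan_xv (l w) w1; split; first exact: lowspanM.
rewrite (dg_leibniz _ (xv_homog w (l w))) signM.
apply: submodD; [exact: submod_spanned|exact: lowspanM|].
by apply: submodZ; [exact: submod_spanned|exact: lowspanM].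
Qed.

Definition DU m m' : R := coefU (wt m).-1 (d (mono m)) m'.

Lemma diff_mono_homog n m : m \in fibU n.+1 -> U (d (mono m)) /\ homogeneous n (d (mono m)).
Proof. by case/fibU_mono => Um nm; split; [exact: U_diff|exact: homogeneous_diff]. Qed.

Lemma DUE n m m' : m \in fibU n.+1 -> DU m m' = coefU n (d (mono m)) m'.
Proof. by rewrite mem_fibU /DU => /andP[_ /eqP->]. Qed.

Lemma diff_monoE n m : m \in fibU n.+1 -> d (mono m) = \sum_(m' <- fibU n) DU m m' *: mono m'.
Proof.
move=> mn; have [Um nm] := diff_mono_homog mn.
by rewrite {1}(coefUE Um nm); apply: eq_bigr => m' _; rewrite (DUE _ mn).
Qed.

(* The differential does not raise the weight of the part of a monomial in the
   variables of degree at least 2, and its part preserving this weight is the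
   Koszul differential on the variables of degree 1. *)
Lemma DU_hi n m m' : m \in fibU n.+1 -> m' \in fibU n -> (wt (hi m) <= wt (hi m'))%N ->
  DU m m' = if hi m' == hi m then DU (lo m) (lo m') else 0.
Proof.
move=> mn m'n le_hi; have := mn; rewrite mem_fibU => /andP[am /eqP wm].
have := m'n; rewrite mem_fibU => /andP[am' /eqP wm'].
set l := lo m; set mu := hi m in le_hi *.
(* Were the low part trivial, [hi m] would have the full weight [n.+1], and [hi m'], of weight at
   most [n], could not weigh as much. *)
have [j ej] : exists j, wt l = j.+1.
  exists (wt l).-1; rewrite prednK //; have := wt_hi m'; have := wt_lo_hi m.
  rewrite -/l -/mu; lia.
have lj : l \in fibU j.+1 by rewrite mem_fibU adm_lo // ej eqxx.
have el : mono m = mono l * mono mu.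
  by rewrite -mono_madd ?hi_lo ?hi_hi // madd_lo_hi.
(* In [d (mono mu)] the total weight, and hence the weight of the high part, is below that of [mu];
   multiplication by the low monomial [mono l] does not affect the high part. This term thus
   contributes nothing at [m']. *)
have S2 : spanned (fun m => wt (hi m) < wt mu)%N ((-1) ^+ wt l *: (mono l * d (mono mu))).
  apply: submodZ; first exact: submod_spanned.
  apply: (spanned_lowM (P := fun m => wt m < wt mu)%N); first exact: hi_lo.
  have Umu : U (mono mu) by apply: spanned_mono => //; exact: adm_hi.
  case ep : (wt mu) => [|p].
    by rewrite dg_diff0; [exact: spanned0|have := mono_homog mu; rewrite ep].
  have mup : mu \in fibU p.+1 by rewrite mem_fibU adm_hi // ep eqxx.
  rewrite (diff_monoE mup); apply: submod_sum_seq; first exact: submod_spanned.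
  move=> x; rewrite mem_fibU => /andP[ax /eqP wx]; apply: submodZ; first exact: submod_spanned.
  by apply: spanned_mono => //; rewrite ltnS -wx wt_hi.
(* The other Leibniz term is the Koszul differential of the low part, with [mu] carried along
   unchanged. *)
have S1 : d (mono l) * mono mu =
    \sum_(x <- fibU n) (if hi x == mu then DU l (lo x) else 0) *: mono x.
  rewrite (diff_monoE lj) mulr_suml.
  rewrite (bigID (fun x => hi x == e0)) /= [X in _ + X]big_seq_cond [X in _ + X]big1 ?addr0; last first.
    move=> x /andP[xj xlow]; rewrite (DUE _ lj).
    have [_ nd] := diff_mono_homog lj.
    by rewrite (coefU_spanned (lowspan_diff (hi_lo m)) nd) ?scale0r ?mul0r.
  rewrite [RHS](bigID (fun x => hi x == mu)) /= [X in _ = _ + X]big1 ?addr0; last first.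
    by move=> x /negPf->; rewrite scale0r.
  rewrite -[RHS]big_filter [RHS](perm_big [seq madd x mu | x <- fibU j & hi x == e0]).
    rewrite big_map big_filter; apply: eq_bigr => x /eqP x0.
    by rewrite hi_madd ?lo_madd ?eqxx ?mono_madd ?scalerAl // hi_hi.
  apply: uniq_perm; first by rewrite filter_uniq // fibU_uniq.
    rewrite map_inj_in_uniq; first by rewrite filter_uniq // fibU_uniq.
    move=> x y; rewrite !mem_filter => /andP[/eqP x0 _] /andP[/eqP y0 _] /(congr1 lo).
    by rewrite !lo_madd ?hi_hi.
  move=> x; rewrite mem_filter mem_fibU; apply/idP/mapP.
    move=> /andP[/eqP hx /andP[ax /eqP wx]]; exists (lo x); last by rewrite -hx madd_lo_hi.
    rewrite mem_filter hi_lo eqxx mem_fibU adm_lo //=.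
    by apply/eqP; have := wt_lo_hi x; have := wt_lo_hi m; rewrite hx -/l -/mu; lia.
  case=> y; rewrite mem_filter mem_fibU => /andP[/eqP y0 /andP[ay /eqP wy]] ->.
  rewrite hi_madd ?hi_hi // eqxx adm_madd ?adm_hi ?hi_hi //= wt_madd.
  by apply/eqP; have := wt_lo_hi m; rewrite -/l -/mu; lia.
have hl := mono_homog l.
have em : d (mono m) = 1 *: \sum_(x <- fibU n) (if hi x == mu then DU l (lo x) else 0) *: mono x
    + (-1) ^+ wt l *: (mono l * d (mono mu)).
  by rewrite el (dg_leibniz _ hl) signM S1 scale1r.
have [Ud nd] := diff_mono_homog mn.
have U1' : U (\sum_(x <- fibU n) (if hi x == mu then DU l (lo x) else 0) *: mono x).
  apply: submod_sum_seq; first exact: submod_spanned.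
  by move=> x /fibU_mono[Ux _]; apply: submodZ; first exact: submod_spanned.
have n1 : homogeneous n (\sum_(x <- fibU n) (if hi x == mu then DU l (lo x) else 0) *: mono x).
  rewrite -S1; have := homogeneousM (homogeneous_diff (fibU_mono lj).2) (mono_homog mu).
  by rewrite (_ : (j + wt mu)%N = n) //; have := wt_lo_hi m; rewrite -/l -/mu; lia.
have n2 : homogeneous n ((-1) ^+ wt l *: (mono l * d (mono mu))).
  have := homogeneous_lin (-1) n1 nd; rewrite em scale1r scaleN1r addKr //.
have U2 : U ((-1) ^+ wt l *: (mono l * d (mono mu))) by exact: spanned_sub S2.
rewrite (DUE _ mn) em coefU_lin // mul1r.
rewrite (coefU_spanned S2 n2) ?addr0 // -?leqNgt //.
exact: (coefU_uniq (c := fun x => if hi x == mu then DU l (lo x) else 0)).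
Qed.

End Filtration.

(** * Homology of a truncation with coefficients *)

Section FiniteHomology.
Variables (R : comUnitRingType) (k : fieldType) (res : {rmorphism R -> k}).
Hypothesis hR : noetherian_local res.
Variables (W : cx R) (M : lmodType R).
Hypothesis fgM : finitely_generated M.

(** Cycles supported on the finite basis in degree [n] form a submodule of a finite power of [M],
    hence are finitely generated; as the homology is killed by the maximal ideal, their generators
    bound its dimension. *)
Lemma dimle_finite n :
  (forall r (y : ix W -> M), res r = 0 -> Cyc n y -> Bnd n (r *: y)) ->
  exists N, dimle res (@Cyc R W M n) (@Bnd R W M n) N.
Proof.
move=> kill; have [p [g gP]] := fgM.
pose S := fib W n; pose J := ('I_(size S) * 'I_p)%type.
pose h0 (j : J) : ix W -> M := fun t => if t == tnth (in_tuple S) j.1 then g j.2 else 0.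
pose Z (y : ix W -> M) := Cyc n y /\ forall t, t \notin S -> y t = 0.
have sZ : submod Z.
  split=> [|a x y [Cx x0] [Cy y0]]; first by split; [exact: (submod_Cyc W M n).1|].
  split; first exact: (submod_Cyc W M n).2.
  by move=> t tS; rewrite -[LHS]/(a *: x t + y t) x0 // y0 // scaler0 addr0.
have [y [_ y0]|N [y [Zy genN]]] := @fg_submod _ _ _ hR _ #|{: J}| (fun i => h0 (enum_val i)) Z sZ.
  have /choice[c cP] := fun t => gP (y t).
  exists (fun i => c (tnth (in_tuple S) (enum_val i).1) (enum_val i).2).
  apply/funext => t; rewrite fct_sumE.
  transitivity (\sum_(j : J) c (tnth (in_tuple S) j.1) j.2 *: h0 j t); last first.
    by rewrite (reindex (enum_val (A := {: J}))) //=; apply: onW_bij; exact: enum_val_bij.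
  rewrite -(pair_bigA _ (fun i j => c (tnth (in_tuple S) i) j *: h0 (i, j) t)) /= /h0 /=.
  have [tS|tS] := boolP (t \in S); last first.
    rewrite y0 // big1 // => i _; rewrite big1 // => j _; case: eqP => [e|_]; last by rewrite scaler0.
    by rewrite e mem_tnth in tS.
  have /tnthP[i ei] : t \in in_tuple S by [].
  rewrite (bigD1 i) //= [X in _ + X]big1 ?addr0 => [|j ji].
    by rewrite {1}(cP t) {1}ei; apply: eq_bigr => j _; rewrite -ei eqxx.
  rewrite big1 // => j' _; rewrite ei (inj_eq (tuple_uniqP (in_tuple S) (fib_uniq W n))).
  by rewrite eq_sym (negPf ji) scaler0.
exists N; apply: (dimle_span hR (g := y)) => //.
- exact: submod_Bnd.
- by move=> i; have [] := Zy i.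
move=> x Cx; pose x' t := if t \in S then x t else 0.
have [|c ec] := genN x'.
  split=> [|t /negPf tS]; last by rewrite /x' tS.
  by apply: Cyc_eq Cx => t tS; rewrite /x' /S tS.
exists c; rewrite -ec; exists 0 => t tS; rewrite dn0.
by rewrite -[LHS]/(x t - x' t) /x' /S tS subrr.
Qed.
End FiniteHomology.

Section DimensionBound.
Variables (R : comUnitRingType) (k : fieldType) (res : {rmorphism R -> k}).
Hypothesis hR : noetherian_local res.
Variables (A : acyclicClosure res) (q : nat).
Hypothesis hq : (1 <= q)%N.

Notation T := (variables (ac_num A) q).
Notation expo := {ffun T -> nat}.
Notation d := (dg_diff A).
Notation mono := (@monomial R A _ (@ac_var _ _ _ A) q).
Notation adm := (@admissible _ q).
Notation U := (@U _ _ _ A q).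
Notation fibU := (@fibU _ _ _ A q).
Notation wt := (@wt _ _ _ A q).
Notation tg := (@tg _ _ _ A q).
Notation xv := (@xv _ _ _ A q).
Notation e0 := (@e0 _ _ _ A q).
Notation spanned := (@spanned _ _ _ A q).
Implicit Types (v w : T) (m l mu : expo) (a b : A) (P : pred expo).

Lemma coefU0 n m : m \in fibU n -> coefU n 0 m = 0.
Proof.
by apply: (coefU_uniq (c := fun=> 0)); rewrite big1 // => ? _; rewrite scale0r.
Qed.

(* The monomials whose part of degree at least 2 satisfies such a [P] span a
   subcomplex of [U], by [DU_hi]. *)
Definition closed_below P := forall mu mu', P mu -> adm mu' -> hi mu' = mu' ->
  (wt mu' < wt mu)%N -> P mu'.

Definition fibP P n := [seq m <- fibU n | P (hi m)].

Lemma mem_fibP P n m : (m \in fibP P n) = P (hi m) && (m \in fibU n).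
Proof. by rewrite mem_filter. Qed.

Lemma fibP_uniq P n : uniq (fibP P n).
Proof. exact: filter_uniq (fibU_uniq _ _ _). Qed.
Lemma fibP_deg P n m : m \in fibP P n -> wt m = n.
Proof. by rewrite mem_fibP mem_fibU => /and3P[_ _ /eqP]. Qed.

Lemma DU_closed P n s t : closed_below P -> s \in fibP P n.+1 -> t \in fibU n ->
  ~~ P (hi t) -> DU s t = 0.
Proof.
move=> cP; rewrite mem_fibP => /andP[Ps sn] tn nPt; have := tn; rewrite mem_fibU => /andP[at' _].
have [lt|le] := ltnP (wt (hi t)) (wt (hi s)).
  by rewrite (cP (hi s)) ?adm_hi ?hi_hi in nPt.
rewrite (DU_hi sn tn le); case: eqP => // e.
by rewrite e Ps in nPt.
Qed.

Lemma sum_fibP P n (V : lmodType R) (c : expo -> R) (f : expo -> V) :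
  (forall m, m \in fibU n -> ~~ P (hi m) -> c m = 0) ->
  \sum_(m <- fibP P n) c m *: f m = \sum_(m <- fibU n) c m *: f m.
Proof.
move=> c0; rewrite big_filter [RHS](bigID (fun m => P (hi m))) /=.
rewrite [X in _ = _ + X]big_seq_cond [X in _ = _ + X]big1 ?addr0 // => m /andP[mn Pm].
by rewrite c0 // scale0r.
Qed.

Lemma fibP_DD P (cP : closed_below P) n s u : s \in fibP P n.+2 -> u \in fibP P n ->
  \sum_(t <- fibP P n.+1) DU s t * DU t u = 0.
Proof.
move=> sP; rewrite mem_fibP => /andP[_ un].
have [sn] : s \in fibU n.+2 by move: sP; rewrite mem_fibP => /andP[].
rewrite (@sum_fibP P n.+1 R^o (DU s) (fun t => DU t u)); last first.
  by move=> t tn; apply: DU_closed cP sP tn.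
transitivity (coefU n (\sum_(t <- fibU n.+1) DU s t *: d (mono t)) u).
  rewrite coefU_sum // => [|t tn]; last exact: diff_mono_homog.
  by apply: eq_big_seq => t tn; rewrite (DUE _ tn).
rewrite (_ : \sum_(t <- _) _ = d (d (mono s))); last first.
  by rewrite (diff_monoE sn) linear_sum; apply: eq_bigr => t _; rewrite linearZ.
by rewrite dg_diff_diff coefU0.
Qed.

Definition UP P (cP : closed_below P) : cx R :=
  Cx (fibP_uniq P) (@fibP_deg P) (fibP_DD cP).

(** The differentials of the degree 1 variables generate the maximal ideal, so [xi] is a combination
    of these variables. Multiplication by it is a null-homotopy of [r] and leaves high parts
    alone. *)
Lemma exists_homotopy_gen r : res r = 0 -> exists xi : A,
  [/\ homogeneous 1 xi, U xi, d xi = r%:A &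
    forall P a, spanned (fun m => P (hi m)) a -> spanned (fun m => P (hi m)) (xi * a)].
Proof.
move=> r0; have [_ gen _] := ac_min1 A.
have [|c /eqP] := gen r%:A; first by exists r.
rewrite subr_eq0 => /eqP ec.
pose vt (i : 'I_(ac_num A 1)) : T := existT _ (Ordinal (hq : (1 < q.+1)%N)) i.
exists (\sum_i c i *: xv (vt i) 1); split.
- apply: (submod_sum (B := homogeneous 1 : A -> Prop)) => [|i _].
    by split; [exact: homogeneous0|move=> ? ? ?; exact: homogeneous_lin].
  by have := homogeneous_lin (c i) (xv_homog (vt i) 1) (homogeneous0 A _); rewrite addr0.
- apply: (submod_sum (B := U)) => [|i _]; first exact: submod_spanned.
  by apply: submodZ; [exact: submod_spanned|exact: U_xv].
- by rewrite linear_sum ec; apply: eq_bigr => i _; rewrite linearZ.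
move=> P a Sa; rewrite mulr_suml.
apply: (submod_sum (B := spanned (fun m => P (hi m)))) => [|i _]; first exact: submod_spanned.
rewrite -scalerAl; apply: submodZ; first exact: submod_spanned.
apply: spanned_xvM Sa => m; rewrite (_ : hi (raise _ _ m) = hi m) //.
apply/ffunP => w; rewrite !ffunE; case: eqP => // w1; case: eqP => // ew.
by rewrite ew in w1.
Qed.

Section Coefficients.
Variable M : lmodType R.
Implicit Types y : expo -> M.

(** The identity d(xi a) + xi d(a) = r a makes [r] times a cycle a boundary. Coefficients being in
    [M], it is applied through the matrix [X] of multiplication by [xi] in the monomial basis. *)
Lemma UP_killed P (cP : closed_below P) n r (y : ix (UP cP) -> M) :
  res r = 0 -> Cyc n y -> Bnd n (r *: y).
Proof.
move=> r0 Cy; have [xi [h1 Uxi dxi sxi]] := exists_homotopy_gen r0.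
pose X (i : nat) (s t : expo) : R := coefU i (xi * mono s) t.
have Xprop (i : nat) (s : expo) : s \in fibU i -> U (xi * mono s) /\ homogeneous i.+1 (xi * mono s).
  move=> si; have [Us hs] := fibU_mono si; split; first exact: UM.
  by rewrite -add1n; exact: homogeneousM.
have XP (i : nat) (s t : expo) : s \in fibP P i -> t \in fibU i.+1 -> ~~ P (hi t) -> X i.+1 s t = 0.
  rewrite mem_fibP => /andP[Ps si] ti nP; have [Us hs] := Xprop i s si.
  have Ss : spanned (fun m => P (hi m)) (mono s).
    by apply: spanned_mono => //; move: si; rewrite mem_fibU => /andP[].
  exact: (coefU_spanned (sxi _ _ Ss) hs).
exists (fun s => \sum_(m <- fibP P n) X n.+1 m s *: y m) => t tP.
have tn : t \in fibU n by move: tP; rewrite mem_fibP => /andP[].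
rewrite /dn /=; under eq_bigr do rewrite scaler_sumr.
rewrite exchange_big /=.
(* The matrix of the map sending a to xi d(a). Its contribution vanishes on cycles, as [E2] shows by
   factoring it through the differential. *)
pose Y (m : expo) : R := coefU n (xi * d (mono m)) t.
have E1 m : m \in fibP P n -> \sum_(s <- fibP P n.+1) DU s t *: (X n.+1 m s *: y m) =
    (r * (t == m)%:R - Y m) *: y m.
  move=> mP; have mn : m \in fibU n by move: mP; rewrite mem_fibP => /andP[].
  have [Um hm] := Xprop n m mn.
  under eq_bigr do rewrite scalerA mulrC; rewrite -scaler_suml; congr (_ *: _).
  rewrite (@sum_fibP P n.+1 R^o (X n.+1 m) (fun s => DU s t)); last by move=> s; exact: XP.
  transitivity (coefU n (d (xi * mono m)) t).
    rewrite {1}(coefUE Um hm) linear_sum /=.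
    under [in RHS]eq_bigr do rewrite linearZ /=.
    rewrite coefU_sum // => [|s sn]; last exact: diff_mono_homog.
    by apply: eq_big_seq => s sn; rewrite (DUE _ sn).
  have [Ums hms] := fibU_mono mn.
  have Ud : U (xi * d (mono m)) by apply: UM => //; exact: U_diff.
  rewrite (dg_leibniz _ h1) dxi expr1 mulN1r -scalerAl mul1r.
  have hd : homogeneous n (xi * d (mono m)).
    case: (n) mn => [|n'] mn'.
      rewrite dg_diff0 ?mulr0; [exact: homogeneous0|].
      by have [_] := fibU_mono mn'.
    by rewrite -add1n; apply: homogeneousM => //; have [] := diff_mono_homog mn'.
  have nN : homogeneous n (-1 *: (xi * d (mono m))).
    by have := homogeneous_lin (-1) hd (homogeneous0 A n); rewrite addr0.
  have UN : U (-1 *: (xi * d (mono m))).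
    by apply: (submodZ (B := U)) => //; exact: submod_spanned.
  rewrite -[- _]scaleN1r coefU_lin // coefU_mono //.
  congr (_ + _); rewrite -[-1 *: _]addr0 coefU_lin //; [|exact: spanned0|exact: homogeneous0].
  by rewrite mulN1r coefU0 // addr0.
rewrite (eq_big_seq _ E1); under eq_bigr do rewrite scalerBl; rewrite sumrB.
rewrite [X in _ - X](_ : _ = 0) ?subr0.
  rewrite (bigD1_seq t) ?fibP_uniq //= eqxx mulr1 big1 ?addr0 // => s st.
  by rewrite eq_sym (negPf st) mulr0 scale0r.
case: n => [|n] in Cy t tP tn Y @X Xprop XP E1 *.
  rewrite big_seq big1 // => m; rewrite mem_fibP => /andP[_ mn].
  rewrite /Y dg_diff0; last by have [] := fibU_mono mn.
  by rewrite mulr0 coefU0 ?scale0r.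
have E2 m : m \in fibP P n.+1 -> Y m *: y m =
    \sum_(s <- fibP P n) X n.+1 s t *: (DU m s *: y m).
  move=> mP; have mn : m \in fibU n.+1 by move: mP; rewrite mem_fibP => /andP[].
  under [RHS]eq_bigr do rewrite scalerA mulrC.
  rewrite -scaler_suml; congr (_ *: _).
  rewrite (@sum_fibP P n R^o (DU m) (fun s => X n.+1 s t)); last by move=> s; exact: DU_closed.
  rewrite /Y (diff_monoE mn) mulr_sumr; under eq_bigr do rewrite -scalerAr.
  by rewrite coefU_sum // => s sn; exact: Xprop.
rewrite (eq_big_seq _ E2) exchange_big big_seq big1 // => s sP.
by rewrite -scaler_sumr -[X in _ *: X]/(@dn R (UP cP) M n y s) Cy ?scaler0.
Qed.

End Coefficients.

End DimensionBound.

Section UPBound.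
Variables (R : comUnitRingType) (k : fieldType) (res : {rmorphism R -> k}).
Hypothesis hR : noetherian_local res.
Variables (A : acyclicClosure res) (q : nat).
Hypothesis hq : (1 <= q)%N.

Notation T := (variables (ac_num A) q).
Notation expo := {ffun T -> nat}.
Notation adm := (@admissible _ q).
Notation fibU := (@fibU _ _ _ A q).
Notation wt := (@wt _ _ _ A q).
Notation e0 := (@e0 _ _ _ A q).
Implicit Types (m l mu : expo) (P : pred expo).

Variable M : lmodType R.

Lemma closed_e0 : closed_below (pred1 e0).
Proof.
move=> mu mu' /eqP -> _ _; rewrite (_ : wt e0 = 0%N) //.
by rewrite /wt big1 // => v _; rewrite ffunE muln0.
Qed.

Lemma closed_predT : closed_below (predT : pred expo). Proof. by []. Qed.

(** This is the inclusion of the subcomplex given by [P], realized as extension by zero. *)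
Definition restrict_hi P (y : expo -> M) : expo -> M := fun m => if P (hi m) then y m else 0.
Fact restrict_hi_linear P : linear (restrict_hi P).
Proof.
move=> a x y; apply/funext => m; rewrite /restrict_hi [RHS]/GRing.add /= [in RHS]/GRing.scale /=.
by case: ifP => // _; rewrite scaler0 addr0.
Qed.
Lemma restrict_hiT P y m : P (hi m) -> restrict_hi P y m = y m.
Proof. by rewrite /restrict_hi => ->. Qed.
Lemma restrict_hiF P y m : ~~ P (hi m) -> restrict_hi P y m = 0.
Proof. by rewrite /restrict_hi => /negPf ->. Qed.
HB.instance Definition _ P :=
  GRing.isLinear.Build R (expo -> M) (expo -> M) *:%R (restrict_hi P) (restrict_hi_linear P).

(** The projection to the graded piece with high part [mu], read as a chain of the Koszul
    complex. *)
Definition translate mu (y : expo -> M) : expo -> M := fun l => y (madd l mu).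
Fact translate_linear mu : linear (translate mu).
Proof. by move=> a x y. Qed.
HB.instance Definition _ mu :=
  GRing.isLinear.Build R (expo -> M) (expo -> M) *:%R (translate mu) (translate_linear mu).

Lemma mem_madd l mu n : hi mu = mu -> adm mu -> (wt mu <= n)%N ->
  l \in fibP (pred1 e0) (n - wt mu)%N ->
  [/\ madd l mu \in fibU n, hi (madd l mu) = mu, lo (madd l mu) = l & hi l = e0].
Proof.
move=> hmu amu ln; rewrite mem_fibP mem_fibU => /and3P[/eqP l0 al /eqP wl].
by rewrite mem_fibU hi_madd ?lo_madd // adm_madd // wt_madd wl subnK ?eqxx.
Qed.

Lemma mem_lo m n : m \in fibU n -> lo m \in fibP (pred1 e0) (n - wt (hi m))%N.
Proof.
rewrite mem_fibP !mem_fibU hi_lo => /andP[/adm_lo -> /eqP <-].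
by rewrite (wt_lo_hi m) addnK /= !eqxx.
Qed.

Lemma sum_translate P n mu (f : expo -> M) : hi mu = mu -> adm mu -> (wt mu <= n)%N -> P mu ->
  (forall m, m \in fibP P n -> hi m != mu -> f m = 0) ->
  \sum_(m <- fibP P n) f m = \sum_(l <- fibP (pred1 e0) (n - wt mu)%N) f (madd l mu).
Proof.
move=> hmu amu ln Pmu f0; rewrite (bigID (fun m => hi m == mu)) /=.
rewrite [X in _ + X]big_seq_cond [X in _ + X]big1 ?addr0 => [|m /andP[mn]]; last exact: f0.
rewrite -big_filter -[RHS](big_map (fun l => madd l mu) predT f); apply: perm_big; apply: uniq_perm.
- by rewrite filter_uniq // fibP_uniq.
- rewrite map_inj_in_uniq ?fibP_uniq // => x y /mem_madd xP /mem_madd yP /(congr1 (@lo _ _ _ A q)).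
  by have [_ _ -> _] := xP hmu amu ln; have [_ _ -> _] := yP hmu amu ln.
move=> m; rewrite mem_filter mem_fibP; apply/and3P/mapP => [[/eqP hm _ mn]|[l /mem_madd lP ->]].
  by exists (lo m); [rewrite -hm; exact: mem_lo|rewrite -hm madd_lo_hi].
by have [-> -> _ _] := lP hmu amu ln.
Qed.

(* One more monomial [mu] is added to the filtration; the new graded piece is
   a shifted copy of the Koszul complex. *)
Lemma dimle_filtration_step (Q : seq expo) mu n
    (cQ : closed_below (mem Q)) (cQ' : closed_below (mem (mu :: Q))) a c :
  hi mu = mu -> adm mu -> (wt mu <= n)%N -> mu \notin Q ->
  (forall mu', mu' \in Q -> (wt mu' <= wt mu)%N) ->
  dimle res (@Cyc R (UP cQ) M n) (@Bnd R (UP cQ) M n) a ->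
  dimle res (@Cyc R (UP closed_e0) M (n - wt mu)%N) (@Bnd R (UP closed_e0) M (n - wt mu)%N) c ->
  dimle res (@Cyc R (UP cQ') M n) (@Bnd R (UP cQ') M n) (a + c).
Proof.
move=> hmu amu ln muQ leQ; have muQ' : mem Q mu = false := negPf muQ.
(* High parts in [Q] are no heavier than [mu] and differ from it, so by [DU_hi] the differential has
   no component from [Q] to [mu]: the old piece is a subcomplex. *)
have DQ0 n' s t : s \in fibP (mem Q) n'.+1 -> t \in fibU n' -> hi t = mu -> DU s t = 0.
  rewrite mem_fibP => /andP[sQ sn] tn ht; rewrite (DU_hi sn tn) ?ht ?leQ //.
  by case: eqP => // e; rewrite -e muQ' in sQ.
have sub n' : {subset fibP (mem Q) n' <= fibP (mem (mu :: Q)) n'}.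
  by move=> m; rewrite !mem_fibP /= inE => /andP[-> ->]; rewrite orbT.
have sumQ n' (f : expo -> M) : (forall m, m \in fibP (mem (mu :: Q)) n' -> m \notin fibP (mem Q) n' -> f m = 0) ->
    \sum_(m <- fibP (mem (mu :: Q)) n') f m = \sum_(m <- fibP (mem Q) n') f m.
  move=> f0; rewrite (bigID (fun m => m \in fibP (mem Q) n')) /= [X in _ + X]big_seq_cond.
  rewrite [X in _ + X]big1 ?addr0 => [|m /andP[]]; last exact: f0.
  rewrite -big_filter; apply: perm_big; apply: uniq_perm.
  - by apply: filter_uniq; exact: fibP_uniq.
  - exact: fibP_uniq.
  by move=> m; rewrite mem_filter; case: (boolP (m \in fibP (mem Q) n')) => // /sub ->.
have caseQ n' m : m \in fibP (mem (mu :: Q)) n' -> (hi m == mu) || (m \in fibP (mem Q) n').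
  by rewrite !mem_fibP /= inE => /andP[/orP[->|->] ->]; rewrite ?orbT.
apply: (dimle_exact hR (f := restrict_hi (mem Q)) (g := translate mu)).
- exact: submod_Bnd.
- exact: submod_Bnd.
- move=> x [w xw]; exists (restrict_hi (mem Q) w) => t tP.
  have -> : dn n (restrict_hi (mem Q) w : ix (UP cQ') -> M) t =
      \sum_(s <- fibP (mem Q) n.+1) DU s t *: w s.
    rewrite /dn /= sumQ => [|m mP mQ].
      by apply: eq_big_seq => m; rewrite mem_fibP => /andP[mQ _]; rewrite /restrict_hi mQ.
    rewrite /restrict_hi; case: ifP => mQ'; last by rewrite scaler0.
    by move: mQ mP; rewrite !mem_fibP mQ' /= => /negPf ->; rewrite andbF.
  have [ht|tQ] := orP (caseQ n t tP).
    rewrite /= /restrict_hi (eqP ht) muQ'.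
    rewrite big_seq big1 // => s sP; rewrite (DQ0 _ _ _ sP) ?scale0r //; last exact/eqP.
    by move: tP; rewrite mem_fibP => /andP[].
  transitivity (x t); last exact: (xw _ tQ).
  by move: tQ; rewrite mem_fibP => /andP[tQ _]; exact: restrict_hiT.
- move=> y Cy; case en: (n - wt mu)%N => [|j] // l lP.
  have [n' en'] : exists n', n = n'.+1 by exists n.-1; lia.
  subst n; have ln' : (wt mu <= n')%N by lia.
  have ej : j = (n' - wt mu)%N by lia.
  subst j; have [tn ht lt hl] := mem_madd hmu amu ln' lP.
  have := Cy (madd l mu); rewrite /= mem_fibP ht /= inE eqxx tn => /(_ isT).
  rewrite /dn /= (sum_translate hmu amu ln); first 1 last.
  + exact: mem_head.
  + move=> m mP hm; have /orP[hm'|mQ] := caseQ _ _ mP; first by rewrite hm' in hm.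
    by rewrite (DQ0 _ _ _ mQ) ?scale0r.
  rewrite en => E; rewrite -[RHS]E; apply: eq_big_seq => l' l'P.
  rewrite -en in l'P; have [sn hs ls _] := mem_madd hmu amu ln l'P.
  by rewrite (DU_hi sn tn) ?hs ?ht // eqxx ls lt.
- exact: submod_Cyc.
- by move=> r w; exact: UP_killed.
move=> y Cy [w' ew'].
(* A Koszul chain bounding the image in the quotient is placed on the piece [mu]; subtracting its
   boundary leaves a cycle supported on [Q]. *)
pose w m := if hi m == mu then w' (lo m) else 0.
have dw t : t \in fibP (mem (mu :: Q)) n ->
    dn n (w : ix (UP cQ') -> M) t = \sum_(l <- fibP (pred1 e0) (n.+1 - wt mu)%N) DU (madd l mu) t *: w' l.
  move=> tP; rewrite /dn /= (sum_translate hmu amu (leqW ln)); first 1 last.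
  + exact: mem_head.
  + by move=> m _ /negPf hm; rewrite /w hm scaler0.
  apply: eq_big_seq => l lP; have [_ hs ls _] := mem_madd hmu amu (leqW ln) lP.
  by rewrite /w hs eqxx ls.
pose x := y - dn n (w : ix (UP cQ') -> M).
have x0 m : m \in fibU n -> hi m = mu -> x m = 0.
  move=> mn hm; have mP : m \in fibP (mem (mu :: Q)) n by rewrite mem_fibP /= inE hm eqxx.
  have loP : lo m \in fibP (pred1 e0) (n - wt mu)%N by rewrite -hm; exact: mem_lo.
  have eym : y m = @dn R (UP closed_e0) M (n - wt mu) w' (lo m).
    by rewrite -(ew' _ loP) -[RHS]/(y (madd (lo m) mu)) -hm madd_lo_hi.
  rewrite -[LHS]/(y m - dn n (w : ix (UP cQ') -> M) m) dw // eym subSn // /dn /=.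
  apply/eqP; rewrite subr_eq0; apply/eqP; apply: eq_big_seq => l lP.
  rewrite -subSn // in lP; have [sn hs ls _] := mem_madd hmu amu (leqW ln) lP.
  by rewrite (DU_hi sn mn) ?hs ?hm // eqxx ls.
have Cx : @Cyc R (UP cQ') M n x.
  apply: submodB; [exact: submod_Cyc|exact: Cy|].
  by apply: Bnd_Cyc; exists w.
have CQ n' (z : expo -> M) : (forall m, m \in fibU n' -> hi m = mu -> z m = 0) ->
    @Cyc R (UP cQ') M n' z -> @Cyc R (UP cQ) M n' z.
  case: n' => // n' z0 Cz t tQ; rewrite -[RHS](Cz t (sub _ _ tQ)).
  rewrite /dn /= sumQ // => m mP mQ; have /orP[/eqP hm|mQ'] := caseQ _ _ mP.
    by rewrite z0 ?scaler0 //; move: mP; rewrite mem_fibP => /andP[].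
  by rewrite mQ' in mQ.
exists x; first exact: CQ.
exists w => t tP; have [ht|tQ] := orP (caseQ n t tP); last first.
  rewrite -[LHS]/(y t - restrict_hi (mem Q) x t) restrict_hiT.
    by rewrite -[x t]/(y t - _) subKr.
  by move: tQ; rewrite mem_fibP => /andP[].
rewrite -[LHS]/(y t - restrict_hi (mem Q) x t) restrict_hiF ?(eqP ht) ?muQ' // subr0.
have tn : t \in fibU n by move: tP; rewrite mem_fibP => /andP[].
by have /eqP := x0 t tn (eqP ht); rewrite subr_eq0 => /eqP.
Qed.

End UPBound.

Section TotalBound.
Variables (R : comUnitRingType) (k : fieldType) (res : {rmorphism R -> k}).
Hypothesis hR : noetherian_local res.
Variables (A : acyclicClosure res) (q : nat).
Hypothesis hq : (1 <= q)%N.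

Notation T := (variables (ac_num A) q).
Notation expo := {ffun T -> nat}.
Notation adm := (@admissible _ q).
Notation fibU := (@fibU _ _ _ A q).
Notation wt := (@wt _ _ _ A q).
Notation e0 := (@e0 _ _ _ A q).
Implicit Types (m l mu : expo) (P : pred expo).

(** High parts are listed by increasing weight, so that every initial segment satisfies
    [closed_below]. *)
Definition hiseq n : seq expo :=
  [seq m <- flatten [seq fibU i | i <- iota 0 n.+1] | hi m == m].

Lemma mem_hiseq n m : (m \in hiseq n) = [&& hi m == m, adm m & (wt m <= n)%N].
Proof.
rewrite mem_filter; congr (_ && _); apply/flatten_mapP/andP => [[i]|[am wn]].
  by rewrite mem_iota mem_fibU => ni /andP[-> /eqP ->].
by exists (wt m); [rewrite mem_iota|rewrite mem_fibU am /=].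
Qed.

Lemma hiseq_sorted n : pairwise (fun m m' => wt m <= wt m')%N (hiseq n).
Proof.
apply: pairwise_filter; elim: (n.+1) 0%N => //= j IH i; rewrite pairwise_cat IH andbT.
apply/andP; split.
  apply/allrelP => x y; rewrite mem_fibU => /andP[_ /eqP ->] /flatten_mapP[i'].
  by rewrite mem_iota mem_fibU => /andP[/ltnW le _] /andP[_ /eqP ->].
have : forall m, m \in fibU i -> wt m = i by move=> m; rewrite mem_fibU => /andP[_ /eqP].
elim: (fibU i) => //= x s IHs H; rewrite IHs ?andbT => [|m ms]; last by apply: H; rewrite inE ms orbT.
by apply/allP => y ys; rewrite !H ?inE ?eqxx ?ys ?orbT.
Qed.

Lemma hiseq_uniq n : uniq (hiseq n).
Proof.
apply: filter_uniq; elim: (n.+1) 0%N => //= j IH i; rewrite cat_uniq IH fibU_uniq andbT /=.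
apply/hasPn => x /flatten_mapP[i']; rewrite mem_iota mem_fibU => /andP[le _] /andP[_ /eqP e].
by rewrite mem_fibU e gtn_eqF ?andbF.
Qed.

Variable M : lmodType R.

Lemma dimle_UP_eq P P' (cP : closed_below (A := A) (q := q) P)
    (cP' : closed_below (A := A) (q := q) P') n N : P =1 P' ->
  dimle res (@Cyc R (UP cP) M n) (@Bnd R (UP cP) M n) N ->
  dimle res (@Cyc R (UP cP') M n) (@Bnd R (UP cP') M n) N.
Proof.
move=> /funext eP; subst P'; by rewrite (Prop_irrelevance cP cP').
Qed.

Hypothesis fgM : finitely_generated M.

(** The exponents of degree 1 variables are at most 1, so there is no Koszul monomial in degrees
    above the number of variables; in the other degrees [dimle_finite] applies. *)
Lemma exists_koszul_bound : exists kap : nat -> nat, (forall i, (#|{: T}| < i)%N -> kap i = 0%N) /\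
  forall i, dimle res (@Cyc R (UP (@closed_e0 _ _ _ A q)) M i) (@Bnd R (UP (@closed_e0 _ _ _ A q)) M i) (kap i).
Proof.
have /choice[kap kapP] : forall i, exists N : nat, ((#|{: T}| < i)%N -> N = 0%N) /\
    dimle res (@Cyc R (UP (@closed_e0 _ _ _ A q)) M i) (@Bnd R (UP (@closed_e0 _ _ _ A q)) M i) N.
  move=> i; have [lt|le] := ltnP #|{: T}| i; last first.
    have [|N dN] := dimle_finite hR (W := UP (@closed_e0 _ _ _ A q)) fgM (n := i).
      by move=> r y; exact: UP_killed.
    by exists N.
  exists 0%N; split=> //; apply: dimle_triv => [|x _]; first exact: submod_Bnd.
  exists 0 => t; rewrite /= mem_fibP mem_fibU => /and3P[/eqP/ffunP t0 /forallP at' /eqP wi].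
  exfalso; move: lt; rewrite ltnNge -wi => /negP; apply.
  rewrite -sum1_card; apply: leq_sum => v _; have := t0 v; rewrite !ffunE.
  case: eqP => [v1 _|_ ->]; last by rewrite muln0.
  by rewrite v1 mul1n; have /implyP := at' v; rewrite -/(tg v) v1 => /(_ isT).
by exists kap; split=> i; have [] := kapP i.
Qed.

(** In degree [n] only high parts of weight at most [n] occur. They are added one at a time, each
    contributing Koszul homology in degree [n - wt mu]. *)
Lemma dimle_UP_bound (kap : nat -> nat) n :
  (forall i, dimle res (@Cyc R (UP (@closed_e0 _ _ _ A q)) M i)
     (@Bnd R (UP (@closed_e0 _ _ _ A q)) M i) (kap i)) ->
  dimle res (@Cyc R (UP (@closed_predT _ _ _ A q)) M n)
    (@Bnd R (UP (@closed_predT _ _ _ A q)) M n) (\sum_(mu <- hiseq n) kap (n - wt mu)%N).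
Proof.
move=> kapP.
have cl s s2 : hiseq n = s ++ s2 -> closed_below (A := A) (q := q) (mem s).
  move=> es mu mu' ms amu' hmu' lt.
  have : mu \in hiseq n by rewrite es mem_cat; apply/orP; left; exact: ms.
  rewrite mem_hiseq => /and3P[_ _ wmu].
  have : mu' \in hiseq n by rewrite mem_hiseq hmu' eqxx amu' (leq_trans (ltnW lt)).
  rewrite es mem_cat => /orP[//|m2].
  have := hiseq_sorted n; rewrite es pairwise_cat => /andP[/allrelP H _].
  by have := H _ _ ms m2; rewrite leqNgt lt.
have step s : forall s2, hiseq n = s ++ s2 -> forall cs : closed_below (A := A) (q := q) (mem s),
    dimle res (@Cyc R (UP cs) M n) (@Bnd R (UP cs) M n) (\sum_(mu <- s) kap (n - wt mu)%N).
  elim/last_ind: s => [|s mu IH] s2 es cs.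
    rewrite big_nil; apply: dimle_triv => [|x _]; first exact: submod_Bnd.
    by exists 0 => t; rewrite /= mem_fibP.
  have es' : hiseq n = s ++ mu :: s2 by rewrite es cat_rcons.
  have cs' := cl _ _ es'.
  have cm : closed_below (A := A) (q := q) (mem (mu :: s)).
    by move=> x y; rewrite -![mem (mu :: s) _]/(_ \in mu :: s) -!mem_rcons; exact: cs.
  have mun : mu \in hiseq n by rewrite es' mem_cat mem_head orbT.
  move: (mun); rewrite mem_hiseq => /and3P[/eqP hmu amu wmu].
  have := hiseq_uniq n; rewrite es' cat_uniq => /and3P[_ /hasPn /(_ mu (mem_head _ _)) mus _].
  have les x : x \in s -> (wt x <= wt mu)%N.
    have := hiseq_sorted n; rewrite es' pairwise_cat => /andP[/allrelP H _] xs.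
    by apply: H => //; exact: mem_head.
  have := dimle_filtration_step hR hq (cQ := cs') (cQ' := cm) hmu amu wmu mus les (IH _ es' cs') (kapP _).
  have -> : \sum_(x <- rcons s mu) kap (n - wt x)%N =
      (\sum_(x <- s) kap (n - wt x) + kap (n - wt mu))%N by rewrite -cats1 big_cat big_seq1.
  by apply: dimle_UP_eq => x; rewrite -[LHS]/(x \in mu :: s) -mem_rcons.
have cn := cl (hiseq n) [::] (esym (cats0 _)).
have fibE i : (i <= n)%N -> fibP (mem (hiseq n)) i = fibU i.
  move=> le; apply/all_filterP/allP => m mi; rewrite -[mem _ _]/(_ \in hiseq n) mem_hiseq.
  move: mi; rewrite mem_fibU hi_hi eqxx => /andP[/adm_hi -> /eqP wm].
  by rewrite (leq_trans (wt_hi m)) ?wm.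
have predTE i : fibP predT i = fibU i by exact: filter_predT.
have CE n' x : (n' <= n)%N -> @Cyc R (UP (@closed_predT _ _ _ A q)) M n' x ->
    @Cyc R (UP cn) M n' x.
  case: n' => // n' le Cx t tn; rewrite /= fibE in tn; last exact: ltnW.
  by have := Cx t; rewrite /= predTE /dn /= predTE fibE //; apply.
apply: dimle_mono (step _ [::] (esym (cats0 _)) cn) => // [x|x [w xw]]; first exact: CE.
(* Chains of degree [n.+1] may have high parts of weight [n.+1], which are missing from [hiseq n]; a
   bounding chain of the subcomplex is extended by zero to them. *)
exists (@restrict_hi _ _ _ A q M (mem (hiseq n)) w) => t; rewrite /= predTE -fibE // => tn.
rewrite (xw t tn) /dn /= predTE /fibP big_filter [RHS](bigID (fun m => mem (hiseq n) (hi m))) /=.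
rewrite [X in _ = _ + X]big1 ?addr0 => [|m mn]; last by rewrite restrict_hiF ?scaler0.
by apply: eq_bigr => m mn; rewrite restrict_hiT.
Qed.

Lemma UP_bound : exists kap : nat -> nat, (forall i, (#|{: T}| < i)%N -> kap i = 0%N) /\
  forall n, dimle res (@Cyc R (UP (@closed_predT _ _ _ A q)) M n)
    (@Bnd R (UP (@closed_predT _ _ _ A q)) M n) (\sum_(mu <- hiseq n) kap (n - wt mu)%N).
Proof.
have [kap [kap0 kapP]] := exists_koszul_bound.
by exists kap; split=> // n; exact: dimle_UP_bound.
Qed.

End TotalBound.

(** * Resolutions from trivial Massey operations *)

Section FreeSums.
Variables (K : choiceType) (A V : zmodType) (h : K -> A -> V).
Hypothesis hD : forall s a b, h s (a + b) = h s a + h s b.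

(** Only additivity of [h s] is asked: the maps to be extended involve the bar and the differential
    and are not linear over the coefficient algebra. *)
Definition lsum (g : {malg A[K]}) : V := \sum_(s <- msupp g) h s g@_s.

Let h0 s : h s 0 = 0.
Proof. by apply: (addrI (h s 0)); rewrite -hD !addr0. Qed.

Lemma lsumD g1 g2 : lsum (g1 + g2) = lsum g1 + lsum g2.
Proof.
pose E := (msupp g1 `|` msupp g2)%fset.
have sub g : (msupp g `<=` E)%fset -> lsum g = \sum_(s <- E) h s g@_s.
  by move=> gE; apply: big_fset_incl => // s _; rewrite -mcoeff_eq0 => /eqP ->.
rewrite !sub ?fsubsetUl ?fsubsetUr ?msuppD_le // -big_split.
by apply: eq_bigr => s _; rewrite mcoeffD hD.
Qed.

Lemma lsum0 : lsum 0 = 0.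
Proof. by apply: (addrI (lsum 0)); rewrite -lsumD !addr0. Qed.
Lemma lsumN g : lsum (- g) = - lsum g.
Proof. by apply: (addrI (lsum g)); rewrite -lsumD !subrr lsum0. Qed.
Lemma lsumB g1 g2 : lsum (g1 - g2) = lsum g1 - lsum g2.
Proof. by rewrite lsumD lsumN. Qed.
Lemma lsum_sum (I : Type) (r : seq I) (F : I -> {malg A[K]}) :
  lsum (\sum_(i <- r) F i) = \sum_(i <- r) lsum (F i).
Proof. exact: (big_morph _ lsumD lsum0). Qed.
Lemma lsumU s a : lsum << a *g s >> = h s a.
Proof.
rewrite /lsum (big_fset_incl _ msuppU_le) ?big_seq_fset1 ?mcoeffUU // => s' _.
by rewrite -mcoeff_eq0 => /eqP ->.
Qed.

Lemma malg_ind (P : {malg A[K]} -> Prop) : P 0 -> (forall x y, P x -> P y -> P (x + y)) ->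
  (forall s a, P << a *g s >>) -> forall g, P g.
Proof.
by move=> P0 PD PU g; rewrite (monalgE g); apply: big_ind => // s _.
Qed.
End FreeSums.

(** * The twisted tensor product with words *)

Section TwistedTensor.
Variables (R : comUnitRingType) (A : dgAlgebra R) (L : choiceType) (Ga : seq L -> A).
Notation d := (dg_diff A).
Notation bar := (@dg_bar R A).
Notation G := {malg A[seq L]}.
Implicit Types (s : seq L) (v : L) (g : G) (a : A).

Hypothesis dGa : forall s, (0 < size s)%N ->
  d (Ga s) = \sum_(1 <= j < size s) bar (Ga (take j s)) * Ga (drop j s).

(* [<< a *g s >>] stands for the tensor of [a] with the word [s]; a letter is a
   reduced homology class with its degree raised by one. *)
Definition tdiff_gen s a : G :=
  << d a *g s >> - \sum_(1 <= j < (size s).+1) << bar a * Ga (take j s) *g drop j s >>.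
Lemma tdiff_genD s a b : tdiff_gen s (a + b) = tdiff_gen s a + tdiff_gen s b.
Proof.
rewrite /tdiff_gen linearD monalgUD addrACA -opprD -big_split /=; congr (_ + - _).
by apply: eq_bigr => j _; rewrite linearD mulrDl monalgUD.
Qed.
Definition tdiff : G -> G := lsum tdiff_gen.

Definition app_gen v s a : G := << a *g rcons s v >>.
Lemma app_genD v s a b : app_gen v s (a + b) = app_gen v s a + app_gen v s b.
Proof. exact: monalgUD. Qed.
Definition app v : G -> G := lsum (app_gen v).

(** Up to sign, the part of the differential of the word [rcons s v] that consumes all its
    letters. *)
Definition psi_gen v s a : A := bar a * Ga (rcons s v).
Lemma psi_genD v s a b : psi_gen v s (a + b) = psi_gen v s a + psi_gen v s b.
Proof. by rewrite /psi_gen linearD mulrDl. Qed.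
Definition psi v : G -> A := lsum (psi_gen v).

Lemma tdiffD g1 g2 : tdiff (g1 + g2) = tdiff g1 + tdiff g2.
Proof. exact: (lsumD tdiff_genD). Qed.
Lemma tdiff0 : tdiff 0 = 0. Proof. exact: (lsum0 tdiff_genD). Qed.
Lemma tdiffB g1 g2 : tdiff (g1 - g2) = tdiff g1 - tdiff g2.
Proof. exact: (lsumB tdiff_genD). Qed.
Lemma tdiff_sum (I : Type) (r : seq I) (F : I -> G) :
  tdiff (\sum_(i <- r) F i) = \sum_(i <- r) tdiff (F i).
Proof. exact: (lsum_sum tdiff_genD). Qed.
Lemma tdiffU s a : tdiff << a *g s >> = tdiff_gen s a.
Proof. exact: (lsumU tdiff_genD). Qed.
Lemma appD v g1 g2 : app v (g1 + g2) = app v g1 + app v g2.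
Proof. exact: (lsumD (app_genD v)). Qed.
Lemma app0 v : app v 0 = 0. Proof. exact: (lsum0 (app_genD v)). Qed.
Lemma appB v g1 g2 : app v (g1 - g2) = app v g1 - app v g2.
Proof. exact: (lsumB (app_genD v)). Qed.
Lemma app_sum v (I : Type) (r : seq I) (F : I -> G) :
  app v (\sum_(i <- r) F i) = \sum_(i <- r) app v (F i).
Proof. exact: (lsum_sum (app_genD v)). Qed.
Lemma appU v s a : app v << a *g s >> = << a *g rcons s v >>.
Proof. exact: (lsumU (app_genD v)). Qed.
Lemma psiD v g1 g2 : psi v (g1 + g2) = psi v g1 + psi v g2.
Proof. exact: (lsumD (psi_genD v)). Qed.
Lemma psi0 v : psi v 0 = 0. Proof. exact: (lsum0 (psi_genD v)). Qed.
Lemma psiB v g1 g2 : psi v (g1 - g2) = psi v g1 - psi v g2.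
Proof. exact: (lsumB (psi_genD v)). Qed.
Lemma psi_sum v (I : Type) (r : seq I) (F : I -> G) :
  psi v (\sum_(i <- r) F i) = \sum_(i <- r) psi v (F i).
Proof. exact: (lsum_sum (psi_genD v)). Qed.
Lemma psiU v s a : psi v << a *g s >> = bar a * Ga (rcons s v).
Proof. exact: (lsumU (psi_genD v)). Qed.

Lemma take_rcons_le j s v : (j <= size s)%N -> take j (rcons s v) = take j s.
Proof. by move=> js; rewrite -cats1 takel_cat. Qed.
Lemma drop_rcons_le j s v : (j <= size s)%N -> drop j (rcons s v) = rcons (drop j s) v.
Proof. by move=> js; rewrite -!cats1 drop_cat; case: ltngtP js => // ->; rewrite subnn drop0 drop_size. Qed.

(** Of the cuts of [rcons s v], only the last one uses up [v]. This exhibits the twisted complex as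
    a cone of the maps [psi v]. *)
Lemma tdiff_app v g : tdiff (app v g) = app v (tdiff g) - << psi v g *g [::] >>.
Proof.
elim/malg_ind: g => [|x y IHx IHy|s a].
- by rewrite app0 tdiff0 app0 psi0 monalgU0 subrr.
- by rewrite appD !tdiffD appD psiD monalgUD IHx IHy opprD addrACA.
rewrite appU !tdiffU psiU /tdiff_gen size_rcons big_nat_recr //=.
rewrite take_oversize ?size_rcons // drop_oversize ?size_rcons //.
rewrite opprD addrA appB appU; congr (_ - _ - _).
rewrite app_sum [LHS]big_nat [RHS]big_nat; apply: eq_bigr => j /andP[_ js].
by rewrite appU take_rcons_le ?drop_rcons_le.
Qed.

(** The Massey relation enters here: the sum over the proper cuts of [rcons s v] is the differential
    of its operation. *)
Lemma psi_tdiff v g : psi v (tdiff g) = - d (psi v g).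
Proof.
elim/malg_ind: g => [|x y IHx IHy|s a].
- by rewrite tdiff0 psi0 linear0 oppr0.
- by rewrite tdiffD !psiD IHx IHy linearD opprD.
rewrite tdiffU /tdiff_gen psiB psi_sum !psiU dg_leibniz_bar dg_barK diff_bar mulNr opprB opprK addrC.
congr (_ + _); rewrite dGa ?size_rcons // mulr_sumr -sumrN [LHS]big_nat [RHS]big_nat.
apply: eq_bigr => j /andP[_ js]; rewrite psiU dg_barM dg_barK mulNr opprK mulrA.
by rewrite take_rcons_le ?drop_rcons_le.
Qed.

Lemma tdiff_nil a : tdiff << a *g [::] >> = << d a *g [::] >>.
Proof. by rewrite tdiffU /tdiff_gen big_geq ?subr0. Qed.

(** Induction on the word from its end: by [tdiff_app] the square reduces to two terms on the empty
    word, which cancel by [psi_tdiff]. *)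
Lemma tdiffK g : tdiff (tdiff g) = 0.
Proof.
elim/malg_ind: g => [|x y IHx IHy|s].
- by rewrite !tdiff0.
- by rewrite !tdiffD IHx IHy addr0.
elim/last_ind: s => [|s v IH] a; first by rewrite !tdiff_nil dg_diff_diff monalgU0.
rewrite -appU tdiff_app tdiffB tdiff_app IH psi_tdiff app0 sub0r monalgUN opprK.
by rewrite tdiff_nil subrr.
Qed.

Lemma scale_malgU (r : R) b s : (r%:A : A) *: << b *g s >> = << r *: b *g s >> :> G.
Proof. by apply/malgP => s'; rewrite mcoeffZ !mcoeffU mulr_algl scalerMnr. Qed.

Lemma tdiff_scale (r : R) g : tdiff (r%:A *: g) = r%:A *: tdiff g.
Proof.
elim/malg_ind: g => [|x y IHx IHy|s a].
- by rewrite scaler0 tdiff0 scaler0.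
- by rewrite scalerDr !tdiffD IHx IHy -scalerDr.
rewrite scale_malgU !tdiffU /tdiff_gen scalerBr scale_malgU linearZ /= scaler_sumr.
by congr (_ - _); apply: eq_bigr => j _; rewrite scale_malgU linearZ /= -scalerAl.
Qed.

Lemma psi_scale v (r : R) g : psi v (r%:A *: g) = r *: psi v g.
Proof.
elim/malg_ind: g => [|x y IHx IHy|s a].
- by rewrite scaler0 psi0 scaler0.
- by rewrite scalerDr !psiD IHx IHy -scalerDr.
by rewrite scale_malgU !psiU linearZ /= -scalerAl.
Qed.

End TwistedTensor.

(** * Homology classes and their Massey operations *)

Section HomologyBasis.
Variables (R : comUnitRingType) (k : fieldType) (res : {rmorphism R -> k}).
Hypothesis hR : noetherian_local res.
Variables (A : acyclicClosure res) (q : nat).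
Notation tr := (truncation (@ac_var _ _ _ A) q).
Notation U := (@U _ _ _ A q).
Notation d := (dg_diff A).

Lemma truncationE : tr = U :> (A -> Prop).
Proof. by apply/funext => a; apply/propext; exact: truncation_spanned. Qed.

Lemma sU : submod U. Proof. exact: submod_spanned. Qed.

Variables (h : nat -> nat).
Hypothesis hh : forall i, dim_residue res (cycles tr i) (boundaries tr i) (h i).

(** A letter stands for a basis element of the homology in positive degree; its tag is one less than
    that degree, so that degree 0 is excluded by typing. *)
Definition letter := {j : nat & 'I_(h j.+1)}.
Definition mkletter j (l : 'I_(h j.+1)) : letter := existT _ j l.
Definition ldeg (v : letter) : nat := (tag v).+1.
HB.instance Definition _ := Choice.on letter.

Lemma cycles_submod i : submod (cycles tr i : A -> Prop).
Proof.
rewrite truncationE; split.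
  by split; [exact: (submod0 sU)|exact: homogeneous0|exact: linear0].
move=> r x y [Ux hx dx] [Uy hy dy]; split; [exact: sU.2|exact: homogeneous_lin|].
by rewrite linearP /= dx dy scaler0 addr0.
Qed.

Lemma homology_basis : exists z : letter -> A,
  [/\ forall v, cycles tr (ldeg v) (z v),
   forall j a, cycles tr j.+1 a -> exists c : 'I_(h j.+1) -> R,
     boundaries tr j.+1 (a - \sum_l c l *: z (mkletter l)) &
   forall j (c : 'I_(h j.+1) -> R), boundaries tr j.+1 (\sum_l c l *: z (mkletter l)) ->
     forall l, res (c l) = 0].
Proof.
have [phi phiP] : exists phi : forall j, A -> 'rV[k]_(h j.+1), forall j,
    [/\ (forall a b, cycles tr j.+1 a -> cycles tr j.+1 b -> phi j (a + b) = phi j a + phi j b),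
      (forall r a, cycles tr j.+1 a -> phi j (r *: a) = res r *: phi j a),
      (forall w, exists2 a, cycles tr j.+1 a & phi j a = w)
    & forall a, cycles tr j.+1 a -> (phi j a = 0 <-> boundaries tr j.+1 a)].
  by exists (fun j => projT1 (cid (hh j.+1))) => j; exact: projT2 (cid (hh j.+1)).
have /choice[z zP] : forall v : letter, exists a, cycles tr (ldeg v) a /\
    phi (tag v) a = delta_mx 0 (tagged v).
  move=> v; have [_ _ srj _] := phiP (tag v).
  by have [a] := srj (delta_mx 0 (tagged v)); exists a.
have phi_sum j (c : 'I_(h j.+1) -> R) :
    cycles tr j.+1 (\sum_l c l *: z (mkletter l)) /\
    phi j (\sum_l c l *: z (mkletter l)) = \row_l res (c l).
  have [add scal _ _] := phiP j; have sC := cycles_submod j.+1.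
  rewrite (row_sum_delta (\row_l res (c l))).
  have phi0 : phi j 0 = 0 by have := scal 0 0 (submod0 sC); rewrite !scale0r rmorph0 scale0r.
  apply: (big_ind2 (fun a w => cycles tr j.+1 a /\ phi j a = w)).
  - by split; [exact: (submod0 sC)|].
  - by move=> x u y w [Cx <-] [Cy <-]; split; [exact: (submodD sC)|exact: add].
  move=> l _; have [Cz ez] := zP (mkletter l).
  split; first exact: (submodZ sC).
  by rewrite scal // ez mxE.
exists z; split=> [v|j a Ca|j c Bc l]; first by have [] := zP v.
  have [lf lK] := res_lift hR; exists (fun l => lf (phi j a 0 l)).
  have [add scal _ ker] := phiP j; have sC := cycles_submod j.+1.
  have [Cs es] := phi_sum j (fun l => lf (phi j a 0 l)).
  apply/ker; first exact: (submodB sC).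
  rewrite add //; last exact: (submodN sC).
  rewrite -scaleN1r scal // es rmorphN1 scaleN1r.
  by apply/rowP => l; rewrite !mxE lK subrr.
have [_ _ _ ker] := phiP j; have [Cs es] := phi_sum j c.
by have /(ker _ Cs) := Bc; rewrite es => /rowP/(_ l); rewrite !mxE.
Qed.

End HomologyBasis.

Section Augmentation.
Variables (R : comUnitRingType) (k : fieldType) (res : {rmorphism R -> k}).
Variables (A : acyclicClosure res) (q : nat).
Notation U := (@U _ _ _ A q).
Notation d := (dg_diff A).
Notation comp := (dg_comp A).
Implicit Types a b : A.

Definition augk a := exists2 r : R, res r = 0 & comp 0 a = r%:A.

Lemma comp0M a b : comp 0 (a * b) = comp 0 a * comp 0 b.
Proof.
elim/dg_ind: a => [|x y IHx IHy|i x ix]; first by rewrite mul0r !linear0 mul0r.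
  by rewrite mulrDl !linearD /= IHx IHy mulrDl.
elim/dg_ind: b => [|y y' IHy IHy'|j y jy]; first by rewrite mulr0 !linear0 mulr0.
  by rewrite mulrDr !linearD /= IHy IHy' mulrDr.
rewrite (comp_homog _ (homogeneousM ix jy)) (comp_homog _ ix) (comp_homog _ jy).
by case: i j {ix jy} => [|i] [|j] //=; rewrite ?mul0r ?mulr0.
Qed.

Lemma submod_augk : submod (augk : A -> Prop).
Proof.
split; first by exists 0; rewrite ?rmorph0 // linear0 scale0r.
move=> r x y [s s0 es] [t t0 et]; exists (r * s + t).
  by rewrite rmorphD rmorphM s0 t0 mulr0 addr0.
by rewrite linearP /= es et scalerDl scalerA.
Qed.

Lemma wt_eq0 (m : {ffun variables (ac_num A) q -> nat}) : wt m = 0%N -> m = e0 A q.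
Proof.
move/eqP; rewrite sum_nat_eq0 => /forallP H; apply/ffunP => v; rewrite ffunE.
by have := H v; rewrite muln_eq0 gtn_eqF ?tg_gt0 //= => /eqP.
Qed.

Lemma U_comp0 a : U a -> exists r : R, comp 0 a = r%:A.
Proof.
apply: (spanned_ind (Z := fun a => exists r : R, comp 0 a = r%:A)) => [|m am _].
  split=> [|r x y [s es] [t et]]; first by exists 0; rewrite linear0 scale0r.
  by exists (r * s + t); rewrite linearP /= es et scalerDl scalerA.
rewrite (comp_homog _ (mono_homog m)); case: eqP => [/esym/wt_eq0 ->|_].
  by exists 1; rewrite mono0 scale1r.
by exists 0; rewrite scale0r.
Qed.

(** The unit is the empty monomial, a member of a free family. *)
Lemma scalar_inj (r s : R) : r%:A = s%:A :> A -> r = s.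
Proof.
move=> /eqP; rewrite -subr_eq0 -scalerBl => /eqP rs; apply/eqP; rewrite -subr_eq0; apply/eqP.
apply: (ac_free (n := q) (c := fun=> r - s) (s := [:: e0 A q])) (mem_head _ _) => //=.
  by rewrite adm0.
by rewrite big_seq1 mono0.
Qed.

Lemma augkM a b : U a -> augk b -> augk (a * b).
Proof.
move=> /U_comp0[r er] [s s0 es]; exists (r * s); first by rewrite rmorphM s0 mulr0.
by rewrite comp0M er es -scalerAl mul1r scalerA.
Qed.

Lemma augkMr a b : augk a -> U b -> augk (a * b).
Proof.
move=> [s s0 es] /U_comp0[r er]; exists (s * r); first by rewrite rmorphM s0 mul0r.
by rewrite comp0M er es -scalerAl mul1r scalerA.
Qed.

Lemma augk_homog i a : homogeneous i.+1 a -> augk a.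
Proof. by move=> ia; exists 0; rewrite ?rmorph0 // (comp_homog _ ia) scale0r. Qed.

Lemma augk_scalar (r : R) : augk r%:A <-> res r = 0.
Proof.
split=> [[s s0]|r0]; last by exists r => //; rewrite linearZ /= dg_one.
by rewrite linearZ /= dg_one => /scalar_inj ->.
Qed.

(** A differential of degree 0 can come only from a variable of degree 1, and then lies in the
    maximal ideal. *)
Lemma augk_diff_xv (v : variables (ac_num A) q) e : augk (d (xv v e)).
Proof.
have a0 : augk 0 by exact: (submod0 submod_augk).
case: e => [|e]; first by rewrite /xv ac_var0 diff1.
have hx := xv_homog v e.+1.
have [t1|t1] := eqVneq (tg v) 1%N; last first.
  have [i ei] : exists i, (tg v * e.+1)%N = i.+2.
    by exists (tg v * e.+1).-2; have := tg_gt0 v; nia.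
  by rewrite ei in hx; exact: (augk_homog (homogeneous_diff hx)).
case: e hx => [|e] hx; last by rewrite xv_odd ?t1 // linear0.
by have [r r0 ->] := diff_gen_degree1 t1; apply/augk_scalar.
Qed.

Lemma augk_diff a : U a -> augk (d a).
Proof.
apply: (spanned_ind (Z := fun a => augk (d a))) => [|m am _].
  split=> [|r x y Ux Uy]; first by rewrite linear0; exact: (submod0 submod_augk).
  by rewrite linearP; exact: submod_augk.2.
suff H : forall l : seq (variables (ac_num A) q), U (\prod_(w <- l) xv w (m w)) /\
    augk (d (\prod_(w <- l) xv w (m w))).
  by have [] := H (index_enum _).
elim=> [|w l [IH1 IH2]].
  by rewrite big_nil diff1; split; [exact: U1|exact: (submod0 submod_augk)].
rewrite big_cons; split; first by apply: UM => //; exact: U_xv.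
rewrite (dg_leibniz _ (xv_homog w (m w))) signM.
apply: (submodD submod_augk); first by apply: augkMr => //; exact: augk_diff_xv.
by apply: (submodZ submod_augk); apply: augkM => //; exact: U_xv.
Qed.

End Augmentation.

Section Massey.
Variables (R : comUnitRingType) (k : fieldType) (res : {rmorphism R -> k}).
Hypothesis hR : noetherian_local res.
Variables (A : acyclicClosure res) (q : nat).
Hypothesis hq : (1 <= q)%N.
Notation tr := (truncation (@ac_var _ _ _ A) q).
Notation U := (@U _ _ _ A q).
Notation d := (dg_diff A).
Notation comp := (dg_comp A).
Variables (h : nat -> nat) (z : letter h -> A) (gamma : seq (set A) -> A).
Notation L := (letter h).
Implicit Types (v w : L) (s : seq L) (a b : A) (g : {malg A[seq L]}).

Hypothesis zC : forall v, cycles tr (ldeg v) (z v).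
Hypothesis z_span : forall j a, cycles tr j.+1 a -> exists c : 'I_(h j.+1) -> R,
  boundaries tr j.+1 (a - \sum_l c l *: z (mkletter l)).
Hypothesis z_indep : forall j (c : 'I_(h j.+1) -> R),
  boundaries tr j.+1 (\sum_l c l *: z (mkletter l)) -> forall l, res (c l) = 0.
Hypothesis gamma_aug : forall s : seq (set A), (0 < size s)%N ->
  (forall c : set A, c \in s -> reduced_homology res tr c) -> augmentation_kernel res tr (gamma s).
Hypothesis gamma_class : forall c : set A, reduced_homology res tr c -> c (gamma [:: c]).
Hypothesis gamma_diff : forall s : seq (set A), (0 < size s)%N ->
  (forall c : set A, c \in s -> reduced_homology res tr c) ->
  d (gamma s) = \sum_(1 <= j < size s) dg_bar (gamma (take j s)) * gamma (drop j s).

Let sU := sU A q.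

Definition Ga s : A := gamma [seq homology_class tr (z v) | v <- s].

Lemma class_reduced s (c : set A) : c \in [seq homology_class tr (z v) | v <- s] ->
  reduced_homology res tr c.
Proof.
case/mapP => v _ ->; have [Uz hz dz] := zC v; exists (z v); split=> //; split=> //.
by exists 0; rewrite ?rmorph0 // (comp_homog _ hz) scale0r.
Qed.

Lemma Ga_aug s : (0 < size s)%N -> U (Ga s) /\ augk (Ga s).
Proof.
move=> s0; have [||Ug ag] := gamma_aug (s := [seq homology_class tr (z v) | v <- s]).
- by rewrite size_map.
- by move=> c; exact: class_reduced.
by split=> //; rewrite -truncationE.
Qed.

Lemma dGa s : (0 < size s)%N ->
  d (Ga s) = \sum_(1 <= j < size s) dg_bar (Ga (take j s)) * Ga (drop j s).
Proof.
move=> s0; rewrite /Ga gamma_diff ?size_map // => [|c]; last exact: class_reduced.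
by apply: eq_bigr => j _; rewrite map_take map_drop.
Qed.

Lemma Ga1 v : exists2 b, U b & Ga [:: v] = z v + d b.
Proof.
have [|b Ub eb] := gamma_class (c := homology_class tr (z v)).
  by apply: (class_reduced (s := [:: v])); rewrite /= mem_head.
by exists b => //; rewrite -truncationE.
Qed.

(** Each homogeneous component of positive degree is expanded in the homology basis, and the
    component of degree 0 is a scalar. Replacing [z v] by [Ga [:: v]] costs a boundary, collected in
    [b]. *)
Lemma cycle_decomp a : U a -> d a = 0 -> exists (lam : R) (ps : seq (R * L)) (b : A),
  U b /\ a = lam%:A + \sum_(p <- ps) p.1 *: Ga [:: p.2] + d b.
Proof.
move=> Ua da; pose Q a := exists (lam : R) (ps : seq (R * L)) (b : A),
  U b /\ a = lam%:A + \sum_(p <- ps) p.1 *: Ga [:: p.2] + d b.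
rewrite (dg_comp_sum a); apply: (big_ind Q).
- exists 0, [::], 0; split; first exact: (submod0 sU).
  by rewrite big_nil scale0r linear0 !addr0.
- move=> x y [l [ps [b [Ub ->]]]] [l' [ps' [b' [Ub' ->]]]].
  exists (l + l'), (ps ++ ps'), (b + b'); split; first exact: (submodD sU).
  by rewrite big_cat scalerDl linearD /= addrACA; congr (_ + _); rewrite addrACA.
move=> i _; have Ui := U_comp i Ua; have hi := comp_homogeneous i a.
have di : d (comp i a) = 0.
  case: (nat_of_ord i) hi => [|j] hi; first exact: dg_diff0.
  by rewrite -comp_diff da linear0.
case: (nat_of_ord i) Ui hi di => [|j] Uj hj dj.
  have [r er] := U_comp0 Ua; exists r, [::], 0; split; first exact: (submod0 sU).
  by rewrite big_nil linear0 !addr0.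
have [|c [b [Ub hb eb]]] := z_span (j := j) (a := comp j.+1 a).
  by split=> //; rewrite truncationE.
rewrite truncationE in Ub; have /choice[bz bzP] : forall v, exists b, U b /\ Ga [:: v] = z v + d b.
  by move=> v; have [b' ? ?] := Ga1 v; exists b'.
exists 0, [seq (c l, mkletter l) | l <- enum 'I_(h j.+1)], (b - \sum_l c l *: bz (mkletter l)).
split.
  apply: (submodB sU) => //; apply: (submod_sum sU) => l _.
  by apply: (submodZ sU); have [] := bzP (mkletter l).
have EG : \sum_l c l *: Ga [:: mkletter l] =
    \sum_l c l *: z (mkletter l) + d (\sum_l c l *: bz (mkletter l)).
  rewrite linear_sum -big_split; apply: eq_bigr => l _.
  by rewrite linearZ /= (bzP _).2 scalerDr.
rewrite scale0r add0r big_map big_enum /= EG linearB /= -eb.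
by rewrite -[_ - _ - _]addrA -opprD [RHS]addrC subrK.
Qed.

(** The relation may mix letters of several degrees; its component of degree [j.+1] involves only
    the letters of that degree, where [z_indep] applies. *)
Lemma Ga_indep (S : seq L) (c : L -> R) b : uniq S -> U b ->
  \sum_(v <- S) c v *: Ga [:: v] = d b -> forall v, v \in S -> res (c v) = 0.
Proof.
move=> uS Ub E v0 v0S; have /choice[bz bzP] : forall v, exists b, U b /\ Ga [:: v] = z v + d b.
  by move=> v; have [b' ? ?] := Ga1 v; exists b'.
pose b' := b - \sum_(v <- S) c v *: bz v.
have Ub' : U b'.
  by apply: (submodB sU) => //; apply: (submod_sum sU) => v _; apply: (submodZ sU); have [] := bzP v.
have Ez : \sum_(v <- S) c v *: z v = d b'.
  rewrite linearB /= -E linear_sum -sumrB; apply: eq_bigr => v _.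
  by rewrite linearZ /= (bzP v).2 scalerDr addrK.
case: v0 v0S => j l lS.
have := z_indep (j := j) (c := fun l => if mkletter l \in S then c (mkletter l) else 0).
move=> /(_ _ l); rewrite lS; apply.
exists (comp j.+2 b'); split; [by rewrite truncationE; exact: U_comp|exact: comp_homogeneous|].
rewrite -comp_diff -Ez linear_sum.
rewrite [RHS](bigID (fun v => tag v == j)) /= [X in _ = _ + X]big1 ?addr0; last first.
  move=> v vj; rewrite linearZ /=; have [_ hz _] := zC v.
  by rewrite (comp_homog _ hz) eqSS eq_sym (negPf vj) scaler0.
rewrite -[RHS]big_filter (perm_big [seq v <- [seq mkletter l | l <- enum 'I_(h j.+1)] | v \in S]) /=.
  rewrite big_filter big_map big_enum_cond /= [LHS](bigID (fun l => mkletter l \in S)) /=.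
  rewrite [X in _ + X]big1 ?addr0 => [|l' /negPf ->]; last by rewrite scale0r.
  apply: eq_bigr => l' ->; rewrite linearZ /=; have [_ hz _] := zC (mkletter l').
  by rewrite hz.
apply: uniq_perm; first exact: filter_uniq.
  apply: filter_uniq; rewrite map_inj_uniq ?enum_uniq // => x y /eqP.
  by rewrite eq_Tagged => /eqP.
move=> [j' l']; rewrite !mem_filter andbC; congr (_ && _); rewrite /=.
apply/eqP/mapP => [e|[x _ /(congr1 (@tag _ _))]] //; subst j'.
by exists l' => //; rewrite mem_enum.
Qed.

End Massey.

(** * Acyclicity of the twisted tensor product and the comparison map *)

Section Acyclicity.
Variables (R : comUnitRingType) (k : fieldType) (res : {rmorphism R -> k}).
Variables (A : acyclicClosure res) (q : nat).
Hypothesis hq : (1 <= q)%N.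
Notation U := (@U _ _ _ A q).
Notation d := (dg_diff A).
Notation bar := (@dg_bar R A).
Notation augk := (@augk _ _ _ A).
Variables (L : choiceType) (Ga : seq L -> A).
Notation G := {malg A[seq L]}.
Implicit Types (v w : L) (s : seq L) (a b : A) (g : G).

Hypothesis Ga_aug : forall s, (0 < size s)%N -> U (Ga s) /\ augk (Ga s).
Hypothesis dGa : forall s, (0 < size s)%N ->
  d (Ga s) = \sum_(1 <= j < size s) bar (Ga (take j s)) * Ga (drop j s).
Hypothesis Ga_decomp : forall a, U a -> d a = 0 ->
  exists (lam : R) (ps : seq (R * L)) (b : A),
    U b /\ a = lam%:A + \sum_(p <- ps) p.1 *: Ga [:: p.2] + d b.
Hypothesis Ga_indep : forall (S : seq L) (c : L -> R) b, uniq S -> U b ->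
  \sum_(v <- S) c v *: Ga [:: v] = d b -> forall v, v \in S -> res (c v) = 0.

Notation tdiff := (tdiff Ga).
Notation psi := (psi Ga).
Let sU := sU A q.

Definition GU g := forall s, U g@_s.

Lemma GU0 : GU 0. Proof. by move=> s; rewrite mcoeff0; exact: (submod0 sU). Qed.
Lemma GUD x y : GU x -> GU y -> GU (x + y).
Proof. by move=> Ux Uy s; rewrite mcoeffD; exact: (submodD sU). Qed.
Lemma GUB x y : GU x -> GU y -> GU (x - y).
Proof. by move=> Ux Uy s; rewrite mcoeffB; exact: (submodB sU). Qed.
Lemma GU_mal a s : U a -> GU << a *g s >>.
Proof. by move=> Ua s'; rewrite mcoeffU; case: eqP => _; [|exact: (submod0 sU)]. Qed.
Lemma GU_sum (I : Type) (r : seq I) (F : I -> G) : (forall i, GU (F i)) -> GU (\sum_(i <- r) F i).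
Proof. by move=> H; apply: big_ind => // [|x y]; [exact: GU0|exact: GUD]. Qed.
Lemma GU_scale (r : R) g : GU g -> GU (r%:A *: g).
Proof. by move=> Ug s; rewrite mcoeffZ mulr_algl; exact: (submodZ sU). Qed.

Lemma GU_ind (P : G -> Prop) : P 0 -> (forall x y, P x -> P y -> P (x + y)) ->
  (forall s a, U a -> P << a *g s >>) -> forall g, GU g -> P g.
Proof.
by move=> P0 PD PU g Ug; rewrite (monalgE g); apply: big_ind => // s _; exact: PU.
Qed.

Lemma coef_app v g s w : (app v g)@_(rcons s w) = if v == w then g@_s else 0.
Proof.
elim/malg_ind: g => [|x y IHx IHy|s' a].
- by rewrite app0 !mcoeff0; case: ifP.
- by rewrite appD !mcoeffD IHx IHy; case: ifP => // _; rewrite addr0.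
rewrite appU !mcoeffU eqseq_rcons; case: eqP => [_|_] /=; last by case: ifP.
by rewrite eq_sym; case: (w == v).
Qed.

Lemma coef_app_nil v g : (app v g)@_[::] = 0.
Proof.
elim/malg_ind: g => [|x y IHx IHy|s a]; first by rewrite app0 mcoeff0.
  by rewrite appD mcoeffD IHx IHy addr0.
by rewrite appU mcoeffU; case: s.
Qed.

Lemma GU_app v g : GU g -> GU (app v g).
Proof.
by move=> Ug; elim/last_ind => [|s w _]; rewrite ?coef_app_nil ?coef_app; [|case: ifP => _ //];
  exact: (submod0 sU).
Qed.

Lemma U_psi v g : GU g -> U (psi v g).
Proof.
apply: (GU_ind (P := fun g => U (psi v g))) => [|x y Ux Uy|s a Ua].
- by rewrite psi0; exact: (submod0 sU).
- by rewrite psiD; exact: (submodD sU).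
rewrite psiU; apply: UM; first exact: U_bar.
by have [] := Ga_aug (s := rcons s v); rewrite ?size_rcons.
Qed.

Lemma augk_tdiff g : GU g -> augk (tdiff g)@_[::].
Proof.
apply: (GU_ind (P := fun g => augk (tdiff g)@_[::])) => [|x y Ux Uy|s a Ua].
- by rewrite tdiff0 mcoeff0; exact: (submod0 (submod_augk A)).
- by rewrite tdiffD mcoeffD; exact: (submodD (submod_augk A)).
rewrite tdiffU /tdiff_gen mcoeffB; apply: (submodB (submod_augk A)).
  by rewrite mcoeffU; case: eqP => _; [exact: augk_diff Ua|exact: (submod0 (submod_augk A))].
rewrite raddf_sum big_nat; apply: (submod_sum (submod_augk A)) => j /andP[j0 js] /=.
rewrite mcoeffU; case: eqP => _; last exact: (submod0 (submod_augk A)).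
have [|Ug ag] := Ga_aug (s := take j s); first by rewrite size_takel.
by apply: (augkM _ ag); exact: U_bar Ua.
Qed.

Definition words_le n g := GU g /\ forall s, (n < size s)%N -> g@_s = 0.

Lemma words_decomp n g : words_le n.+1 g -> exists (u : A) (S : seq L) (f : L -> G),
  [/\ U u, uniq S, forall v, words_le n (f v) & g = << u *g [::] >> + \sum_(v <- S) app v (f v)].
Proof.
move=> [Ug sg].
(* Words are grouped by their last letter. The clause that [f] vanishes off [S] allows the lists of
   two summands to be merged. *)
pose Q g := exists (u : A) (S : seq L) (f : L -> G),
  [/\ U u, uniq S, forall v, words_le n (f v), forall v, v \notin S -> f v = 0 &
      g = << u *g [::] >> + \sum_(v <- S) app v (f v)].
suff [u [S [f [Uu uS Wf _ ->]]]] : Q g by exists u, S, f.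
have W0 : words_le n 0 by split; [exact: GU0|move=> s _; rewrite mcoeff0].
have Q0 : Q 0.
  exists 0, [::], (fun=> 0); split=> //; first exact: (submod0 sU).
  by rewrite big_nil monalgU0 addr0.
rewrite (monalgE g); apply: (big_ind Q) => // [x y|s _].
  move=> [u [S [f [Uu uS Wf f0 ->]]]] [u' [S' [f' [Uu' uS' Wf' f0' ->]]]].
  exists (u + u'), (undup (S ++ S')), (fun v => f v + f' v).
  have ext (S1 : seq L) (f1 : L -> G) : uniq S1 -> (forall v, v \notin S1 -> f1 v = 0) ->
      {subset S1 <= undup (S ++ S')} ->
      \sum_(v <- S1) app v (f1 v) = \sum_(v <- undup (S ++ S')) app v (f1 v).
    move=> u1 f10 sub; rewrite [RHS](bigID (fun v => v \in S1)) /= [X in _ = _ + X]big1 ?addr0.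
      rewrite -[RHS]big_filter; apply: perm_big; apply: uniq_perm => //.
        by apply: filter_uniq; exact: undup_uniq.
      by move=> v; rewrite mem_filter; case: (boolP (v \in S1)) => // /sub ->.
    by move=> v /f10 ->; rewrite app0.
  split; first exact: (submodD sU).
  - exact: undup_uniq.
  - move=> v; split; first by apply: GUD; [have [] := Wf v|have [] := Wf' v].
    by move=> s ns; rewrite mcoeffD (Wf v).2 // (Wf' v).2 // addr0.
  - move=> v; rewrite mem_undup mem_cat negb_or => /andP[/f0 -> /f0' ->].
    by rewrite addr0.
  under [X in _ = _ + X]eq_bigr do rewrite appD; rewrite big_split /= monalgUD addrACA; congr (_ + (_ + _)).
    by apply: ext => // v vS; rewrite mem_undup mem_cat vS.
  by apply: ext => // v vS; rewrite mem_undup mem_cat vS orbT.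
have [ls|/sg ->] := leqP (size s) n.+1; last by rewrite monalgU0.
case/lastP: s ls => [|s v] ls.
  exists g@_[::], [::], (fun=> 0); split=> //.
  by rewrite big_nil addr0.
exists 0, [:: v], (fun w => if w == v then << g@_(rcons s v) *g s >> else 0).
split=> // [|w|w|]; first exact: (submod0 sU).
- case: eqP => // _; split; first exact: GU_mal.
  move=> s' ns'; rewrite mcoeffU; case: eqP => // e; subst s'.
  by rewrite size_rcons ltnS leqNgt ns' in ls.
- by rewrite inE; case: eqP.
by rewrite big_seq1 eqxx appU monalgU0 add0r.
Qed.

Lemma tdiff_letter v a : tdiff << a *g [:: v] >> =
  << d a *g [:: v] >> - << bar a * Ga [:: v] *g [::] >>.
Proof. by rewrite tdiffU /tdiff_gen /= big_nat1. Qed.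

Lemma malgU_sum (I : Type) (r : seq I) (F : I -> A) s :
  << \sum_(i <- r) F i *g s >> = \sum_(i <- r) << F i *g s >> :> G.
Proof. exact: raddf_sum. Qed.

Lemma tdiff_letter_scalar (c : R) v : tdiff << c%:A *g [:: v] >> = << c *: Ga [:: v] *g [::] >>.
Proof.
rewrite tdiff_letter !linearZ /= diff1 bar1 scaler0 monalgU0 sub0r -monalgUN.
by rewrite -scalerAl mulN1r scalerN opprK.
Qed.

(** Induction on the length of words. In a cycle, the part in front of a last letter [v] is itself a
    cycle with shorter words, hence a scalar plus a boundary. Removing the boundaries leaves words
    of length at most 1 with scalar coefficients on letters. These scalars lie in the maximal ideal
    by independence, so they are differentials of elements of [U], and what finally remains is a
    cycle of [U]. *)
Lemma tdiff_acyclic n g : words_le n g -> tdiff g = 0 ->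
  exists (lam : R) (g' : G), GU g' /\ g = << lam%:A *g [::] >> + tdiff g'.
Proof.
have base u : U u -> d u = 0 -> exists (lam : R) (g' : G), GU g' /\
    << u *g [::] >> = << lam%:A *g [::] >> + tdiff g'.
  move=> Uu du; have [lam [ps [b [Ub eu]]]] := Ga_decomp Uu du.
  exists lam, (\sum_(p <- ps) << p.1%:A *g [:: p.2] >> + << b *g [::] >>); split.
    apply: GUD; last exact: GU_mal.
    by apply: GU_sum => p; apply: GU_mal; apply: (submodZ sU); exact: U1.
  rewrite tdiffD tdiff_sum tdiff_nil eu !monalgUD malgU_sum addrA.
  by congr (_ + _ + _); apply: eq_bigr => p _; rewrite tdiff_letter_scalar.
elim: n g => [|n IH] g [Ug sg] dg.
  have eg : g = << g@_[::] *g [::] >>.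
    apply/malgP => s; rewrite mcoeffU; case: eqP => [<- //|ns].
    by rewrite mulr0n sg // lt0n size_eq0; apply/eqP => e; apply: ns.
  rewrite eg; apply: base => //; move: dg; rewrite eg tdiff_nil => /malgP/(_ [::]).
  by rewrite !mcoeffUU mcoeff0.
have [u [S [f [Uu uS Wf eg]]]] := words_decomp (conj Ug sg).
have df v : v \in S -> tdiff (f v) = 0.
  move=> vS; apply/malgP => s; rewrite mcoeff0.
  have /malgP/(_ (rcons s v)) := dg; rewrite eg tdiffD tdiff_nil tdiff_sum mcoeffD mcoeffU.
  rewrite mcoeff0 (_ : ([::] == rcons s v) = false) ?mulr0n ?add0r; last by case: (s).
  rewrite raddf_sum (bigD1_seq v) //= big1 => [|w /negPf wv].
    rewrite addr0 tdiff_app mcoeffB coef_app eqxx mcoeffU.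
    by rewrite (_ : ([::] == rcons s v) = false) ?mulr0n ?subr0 //; case: (s).
  rewrite tdiff_app mcoeffB coef_app wv mcoeffU.
  by rewrite (_ : ([::] == rcons s v) = false) ?mulr0n ?subr0 //; case: (s).
have /choice[p pP] : forall v, exists p : R * G, v \in S ->
    GU p.2 /\ f v = << p.1%:A *g [::] >> + tdiff p.2.
  move=> v; have [vS|_] := boolP (v \in S); last by exists (0, 0).
  by have [l [g' H]] := IH _ (Wf v) (df v vS); exists (l, g').
pose u1 := u + \sum_(v <- S) psi v (p v).2.
have Uu1 : U u1.
  apply: (submodD sU) => //; apply: (submod_sum_seq sU) => v vS.
  by apply: U_psi; have [] := pP v vS.
pose X := \sum_(v <- S) app v (p v).2.
have UX : GU X.
  rewrite /X big_seq; apply: (big_ind GU) => [|x y|v vS]; [exact: GU0|exact: GUD|].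
  by apply: GU_app; have [] := pP v vS.
have eg1 : g = << u1 *g [::] >> + \sum_(v <- S) << (p v).1%:A *g [:: v] >> + tdiff X.
  rewrite eg /u1 monalgUD malgU_sum /X tdiff_sum -!addrA; congr (_ + _).
  rewrite addrCA -!big_split /=; apply: eq_big_seq => v vS.
  rewrite tdiff_app (pP v vS).2 appD appU /=.
  by congr (_ + _); rewrite [RHS]addrC subrK.
(* The coefficient of the cycle condition at the empty word: a combination of the classes [Ga
   [:: v]] is a boundary. *)
have E1 : d u1 + \sum_(v <- S) (p v).1 *: Ga [:: v] = 0.
  have := dg; rewrite eg1 tdiffD tdiffK // addr0 tdiffD tdiff_nil tdiff_sum.
  under eq_bigr do rewrite tdiff_letter_scalar.
  by rewrite -malgU_sum -monalgUD => /malgP/(_ [::]); rewrite mcoeffUU mcoeff0.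
have l0 v : v \in S -> res (p v).1 = 0.
  apply: (Ga_indep (c := fun v => (p v).1) (b := - u1)) => //; first exact: (submodN sU).
  by rewrite linearN /=; apply/esym/addr0_eq.
have /choice[b bP] : forall v, exists b : A, v \in S -> U b /\ d b = (p v).1%:A.
  move=> v; have [vS|_] := boolP (v \in S); last by exists 0.
  by have [x [_ Ux dx _]] := exists_homotopy_gen A hq (l0 v vS); exists x.
pose Y := \sum_(v <- S) << b v *g [:: v] >>.
have UY : GU Y.
  rewrite /Y big_seq; apply: (big_ind GU) => [|x y|v vS]; [exact: GU0|exact: GUD|].
  by apply: GU_mal; have [] := bP v vS.
pose u2 := u1 + \sum_(v <- S) bar (b v) * Ga [:: v].
have Uu2 : U u2.
  apply: (submodD sU) => //; apply: (submod_sum_seq sU) => v vS; apply: UM.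
    by apply: U_bar; have [] := bP v vS.
  by have [] := Ga_aug (s := [:: v]).
have eg2 : g = << u2 *g [::] >> + tdiff (Y + X).
  rewrite eg1 tdiffD addrA; congr (_ + _).
  rewrite /u2 (monalgUD _ u1) malgU_sum -addrA; congr (_ + _).
  rewrite /Y tdiff_sum -big_split; apply: eq_big_seq => v vS /=.
  by rewrite tdiff_letter (bP v vS).2 addrC subrK.
have du2 : d u2 = 0.
  have := dg; rewrite eg2 tdiffD tdiffK // addr0 tdiff_nil => /malgP/(_ [::]).
  by rewrite mcoeffUU mcoeff0.
have [lam [g' [Ug' eu2]]] := base u2 Uu2 du2.
exists lam, (g' + (Y + X)); split; first by apply: GUD => //; exact: GUD.
have E : tdiff (g' + (Y + X)) = tdiff g' + tdiff (Y + X) by exact: tdiffD.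
by rewrite E addrA -eu2 -eg2.
Qed.

(* A word has finitely many letters, so that a finite sum of words has bounded
   length. *)
Lemma tdiff_exact g : GU g -> tdiff g = 0 -> augk g@_[::] ->
  exists g', [/\ GU g', tdiff g' = g & augk g'@_[::]].
Proof.
move=> Ug dg ag; pose n := \max_(s <- msupp g) size s.
have Wg : words_le n g.
  split=> // s ns; have [sg|] := boolP (s \in msupp g); last by rewrite -mcoeff_eq0 => /eqP.
  by move: ns; rewrite ltnNge (leq_bigmax_seq (F := @size L) s sg).
have [lam [g1 [Ug1 eg]]] := tdiff_acyclic Wg dg.
have l0 : res lam = 0.
  apply/(augk_scalar A q).
  have := submodB (submod_augk A) ag (augk_tdiff Ug1).
  by rewrite {1}eg mcoeffD mcoeffUU addrK.
have [b [_ Ub db _]] := exists_homotopy_gen A hq l0.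
pose g2 := g1 + << b *g [::] >>.
have Ug2 : GU g2 by apply: GUD => //; exact: GU_mal.
have eg2 : tdiff g2 = g by rewrite tdiffD tdiff_nil db addrC -eg.
have [r er] := U_comp0 (Ug2 [::]).
(* Scalars on the empty word are cycles. Subtracting one puts the preimage into the augmentation
   kernel, as the next lifting step requires. *)
exists (g2 - << r%:A *g [::] >>); split.
- by apply: GUB => //; apply: GU_mal; apply: (submodZ sU); exact: U1.
- by rewrite tdiffB tdiff_nil eg2 linearZ /= diff1 scaler0 monalgU0 subr0.
exists 0; rewrite ?rmorph0 // mcoeffB mcoeffUU linearB /= er linearZ /= dg_one.
by rewrite subrr scale0r.
Qed.

Section Lifting.
Variables (F : cx R) (t0 : ix F).
Hypothesis F0 : fib F 0 = [:: t0].
Hypothesis F1 : forall s : ix F, s \in fib F 1 -> res (cD s t0) = 0.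

(** The usual comparison map over k, built degree by degree from [tdiff_exact]. The invariant [P]
    records that the combinations to be lifted next are cycles in the augmentation kernel. *)
Lemma exists_lift : exists f : nat -> ix F -> G, [/\ f 0%N t0 = << 1 *g [::] >>,
  forall n t, t \in fib F n -> GU (f n t) &
  forall n (s : ix F), s \in fib F n.+1 -> tdiff (f n.+1 s) = \sum_(t <- fib F n) (cD s t)%:A *: f n t].
Proof.
pose P n (f : ix F -> G) := (n = 0%N -> f t0 = << 1 *g [::] >>) /\ forall t, t \in fib F n ->
  GU (f t) /\ (if n is n'.+1 then augk (f t)@_[::] /\
    forall s : ix F, s \in fib F n.+1 -> \sum_(t <- fib F n) (cD s t)%:A *: tdiff (f t) = 0
    else tdiff (f t) = 0).
pose Q n (f f' : ix F -> G) := forall s : ix F, s \in fib F n.+1 ->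
  tdiff (f' s) = \sum_(t <- fib F n) (cD s t)%:A *: f t.
have [||f fP] := @dependent_choice (ix F -> G) P Q.
- exists (fun=> << 1 *g [::] >>); split=> // t _; split; first exact: (GU_mal _ (U1 A q)).
  by rewrite tdiff_nil diff1 monalgU0.
- move=> n f [f0 Pf].
  have cyc (s : ix F) : s \in fib F n.+1 -> let g := \sum_(t <- fib F n) (cD s t)%:A *: f t in
      [/\ GU g, tdiff g = 0 & augk g@_[::]].
    move=> sn g; split.
    + rewrite /g big_seq; apply: (big_ind GU) => [|x y|t tn]; [exact: GU0|exact: GUD|].
      by apply: GU_scale; have [] := Pf t tn.
    + rewrite /g tdiff_sum; under eq_bigr do rewrite tdiff_scale.
      case: (n) sn Pf => [|n'] sn Pf.
        by rewrite big_seq big1 // => t tn; have [_ ->] := Pf t tn; rewrite scaler0.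
      case E : (fib F n'.+1) => [|t l]; first by rewrite big_nil.
      by rewrite -E; have [|_ [_ H]] := Pf t; [rewrite E mem_head|exact: H].
    rewrite /g raddf_sum big_seq; apply: (submod_sum (submod_augk A)) => t tn /=.
    rewrite mcoeffZ mulr_algl; case: (n) sn tn f0 Pf => [|n'] sn tn f0 Pf; last first.
      by apply: (submodZ (submod_augk A)); have [_ []] := Pf t tn.
    move: tn; rewrite F0 inE => /eqP ->; rewrite f0 // mcoeffUU.
    by apply/(augk_scalar A q); apply: F1.
  have /choice[f' f'P] : forall s : ix F, exists g', s \in fib F n.+1 ->
      [/\ GU g', tdiff g' = \sum_(t <- fib F n) (cD s t)%:A *: f t & augk g'@_[::]].
    move=> s; have [/cyc[Ug dg ag]|_] := boolP (s \in fib F n.+1); last by exists 0.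
    by have [g' H] := tdiff_exact Ug dg ag; exists g'.
  exists f'; split; last by move=> s /f'P[].
  split=> // s sn; have [Us ds as_] := f'P s sn; split=> //; split=> // s' s'n.
  rewrite (eq_big_seq (fun t => (cD s' t)%:A *: \sum_(u <- fib F n) (cD t u)%:A *: f u)); last first.
    by move=> t tn; have [_ -> _] := f'P t tn.
  under eq_bigr do rewrite scaler_sumr.
  rewrite exchange_big big_seq big1 // => u un.
  under eq_bigr do rewrite scalerA -scalerAl mul1r scalerA.
  by rewrite -scaler_suml -scaler_suml (cDD s'n un) !scale0r.
exists f; split=> [|n t tn|n s sn].
- by have [[-> //]] := fP 0%N.
- by have [[_ /(_ t tn)[]]] := fP n.
- by have [_] := fP n; apply.
Qed.

(** [Psi v] is the comparison map followed by [psi v], which anticommutes with the differentials.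
    The operation need not be homogeneous, so the component of the right degree is extracted. *)
Lemma exists_Psi (ldeg : L -> nat) : exists Psi : L -> nat -> ix F -> A,
  [/\ forall v n t, t \in fib F n -> U (Psi v n t) /\ homogeneous (n + ldeg v) (Psi v n t),
      forall v n (s : ix F), s \in fib F n.+1 ->
        d (Psi v n.+1 s) = - \sum_(t <- fib F n) cD s t *: Psi v n t &
      forall v, Psi v 0%N t0 = - dg_comp A (ldeg v) (Ga [:: v])].
Proof.
have [f [f0 fU df]] := exists_lift.
exists (fun v n t => dg_comp A (n + ldeg v) (psi v (f n t))); split=> [v n t tn|v n s sn|v].
- by split; [apply/U_comp/U_psi/fU|exact: comp_homogeneous].
- rewrite addSn -comp_diff -[d _]opprK -psi_tdiff // df // psi_sum linearN /= linear_sum.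
  by congr (- _); apply: eq_bigr => t _; rewrite psi_scale linearZ.
by rewrite f0 psiU bar1 mulN1r linearN.
Qed.
End Lifting.

End Acyclicity.

(** * The cone and its long exact sequence *)

Lemma submod_homogeneous (R : comUnitRingType) (A : dgAlgebra R) i :
  submod (homogeneous i : A -> Prop).
Proof. by split=> [|r x y]; [exact: homogeneous0|exact: homogeneous_lin]. Qed.

Lemma dimeq_killed (R : comUnitRingType) (k : fieldType) (res : {rmorphism R -> k})
    (X : lmodType R) (Z B : X -> Prop) (J : eqType) (S : seq J) r x :
  submod Z -> dimeq res Z B S -> res r = 0 -> Z x -> B (r *: x).
Proof.
move=> sZ [phi [lin _ ker]] r0 Zx; apply/ker => [|s sS]; first exact: submodZ.
have Z0 := submod0 sZ.
have phi0 : phi 0 s = 0.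
  by have := lin (-1) 0 0 Z0 Z0 s sS; rewrite scaler0 addr0 rmorphN1 mulN1r addNr.
by have := lin r x 0 Zx Z0 s sS; rewrite addr0 r0 mul0r phi0 addr0.
Qed.

Section Cone.
Variables (R : comUnitRingType) (k : fieldType) (res : {rmorphism R -> k}).
Hypothesis hR : noetherian_local res.
Variables (A : acyclicClosure res) (q : nat).
Hypothesis hq : (1 <= q)%N.
Notation tr := (truncation (@ac_var _ _ _ A) q).
Notation U := (@U _ _ _ A q).
Notation d := (dg_diff A).
Notation T := (variables (ac_num A) q).
Notation expo := {ffun T -> nat}.
Notation fibU := (@fibU _ _ _ A q).
Notation mono := (@monomial R A _ (@ac_var _ _ _ A) q).
Notation e0 := (@e0 _ _ _ A q).
Notation UU := (UP (@closed_predT _ _ _ A q)).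
Variables (h : nat -> nat) (z : letter h -> A).
Notation L := (letter h).
Implicit Types (v w : L) (m : expo).

Hypothesis zC : forall v, cycles tr (ldeg v) (z v).
Hypothesis z_span : forall j a, cycles tr j.+1 a -> exists c : 'I_(h j.+1) -> R,
  boundaries tr j.+1 (a - \sum_l c l *: z (mkletter l)).
Hypothesis z_indep : forall j (c : 'I_(h j.+1) -> R),
  boundaries tr j.+1 (\sum_l c l *: z (mkletter l)) -> forall l, res (c l) = 0.

Variables (F : cx R) (t0 : ix F) (Psi : L -> nat -> ix F -> A).
Hypothesis F0 : fib F 0 = [:: t0].
Hypothesis FB0 : forall c : ix F -> R^o, Bnd 0 c <-> res (c t0) = 0.
Hypothesis F_exact : forall n, exact_at F R^o n.+1.
Hypothesis PsiU : forall v n t, t \in fib F n ->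
  U (Psi v n t) /\ homogeneous (n + ldeg v) (Psi v n t).
Hypothesis Psi_diff : forall v n s, s \in fib F n.+1 ->
  d (Psi v n.+1 s) = - \sum_(t <- fib F n) cD s t *: Psi v n t.
Hypothesis Psi0 : forall v, exists b, [/\ U b, homogeneous (ldeg v).+1 b & Psi v 0%N t0 = - z v + d b].

(** The letters whose copy of F, shifted by [(ldeg v).+1], reaches degree [n]. *)
Definition lets n : seq L :=
  flatten [seq [seq mkletter l | l <- enum 'I_(h j.+1)] | j <- iota 0 n.-1].

Lemma mem_lets n v : (v \in lets n) = ((ldeg v).+1 <= n)%N.
Proof.
apply/flatten_mapP/idP => [[j]|le].
  by rewrite mem_iota /ldeg => jn /mapP[l _ ->] /=; lia.
exists (tag v); first by rewrite mem_iota; move: le; rewrite /ldeg; lia.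
by case: v le => j l _; apply/mapP; exists l; rewrite ?mem_enum.
Qed.

Lemma lets_uniq n : uniq (lets n).
Proof.
rewrite /lets; elim: (n.-1) 0%N => //= p IH i; rewrite cat_uniq IH andbT.
rewrite map_inj_uniq ?enum_uniq /= => [|x y /eqP]; last by rewrite eq_Tagged => /eqP.
apply/hasPn => v /flatten_mapP[j]; rewrite mem_iota => ij /mapP[l _ ->].
by apply/mapP => -[l' _ /(congr1 (@tag _ _))/= e]; lia.
Qed.

Lemma big_lets (V : nmodType) n (f : nat -> V) :
  \sum_(v <- lets n) f (tag v) = \sum_(j < n.-1) f j *+ h j.+1.
Proof.
rewrite big_flatten big_map -[n.-1]subn0 -/(index_iota 0 n.-1) big_mkord subn0.
apply: eq_bigr => j _; rewrite big_map big_enum /=.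
by rewrite sumr_const card_ord.
Qed.

Definition fibQ n : seq (L * ix F) := [seq (v, s) | v <- lets n, s <- fib F (n - (ldeg v).+1)].

Lemma mem_fibQ n v s : ((v, s) \in fibQ n) = ((ldeg v).+1 <= n)%N && (s \in fib F (n - (ldeg v).+1)).
Proof.
apply/allpairsPdep/andP => [[v' [s' [vn sn [-> ->]]]]|[vn sn]].
  by rewrite -mem_lets.
by exists v, s; rewrite mem_lets.
Qed.

Lemma fibQ_uniq n : uniq (fibQ n).
Proof.
apply: allpairs_uniq_dep => [|v _|[v s] [v' s'] _ _ /= [-> ->]] //; first exact: lets_uniq.
exact: fib_uniq.
Qed.

Definition coneix := (expo + (L * ix F))%type.
Definition cfib n : seq coneix := map inl (fibU n) ++ map inr (fibQ n).
Definition cdg (t : coneix) : nat :=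
  match t with inl m => wt m | inr p => ((ldeg p.1).+1 + cdeg p.2)%N end.
Definition coefPsi (p : L * ix F) m : R := coefU (cdeg p.2 + ldeg p.1) (Psi p.1 (cdeg p.2) p.2) m.
(* The cone of the maps [Psi v], of degree [ldeg v], from copies of [F] to [U]. *)
Definition coneD (s t : coneix) : R :=
  match s, t with
  | inl m, inl m' => DU m m'
  | inl _, inr _ => 0
  | inr p, inl m => coefPsi p m
  | inr p, inr p' => (p.1 == p'.1)%:R * cD p.2 p'.2
  end.

Lemma mem_cfib_inl n m : (inl m \in cfib n) = (m \in fibU n).
Proof.
rewrite mem_cat mem_map; last by move=> ? ? [].
by rewrite orbC (_ : _ \in map inr _ = false) //; apply/mapP => -[].
Qed.
Lemma mem_cfib_inr n p : (inr p \in cfib n) = (p \in fibQ n).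
Proof.
rewrite mem_cat orbC mem_map; last by move=> ? ? [].
by rewrite orbC (_ : _ \in map inl _ = false) //; apply/mapP => -[].
Qed.

Lemma cfib_uniq n : uniq (cfib n).
Proof.
rewrite cat_uniq !map_inj_uniq ?fibU_uniq ?fibQ_uniq ?andbT => [|x y [] //|x y [] //].
by apply/hasPn => t /mapP[p _ ->]; apply/mapP => -[].
Qed.
Lemma cfib_deg n t : t \in cfib n -> cdg t = n.
Proof.
case: t => [m|[v s]]; first by rewrite mem_cfib_inl mem_fibU => /andP[_ /eqP].
by rewrite mem_cfib_inr mem_fibQ /= => /andP[vn /fib_deg ->]; rewrite subnKC.
Qed.

Lemma big_cfib (V : nmodType) n (f : coneix -> V) :
  \sum_(t <- cfib n) f t = \sum_(m <- fibU n) f (inl m) + \sum_(p <- fibQ n) f (inr p).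
Proof. by rewrite big_cat !big_map. Qed.

Lemma big_fibQ (V : nmodType) n (v : L) (f : ix F -> V) : (ldeg v < n)%N ->
  \sum_(p <- fibQ n) (if p.1 == v then f p.2 else 0) = \sum_(s <- fib F (n - (ldeg v).+1)) f s.
Proof.
move=> vn; rewrite big_allpairs_dep /= (bigD1_seq v) ?mem_lets ?lets_uniq //= [X in _ + X]big1.
  by rewrite addr0; apply: eq_bigr => s _; rewrite eqxx.
by move=> w /negPf wv; rewrite big1 // => s _; rewrite wv.
Qed.

Lemma coefPsiE n v s m : s \in fib F n -> coefPsi (v, s) m = coefU (n + ldeg v) (Psi v n s) m.
Proof. by move=> /fib_deg sn; rewrite /coefPsi /= sn. Qed.

Lemma coefPsi_diff n v s m : s \in fib F n.+1 -> m \in fibU (n + ldeg v) ->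
  \sum_(m' <- fibU (n + ldeg v).+1) coefPsi (v, s) m' * DU m' m =
  - \sum_(t <- fib F n) cD s t * coefPsi (v, t) m.
Proof.
move=> sn mn; have [Up hP] := PsiU v sn.
transitivity (coefU (n + ldeg v) (d (Psi v n.+1 s)) m).
  rewrite {1}(coefUE Up hP) linear_sum /=; under [in RHS]eq_bigr do rewrite linearZ /=.
  rewrite coefU_sum // => [|m' m'n]; last exact: diff_mono_homog.
  by apply: eq_big_seq => m' m'n; rewrite (coefPsiE _ _ sn) (DUE _ m'n).
rewrite Psi_diff // -sumrN; under eq_bigr do rewrite -scaleNr.
rewrite coefU_sum // => [|t tn]; last exact: PsiU.
by rewrite -sumrN; apply: eq_big_seq => t tn; rewrite (coefPsiE _ _ tn) mulNr.
Qed.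

Lemma coefPsi_diff0 v m : m \in fibU (ldeg v).-1 ->
  \sum_(m' <- fibU (ldeg v)) coefPsi (v, t0) m' * DU m' m = 0.
Proof.
move=> mn; have t00 : t0 \in fib F 0 by rewrite F0 mem_head.
have [Up hP] := PsiU v t00; have [b [_ _ eb]] := Psi0 v; have [_ _ dz] := zC v.
transitivity (coefU (ldeg v).-1 (d (Psi v 0%N t0)) m).
  rewrite {1}(coefUE Up hP) linear_sum /=; under [in RHS]eq_bigr do rewrite linearZ /=.
  rewrite coefU_sum // => [|m' m'n]; last exact: diff_mono_homog.
  by apply: eq_big_seq => m' m'n; rewrite (coefPsiE _ _ t00) (DUE _ m'n).
by rewrite eb linearD linearN /= dz oppr0 add0r dg_diff_diff coefU0.
Qed.

Lemma coneDD n s u : s \in cfib n.+2 -> u \in cfib n ->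
  \sum_(t <- cfib n.+1) coneD s t * coneD t u = 0.
Proof.
rewrite big_cfib; case: s => [ms|[v s]]; case: u => [mu|[w u]] /=.
- rewrite !mem_cfib_inl => msn mun; rewrite [X in _ + X]big1 ?addr0 => [|p _]; last by rewrite mul0r.
  have := @fibP_DD _ _ _ A q predT (@closed_predT _ _ _ A q) n ms mu.
  by rewrite !mem_fibP /fibP filter_predT /=; apply.
- by rewrite !big1 ?addr0 // => ? _; rewrite ?mul0r ?mulr0.
- rewrite mem_cfib_inl mem_cfib_inr mem_fibQ => /andP[vn sn] mun.
  rewrite (eq_bigr (fun p => if p.1 == v then cD s p.2 * coefPsi (v, p.2) mu else 0)); last first.
    by case=> v' s' _ /=; rewrite eq_sym; case: eqP => [->|_]; rewrite ?mul0r ?mul1r.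
  (* When [s] has degree 0 in its copy of F, the differential of F contributes nothing, and the
     claim is that [Psi v 0 t0] is a cycle. *)
  move: vn; rewrite leq_eqVlt => /orP[/eqP e|vn].
    rewrite [X in _ + X]big_seq [X in _ + X]big1 => [|[v' s'] /=]; last first.
      by rewrite mem_fibQ => /andP[le _]; case: eqP => // e'; move: le; rewrite e'; lia.
    rewrite addr0; move: sn; rewrite -e subnn F0 inE => /eqP ->.
    have en : n = (ldeg v).-1 by lia.
    have en' : n.+1 = ldeg v by lia.
    by rewrite en'; apply: coefPsi_diff0; rewrite -en.
  rewrite (big_fibQ (fun s' => cD s s' * coefPsi (v, s') mu)) //; have [i ei] : exists i, (n.+1 - (ldeg v).+1)%N = i by exists (n.+1 - (ldeg v).+1)%N.
  have esn : (n.+2 - (ldeg v).+1)%N = i.+1 by lia.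
  have en : n = (i + ldeg v)%N by lia.
  by rewrite ei esn in sn *; rewrite en in mun *; rewrite coefPsi_diff // addNr.
rewrite !mem_cfib_inr !mem_fibQ => /andP[vn sn] /andP[wn un].
rewrite big1 ?add0r => [|m _]; last by rewrite mulr0.
have [evw|nvw] := eqVneq v w; last first.
  rewrite big1 // => -[v' s'] _ /=; case: (eqVneq v v') => [<-|_]; last by rewrite !mul0r.
  by rewrite (negPf nvw) mul0r mulr0.
subst w; rewrite (eq_bigr (fun p => if p.1 == v then cD s p.2 * cD p.2 u else 0)); last first.
  by case=> v' s' _ /=; rewrite eq_sym; case: eqP => _; rewrite ?mul0r ?mul1r ?mulr0.
rewrite (big_fibQ (fun s' => cD s s' * cD s' u)) //; last by lia.
have [i ei] : exists i, (n - (ldeg v).+1)%N = i by exists (n - (ldeg v).+1)%N.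
have e1 : (n.+1 - (ldeg v).+1)%N = i.+1 by lia.
have e2 : (n.+2 - (ldeg v).+1)%N = i.+2 by lia.
by rewrite e1; rewrite e2 in sn; rewrite ei in un; exact: cDD sn un.
Qed.

Definition cone : cx R := Cx cfib_uniq cfib_deg coneDD.

Section ConeCoefficients.
Variable M : lmodType R.
Implicit Types y : coneix -> M.

Lemma dn_cone_inr n y v s : (v, s) \in fibQ n ->
  @dn R cone M n y (inr (v, s)) = dn (n - (ldeg v).+1) (fun s => y (inr (v, s))) s.
Proof.
rewrite mem_fibQ => /andP[vn sn]; rewrite /dn /= big_cfib big1 ?add0r => [|m _]; last by rewrite scale0r.
rewrite -subSn // -(big_fibQ (fun s' => cD s' s *: y (inr (v, s')))) ?ltnS 1?ltnW //.
apply: eq_bigr => -[v' s'] _ /=; case: eqP => [->|_]; first by rewrite mul1r.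
by rewrite mul0r scale0r.
Qed.

(** The connecting map of the cone, from the copies of F to U. *)
Definition delta n (y : L * ix F -> M) : expo -> M := fun m =>
  \sum_(p <- fibQ n.+1) coefPsi p m *: y p.

Fact delta_linear n : linear (delta n).
Proof.
move=> a x y; apply/funext => m; rewrite /delta [RHS]/GRing.add /= [in RHS]/GRing.scale /=.
rewrite scaler_sumr -big_split; apply: eq_bigr => p _ /=.
by rewrite -[(a *: x + y) p]/(a *: x p + y p) scalerDr !scalerA mulrC.
Qed.
HB.instance Definition _ n :=
  GRing.isLinear.Build R (L * ix F -> M) (expo -> M) *:%R (delta n) (delta_linear n).

Lemma fibUU n : fib UU n = fibU n.
Proof. exact: filter_predT. Qed.

Lemma dn_cone_inl n y m :
  @dn R cone M n y (inl m) = @dn R UU M n (fun m => y (inl m)) m + delta n (fun p => y (inr p)) m.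
Proof. by rewrite /dn fibUU /= big_cfib. Qed.

Definition CycQ n (y : L * ix F -> M) := forall v, (ldeg v < n)%N ->
  @Cyc R F M (n - (ldeg v).+1) (fun s => y (v, s)).
Definition BndQ n (y : L * ix F -> M) := forall v, (ldeg v < n)%N ->
  @Bnd R F M (n - (ldeg v).+1) (fun s => y (v, s)).

Lemma submod_CycQ n : submod (CycQ n).
Proof.
split=> [v _|a x y Cx Cy v vn]; first exact: (submod_Cyc F M _).1.
exact: (submod_Cyc F M _).2 a _ _ (Cx v vn) (Cy v vn).
Qed.
Lemma submod_BndQ n : submod (BndQ n).
Proof.
split=> [v _|a x y Cx Cy v vn]; first exact: (submod_Bnd F M _).1.
exact: (submod_Bnd F M _).2 a _ _ (Cx v vn) (Cy v vn).
Qed.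

Lemma Cyc_cone n y : @Cyc R cone M n y <->
  CycQ n (fun p => y (inr p)) /\
  forall i, n = i.+1 -> forall m, m \in fibU i ->
    @dn R UU M i (fun m => y (inl m)) m + delta i (fun p => y (inr p)) m = 0.
Proof.
split=> [Cy|[CQ CU]].
  split=> [v vn|i en m mi]; last first.
    by move: Cy; rewrite en => /(_ (inl m)); rewrite mem_cfib_inl mi dn_cone_inl; apply.
  case: n Cy vn => // n Cy vn; case ei : (n.+1 - (ldeg v).+1)%N => [|i] // s si.
  have pn : (v, s) \in fibQ n by rewrite mem_fibQ (_ : (n - (ldeg v).+1)%N = i) ?si; lia.
  have := Cy (inr (v, s)); rewrite mem_cfib_inr => /(_ pn); rewrite dn_cone_inr //.
  by rewrite (_ : (n - (ldeg v).+1)%N = i) //; lia.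
case: n CQ CU => // n CQ CU [m|[v s]]; first by rewrite mem_cfib_inl dn_cone_inl; exact: CU.
rewrite mem_cfib_inr => pn; rewrite dn_cone_inr //.
move: pn; rewrite mem_fibQ => /andP[vn sn].
have := CQ v (leqW vn); rewrite subSn // => /(_ s sn); exact.
Qed.

Lemma Bnd_cone n y : @Bnd R cone M n y <-> exists (w : expo -> M) (x : L * ix F -> M),
  (forall m, m \in fibU n -> y (inl m) = @dn R UU M n w m + delta n x m) /\
  forall v s, (v, s) \in fibQ n -> y (inr (v, s)) = dn (n - (ldeg v).+1) (fun s => x (v, s)) s.
Proof.
split=> [[w ew]|[w [x [eU eQ]]]].
  exists (fun m => w (inl m)), (fun p => w (inr p)); split=> [m mn|v s pn].
    by rewrite ew ?dn_cone_inl // mem_cfib_inl.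
  by rewrite ew ?dn_cone_inr // mem_cfib_inr.
exists (fun t => match t with inl m => w m | inr p => x p end) => -[m|[v s]].
  by rewrite mem_cfib_inl => mn; rewrite dn_cone_inl eU.
by rewrite mem_cfib_inr => pn; rewrite dn_cone_inr // eQ.
Qed.

End ConeCoefficients.

Lemma fibU0 : fibU 0 = [:: e0].
Proof.
apply: perm_small_eq => //; apply: uniq_perm; rewrite ?fibU_uniq // => m.
rewrite mem_fibU inE; apply/andP/eqP => [[_ /eqP/wt_eq0]//|->].
by rewrite adm0 /wt big1 // => v _; rewrite ffunE muln0.
Qed.

Lemma diff_comb n (y : expo -> R^o) :
  d (\sum_(m <- fibU n.+1) y m *: mono m) = \sum_(m <- fibU n) @dn R UU R^o n y m *: mono m.
Proof.
rewrite linear_sum.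
rewrite (eq_big_seq (fun m => \sum_(m' <- fibU n) (DU m m' * y m) *: mono m')) => [|m mn].
  by rewrite exchange_big /=; apply: eq_bigr => m' _; rewrite -scaler_suml /dn fibUU.
rewrite linearZ /= (diff_monoE mn) scaler_sumr.
by apply: eq_bigr => m' _; rewrite scalerA mulrC.
Qed.

Lemma big_fibQ_top (V : nmodType) j (f : L * ix F -> V) :
  (forall v s, (v, s) \in fibQ j.+2 -> ldeg v != j.+1 -> f (v, s) = 0) ->
  \sum_(p <- fibQ j.+2) f p = \sum_(l < h j.+1) f (mkletter l, t0).
Proof.
move=> f0; have lE : lets j.+2 = lets j.+1 ++ [seq mkletter l | l <- enum 'I_(h j.+1)].
  have e : iota 0 j.+1 = iota 0 j ++ [:: j] by rewrite -addn1 iotaD.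
  by rewrite /lets -[j.+2.-1]/(j.+1) e map_cat flatten_cat /= cats0.
rewrite big_allpairs_dep /= lE big_cat /= big_map big_enum /= big_seq big1 ?add0r => [|v vl].
  apply: eq_bigr => l _; rewrite (_ : (j.+2 - _)%N = 0%N) ?F0 ?big_seq1 //.
  by rewrite /ldeg /= subnn.
rewrite big_seq big1 // => s sn; apply: f0.
  by rewrite mem_fibQ sn andbT; move: vl; rewrite mem_lets; lia.
by move: vl; rewrite mem_lets; lia.
Qed.

Lemma delta_comb j (x : L * ix F -> R^o) :
  (forall v s, (v, s) \in fibQ j.+2 -> ldeg v != j.+1 -> x (v, s) = 0) ->
  \sum_(m <- fibU j.+1) delta j.+1 x m *: mono m =
  \sum_(l < h j.+1) x (mkletter l, t0) *: Psi (mkletter l) 0%N t0.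
Proof.
move=> x0; have t00 : t0 \in fib F 0 by rewrite F0 mem_head.
rewrite -(big_fibQ_top (f := fun p => x p *: Psi p.1 0%N p.2)) => [|v s vs vj]; last first.
  by rewrite (x0 v s vs vj) scale0r.
rewrite /delta; under eq_bigr do rewrite scaler_suml.
rewrite exchange_big /=; apply: eq_big_seq => -[v s] vs /=.
have [ev|vj] := eqVneq (ldeg v) j.+1; last first.
  by rewrite (x0 v s vs vj) scale0r big1 // => m _; rewrite scaler0 scale0r.
move: vs; rewrite mem_fibQ ev subnn => /andP[_]; rewrite F0 inE => /eqP ->.
have [Up hP] := PsiU v t00; rewrite {1}(coefUE Up hP) scaler_sumr add0n ev.
apply: eq_bigr => m _; rewrite (coefPsiE _ _ t00) -?[(0 + ldeg v)%N]/(ldeg v) ev scalerA.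
by congr (_ *: _); rewrite mulrC.
Qed.

(** The quotient has one class in degree [(ldeg v).+1] for each letter [v], and the connecting map
    sends it to minus the class of [z v]. This matches a basis of the reduced homology of U, so only
    H_0(U) = k survives. *)
Lemma cone_residue : resolves (fun _ : ix cone => one_residue res).
Proof.
apply: (resolves_residue hR (t0 := inl e0 : ix cone)).
- by rewrite /= /cfib fibU0 /fibQ /lets.
- move=> c; have e00 : inl e0 \in cfib 0 by rewrite mem_cfib_inl fibU0 mem_head.
  have Q1 : fibQ 1 = [::] by [].
  have dnE (w : coneix -> R^o) : @dn R cone R^o 0 w (inl e0) =
      \sum_(m <- fibU 1) DU m e0 * w (inl m).
    by rewrite dn_cone_inl /delta Q1 big_nil addr0 /dn fibUU.
  split=> [[w ew]|c0].
    rewrite ew // dnE rmorph_sum big_seq big1 // => m m1; rewrite rmorphM.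
    rewrite [X in X * _](_ : _ = 0) ?mul0r //; apply/(augk_scalar A q).
    by have := augk_diff (fibU_mono m1).1; rewrite (diff_monoE m1) fibU0 big_seq1 mono0.
  have [xi [h1 Uxi dxi _]] := exists_homotopy_gen A hq c0.
  exists (fun t => if t is inl m then coefU 1 xi m else 0) => t.
  rewrite /= /cfib fibU0 mem_cat inE orbF => /eqP ->; rewrite dnE.
  apply: (@scalar_inj _ _ _ A q); rewrite -dxi {1}(coefUE Uxi h1) linear_sum scaler_suml.
  apply: eq_big_seq => m m1; rewrite linearZ /= (diff_monoE m1) fibU0 big_seq1 mono0.
  by rewrite scalerA mulrC.
move=> n y Cy; have [CQ _] := (Cyc_cone n.+1 y).1 Cy.
have t00 : t0 \in fib F 0 by rewrite F0 mem_head.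
(* The components in positive degree are boundaries; the remaining ones have
   to lie in the maximal ideal since the [z v] are independent. *)
have /choice[w1 w1P] : forall v, exists w : ix F -> R^o, (ldeg v < n)%N ->
    forall s, s \in fib F (n.+1 - (ldeg v).+1) -> y (inr (v, s)) = dn (n.+1 - (ldeg v).+1) w s.
  move=> v; have [vn|_] := ltnP (ldeg v) n; last by exists 0.
  have := CQ v (leqW vn); case ei : (n.+1 - (ldeg v).+1)%N => [|i]; first lia.
  by move=> /F_exact[w ew]; exists w.
pose x1 (p : L * ix F) : R^o := if (ldeg p.1 < n)%N then w1 p.1 p.2 else 0.
pose W1 : coneix -> R^o := fun t => if t is inr p then x1 p else 0.
pose y1 := y - @dn R cone R^o n.+1 W1.
have Cy1 : @Cyc R cone R^o n.+1 y1.
  have CW : @Cyc R cone R^o n.+1 (@dn R cone R^o n.+1 W1) by apply: Bnd_Cyc; exists W1.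
  exact: (submodB (submod_Cyc cone R^o n.+1) Cy CW).
have y1Q v s : (v, s) \in fibQ n.+1 -> y1 (inr (v, s)) = if ldeg v == n then y (inr (v, s)) else 0.
  move=> pn; rewrite -[LHS]/(y (inr (v, s)) - @dn R cone R^o n.+1 W1 (inr (v, s))) dn_cone_inr //.
  have := pn; rewrite mem_fibQ => /andP[]; rewrite ltnS leq_eqVlt => /orP[/eqP ev|vn] sn.
    rewrite ev eqxx [X in _ - X]big1 ?subr0 // => s' _.
    by rewrite /W1 /x1 /= ev ltnn scaler0.
  rewrite (ltn_eqF vn) (w1P v vn s sn); apply/eqP; rewrite subr_eq0; apply/eqP.
  by apply: eq_dn => s' _; rewrite /W1 /x1 /= vn.
have y0 v : ldeg v = n -> res (y (inr (v, t0))) = 0.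
  case: v => j l /=; rewrite /ldeg /= => ej; subst n.
  have /choice[b bP] := Psi0.
  pose a := \sum_(m <- fibU j.+2) y1 (inl m) *: mono m.
  have [_ CU1] := (Cyc_cone _ _).1 Cy1; have {}CU1 := CU1 _ erefl.
  have y1top v s : (v, s) \in fibQ j.+2 -> ldeg v != j.+1 -> y1 (inr (v, s)) = 0.
    by move=> /y1Q ->; rewrite /ldeg => /negPf ->.
  have y1l (l' : 'I_(h j.+1)) : y1 (inr (mkletter l', t0)) = y (inr (mkletter l', t0)).
    by rewrite y1Q ?mem_fibQ /ldeg /= ?eqxx // subnn t00 leqnn.
  have H : boundaries tr j.+1 (\sum_(l < h j.+1) y (inr (mkletter l, t0)) *: z (mkletter l)).
    exists (a + \sum_(l < h j.+1) y (inr (mkletter l, t0)) *: b (mkletter l)); split.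
    - rewrite truncationE; apply: (submodD (sU A q)); first by apply: (submod_sum_seq (sU A q)) => m mn; apply: (submodZ (sU A q)); have [] := fibU_mono mn.
      by apply: (submod_sum (sU A q)) => l' _; apply: (submodZ (sU A q)); have [] := bP (mkletter l').
    - have hs := submod_homogeneous A j.+2; apply: (submodD hs); first by apply: (submod_sum_seq hs) => m mn; apply: (submodZ hs); have [] := fibU_mono mn.
      by apply: (submod_sum hs) => l' _; apply: (submodZ hs); have [] := bP (mkletter l').
    have da : d a = - \sum_(l < h j.+1) y (inr (mkletter l, t0)) *: Psi (mkletter l) 0%N t0.
      under [in RHS]eq_bigr do rewrite -y1l.
      rewrite -(delta_comb (x := fun p => y1 (inr p))) // /a diff_comb -sumrN.
      apply: eq_big_seq => m mj; rewrite -scaleNr; congr (_ *: _).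
      by apply/eqP; rewrite -addr_eq0; apply/eqP/CU1.
    rewrite linearD /= da -sumrN linear_sum -big_split; apply: eq_bigr => l' _ /=.
    have [_ _ ->] := bP (mkletter l').
    by rewrite [d (_ *: _)]linearZ /= scalerDr scalerN opprD opprK subrK.
  exact: (z_indep H l).
(* Letters of degree [n] can now be included: their coefficient at [t0] lies in the maximal ideal,
   hence is a boundary in F by [FB0]. *)
have /choice[w2 w2P] : forall v, exists w : ix F -> R^o, (ldeg v < n.+1)%N ->
    forall s, s \in fib F (n.+1 - (ldeg v).+1) -> y (inr (v, s)) = dn (n.+1 - (ldeg v).+1) w s.
  move=> v; have [vn|_] := ltnP (ldeg v) n.+1; last by exists 0.
  have := CQ v vn; case ei : (n.+1 - (ldeg v).+1)%N => [|i]; last first.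
    by move=> /F_exact[w ew]; exists w.
  have ev : ldeg v = n by lia.
  by have [_ /(_ (y0 v ev))[w ew]] := FB0 (fun s => y (inr (v, s))); exists w.
pose W2 : coneix -> R^o := fun t => if t is inr p then w2 p.1 p.2 else 0.
pose y2 := y - @dn R cone R^o n.+1 W2.
suff [W ew] : @Bnd R cone R^o n.+1 y2.
  exists (W + W2) => t tn; have := ew t tn; rewrite -[y2 t]/(y t - @dn R cone R^o n.+1 W2 t) => /eqP.
  rewrite subr_eq => /eqP ->; have := @dnP R cone R^o n.+1 1 W W2 t; rewrite !scale1r; exact: esym.
have Cy2 : @Cyc R cone R^o n.+1 y2.
  have CW : @Cyc R cone R^o n.+1 (@dn R cone R^o n.+1 W2) by apply: Bnd_Cyc; exists W2.
  exact: (submodB (submod_Cyc cone R^o n.+1) Cy CW).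
have y2Q v s : (v, s) \in fibQ n.+1 -> y2 (inr (v, s)) = 0.
  move=> pn; rewrite -[LHS]/(y (inr (v, s)) - @dn R cone R^o n.+1 W2 (inr (v, s))) dn_cone_inr //.
  by have := pn; rewrite mem_fibQ => /andP[vn sn]; rewrite (w2P v vn s sn) subrr.
have [_ CU2] := (Cyc_cone _ _).1 Cy2; have {}CU2 := CU2 _ erefl.
pose a := \sum_(m <- fibU n.+1) y2 (inl m) *: mono m.
have Ca : cycles tr n.+1 a.
  have hs := submod_homogeneous A n.+1; split.
  - by rewrite truncationE; apply: (submod_sum_seq (sU A q)) => m mn; apply: (submodZ (sU A q)); have [] := fibU_mono mn.
  - by apply: (submod_sum_seq hs) => m mn; apply: (submodZ hs); have [] := fibU_mono mn.
  rewrite /a diff_comb big_seq big1 // => m mn; have := CU2 m mn.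
  rewrite [X in _ + X]/delta big_seq big1 ?addr0 => [->|[v s] vs]; first by rewrite scale0r.
  by rewrite y2Q // scaler0.
have [c [b [Ub hb eb]]] := z_span Ca.
have /choice[b' bP] := Psi0.
pose c' v := \sum_(l < h n.+1) (if v == mkletter l then c l else 0).
have c'l l : c' (mkletter l) = c l.
  rewrite /c' (bigD1 l) //= eqxx big1 ?addr0 // => l' /negPf ll'.
  by rewrite eq_Tagged /= eq_sym ll'.
pose B := b + \sum_l c l *: b' (mkletter l).
have {}Ub : U b by move: Ub; rewrite truncationE.
have UB : U B.
  apply: (submodD (sU A q)) => //; apply: (submod_sum (sU A q)) => l _.
  by apply: (submodZ (sU A q)); have [] := bP (mkletter l).
have hB : homogeneous n.+2 B.
  have hs := submod_homogeneous A n.+2; apply: (submodD hs) => //; apply: (submod_sum hs) => l _.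
  by apply: (submodZ hs); have [] := bP (mkletter l).
(* The connecting map sends these coefficients to the combination of the [z] that represents the
   class of [a], up to a boundary which the second term of [B] compensates. *)
pose x2 (p : L * ix F) : R^o := if p.2 == t0 then - c' p.1 else 0.
apply/Bnd_cone; exists (coefU n.+2 B), x2.
have xtop v s : (v, s) \in fibQ n.+2 -> ldeg v != n.+1 -> x2 (v, s) = 0.
  move=> _ vn; rewrite /x2 /= /c' big1 ?oppr0 ?if_same // => l _; case: eqP => // ev.
  by move: vn; rewrite ev /ldeg eqxx.
split=> [m mn|v s vs]; last first.
  rewrite y2Q // /dn big1 // => s' _; rewrite /x2 /= (_ : c' v = 0) ?oppr0 ?if_same ?scaler0 //.
  move: vs; rewrite mem_fibQ => /andP[vn _]; rewrite /c' big1 // => l _; case: eqP => // ev.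
  by move: vn; rewrite ev /ldeg ltnn.
have aE : a = \sum_(m <- fibU n.+1) (@dn R UU R^o n.+1 (coefU n.+2 B) m +
    delta n.+1 x2 m) *: mono m.
  under eq_bigr do rewrite scalerDl; rewrite big_split /= delta_comb // -diff_comb -(coefUE UB hB).
  have -> : a = d b + \sum_l c l *: z (mkletter l) by rewrite -eb subrK.
  rewrite linearD /= -addrA; congr (_ + _); rewrite linear_sum -big_split; apply: eq_bigr => l _ /=.
  have [_ _ ->] := bP (mkletter l).
  by rewrite /x2 /= eqxx c'l [d (_ *: _)]linearZ /= scaleNr scalerDr scalerN opprD opprK addrCA subrr addr0.
by rewrite -(coefU_uniq (c := fun m => y2 (inl m)) erefl mn) -/a; exact: (coefU_uniq aE mn).
Qed.

Section LongExactSequence.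
Variables (P : cx R) (M : lmodType R) (eP : ix P -> M).
Hypothesis resP : resolves eP.
Hypothesis minP : forall n s t, s \in fib P n.+1 -> t \in fib P n -> res (cD s t) = 0.
Variable H : nat -> nat.
Hypothesis HP : forall n, dimle res (@Cyc R UU M n) (@Bnd R UU M n) (H n).

Definition incl_cone (x : expo -> M) : coneix -> M :=
  fun t => if t is inl m then x m else 0.
Fact incl_cone_linear : linear incl_cone.
Proof.
move=> a x y; apply/funext => -[m|p] //.
by rewrite -[RHS]/(a *: 0 + 0) scaler0 addr0.
Qed.
HB.instance Definition _ :=
  GRing.isLinear.Build R (expo -> M) (coneix -> M) *:%R incl_cone incl_cone_linear.

Definition proj_cone (y : coneix -> M) : L * ix F -> M := fun p => y (inr p).
Fact proj_cone_linear : linear proj_cone. Proof. by move=> a x y. Qed.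
HB.instance Definition _ :=
  GRing.isLinear.Build R (coneix -> M) (L * ix F -> M) *:%R proj_cone proj_cone_linear.

(** This indexes a basis of the homology of the quotient with coefficients in [M], which is a sum of
    shifted copies of Tor(k, M). *)
Definition seqQ n : seq (L * ix P) := [seq (v, a) | v <- lets n, a <- fib P (n - (ldeg v).+1)].

Lemma mem_seqQ n v a : ((v, a) \in seqQ n) = ((ldeg v).+1 <= n)%N && (a \in fib P (n - (ldeg v).+1)).
Proof.
apply/allpairsPdep/andP => [[v' [s' [vn sn [-> ->]]]]|[vn sn]].
  by rewrite -mem_lets.
by exists v, a; rewrite mem_lets.
Qed.

Lemma seqQ_uniq n : uniq (seqQ n).
Proof.
apply: allpairs_uniq_dep => [|v _|[v s] [v' s'] _ _ /= [-> ->]] //; first exact: lets_uniq.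
exact: fib_uniq.
Qed.

Lemma dimeq_Q n : dimeq res (@CycQ M n) (@BndQ M n) (seqQ n).
Proof.
have resF : resolves (fun _ : ix F => one_residue res) by apply: (resolves_residue hR F0 FB0 F_exact).
have /choice[phi phiP] := Tor_residue_dimeq resP resF minP.
exists (fun y p => phi (n - (ldeg p.1).+1)%N (fun s => y (p.1, s)) p.2); split.
- move=> a x y Cx Cy [v s]; rewrite mem_seqQ => /andP[vn sn].
  by have [lin _ _] := phiP (n - (ldeg v).+1)%N; exact: lin (Cx v vn) (Cy v vn) s sn.
- move=> w; have /choice[x xP] : forall v, exists x : ix F -> M,
      Cyc (n - (ldeg v).+1) x /\ forall s, s \in fib P (n - (ldeg v).+1) ->
      phi (n - (ldeg v).+1)%N x s = w (v, s).
    by move=> v; have [_ /(_ (fun s => w (v, s)))[x]] := phiP (n - (ldeg v).+1)%N; exists x.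
  exists (fun p => x p.1 p.2) => [v _|[v s]]; first by have [] := xP v.
  by rewrite mem_seqQ => /andP[_ sn]; have [_ /(_ s sn)] := xP v.
move=> y Cy; split=> [By [v s]|y0 v vn].
  rewrite mem_seqQ => /andP[vn sn]; have [_ _ ker] := phiP (n - (ldeg v).+1)%N.
  exact: (ker _ (Cy v vn)).1 (By v vn) s sn.
have [_ _ ker] := phiP (n - (ldeg v).+1)%N; apply: (ker _ (Cy v vn)).2 => s sn.
by have := y0 (v, s); rewrite mem_seqQ vn sn; apply.
Qed.

(** Exactness of H_n(U (x) M) -> H_n(cone (x) M) -> H_n(Q (x) M) at the middle term, where Q is the
    quotient of the cone by U. *)
Lemma dimle_cone_Q n : dimle res (@Cyc R cone M n) (@Bnd R cone M n) (H n + size (seqQ n)).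
Proof.
apply: (@dimle_exact R k res hR _ _ _ incl_cone proj_cone (@Cyc R UU M n) (@Bnd R UU M n)
  (@Cyc R cone M n) (@Bnd R cone M n) (@CycQ M n) (@BndQ M n)).
- exact: submod_Bnd.
- exact: submod_BndQ.
- move=> x [w ew]; apply/Bnd_cone; exists w, 0; split=> [m mn|v s _]; last by rewrite dn0.
  by rewrite linear0 addr0 /= ew // fibUU.
- by move=> y /Cyc_cone[].
- exact: submod_Cyc.
- by move=> r w r0 Cw; exact: dimeq_killed (submod_CycQ M n) (dimeq_Q n) r0 Cw.
- move=> y Cy By.
  have /choice[w wP] : forall v, exists w : ix F -> M, (ldeg v < n)%N ->
      forall s, s \in fib F (n - (ldeg v).+1) -> y (inr (v, s)) = dn (n - (ldeg v).+1) w s.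
    move=> v; have [vn|_] := ltnP (ldeg v) n; last by exists 0.
    by have [w ew] := By v vn; exists w.
  pose W : coneix -> M := fun t => if t is inr p then w p.1 p.2 else 0.
  have CW : @Cyc R cone M n (@dn R cone M n W) by apply: Bnd_Cyc; exists W.
  pose y2 : coneix -> M := y - @dn R cone M n W.
  have Cy2 : @Cyc R cone M n y2 := submodB (submod_Cyc cone M n) Cy CW.
  have y2Q v s : (v, s) \in fibQ n -> y2 (inr (v, s)) = 0.
    move=> pn; rewrite -[LHS]/(y (inr (v, s)) - @dn R cone M n W (inr (v, s))) dn_cone_inr //.
    by have := pn; rewrite mem_fibQ => /andP[vn sn]; rewrite (wP v vn s sn) subrr.
  exists (fun m => y2 (inl m)).
    case: (n) Cy2 y2Q => // i Cy2 y2Q m mi; have [_ /(_ i erefl m)] := (Cyc_cone _ _).1 Cy2.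
    rewrite -fibUU => /(_ mi); rewrite [X in _ + X]/delta big_seq big1 ?addr0 // => -[v s] vs.
    by rewrite y2Q // scaler0.
  exists W => -[m|[v s]] tn; last first.
    rewrite -[LHS]/(y (inr (v, s)) - 0) subr0; move: tn; rewrite mem_cfib_inr => tn.
    by have /eqP := y2Q v s tn; rewrite -[y2 _]/(y (inr (v, s)) - @dn R cone M n W _) subr_eq0 => /eqP.
  by rewrite -[LHS]/(y (inl m) - (y (inl m) - @dn R cone M n W (inl m))) subKr.
- exact: HP.
exact: (dimeq_le hR (submod_CycQ M n) (dimeq_Q n)).
Qed.

(** Exactness of H_{n+1}(cone (x) M) -> H_{n+1}(Q (x) M) -> H_n(U (x) M) at the middle term; the
    first module is Tor(k, M) because the cone resolves k. *)
Lemma dimle_Q_cone n :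
  dimle res (@CycQ M n.+1) (@BndQ M n.+1) (size (fib P n.+1) + H n).
Proof.
apply: (@dimle_exact R k res hR _ _ _ proj_cone (delta n) (@Cyc R cone M n.+1) (@Bnd R cone M n.+1)
  (@CycQ M n.+1) (@BndQ M n.+1) (@Cyc R UU M n) (@Bnd R UU M n)).
- exact: submod_BndQ.
- exact: submod_Bnd.
- move=> y /Bnd_cone[w [x [_ eQ]]] v vn; exists (fun s => x (v, s)) => s sn.
  by apply: eQ; rewrite mem_fibQ vn.
- move=> y Cy; case: n Cy => // n Cy m; rewrite fibUU => mn.
  pose Y : coneix -> M := fun t => if t is inr p then y p else 0.
  have := @dn_dn R cone M n Y (inl m); rewrite mem_cfib_inl => /(_ mn).
  rewrite dn_cone_inl [X in _ + X]/delta big_seq big1 ?addr0 => [E|[v s] vs].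
    rewrite -[RHS]E; apply: eq_dn => m' _ /=; rewrite dn_cone_inl.
    by rewrite [X in X + _](_ : _ = 0) ?add0r // /dn big1 // => ? _; rewrite scaler0.
  rewrite dn_cone_inr //; move: vs; rewrite mem_fibQ => /andP[vn sn].
  have := Cy v (leqW vn); rewrite subSn // => /(_ s sn) E.
  by rewrite -[dn _ _ s]/(dn (n.+1 - (ldeg v).+1) (fun s => y (v, s)) s) E scaler0.
- exact: submod_CycQ.
- by move=> r y r0 Cy; exact: (UP_killed hq r0 Cy).
- move=> y Cy [w ew]; exists (fun t => match t with inl m => - w m | inr p => y p end).
    apply/Cyc_cone; split=> // i [<-] m mn.
    have -> : @dn R UU M n (fun m => - w m) m = - dn n w m.
      have := @dnP R UU M n (-1) w 0 m; rewrite addr0 dn0 addr0 !scaleN1r; exact.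
    by rewrite -ew ?fibUU // addNr.
  rewrite (_ : y - _ = 0); last by apply/funext => p; exact: subrr.
  exact: (submod0 (submod_BndQ M _)).
- have resC := cone_residue.
  exact: (dimeq_le hR (submod_Cyc cone M n.+1) (Tor_residue_dimeq resP resC minP n.+1)).
exact: HP.
Qed.

(** The first factor is the coefficient sequence of V: h_{i-1} in degree i at least 2, reflecting
    the shift of the copy of F by [(ldeg v).+1]. *)
Lemma size_seqQ n : size (seqQ n) =
  conv (fun i => if i is i'.+2 then h i'.+1 else 0%N) (betti P) n.
Proof.
rewrite size_allpairs_dep sumnE big_map.
rewrite (big_lets n (fun j => size (fib P (n - j.+2)))) /conv.
case: n => [|n]; first by rewrite big_ord0 big_ord_recl big_ord0.
rewrite !big_ord_recl /= !add0n; apply: eq_bigr => j _.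
rewrite /betti /bump /= !add1n mulnC add0n; elim: (h _) => [|m IH]; first by rewrite muln0.
by rewrite mulrS mulnS IH.
Qed.

Lemma betti_le_conv n : (betti P n <= H n +
  conv (fun i => if i is i'.+2 then h i'.+1 else 0%N) (betti P) n)%N.
Proof.
rewrite -size_seqQ.
have D := Tor_residue_dimeq resP cone_residue minP n.
exact: (dimeq_ge (submod_Cyc cone M n) (fib_uniq P n) D (@dimle_cone_Q n)).
Qed.

Lemma conv_le_betti n : (conv (fun i => if i is i'.+2 then h i'.+1 else 0%N) (betti P) n.+1 <=
  betti P n.+1 + H n)%N.
Proof.
rewrite -size_seqQ.
exact: (dimeq_ge (submod_CycQ M n.+1) (seqQ_uniq n.+1) (dimeq_Q n.+1) (@dimle_Q_cone n)).
Qed.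
End LongExactSequence.

End Cone.

(** * Growth of the coefficients *)

Lemma prod_even (V : comPzRingType) (q : nat) (g : nat -> V) : g 0%N = 1 ->
  \prod_(j < q.+1 | ~~ odd j) g j = \prod_(1 <= i < q.+1 | (2 * i <= q)%N) g (2 * i)%N.
Proof.
move=> g0; rewrite -(big_mkord (fun j => ~~ odd j) g) /index_iota subn0 big_cons /= g0 mul1r.
rewrite subn1 /= -big_filter -[RHS]big_filter -(big_map (muln 2) predT g).
apply: perm_big; apply: uniq_perm.
- by rewrite filter_uniq ?iota_uniq.
- by rewrite map_inj_uniq ?filter_uniq ?iota_uniq // => x y /=; lia.
move=> j; rewrite mem_filter mem_iota; apply/idP/mapP => [/and3P[oj j1 jq]|[i]].
  exists j./2; last by lia.
  by rewrite mem_filter mem_iota; lia.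
by rewrite mem_filter mem_iota => /andP[iq ii] ->; lia.
Qed.

Section Counting.
Variables (R : comUnitRingType) (k : fieldType) (res : {rmorphism R -> k}).
Variables (A : acyclicClosure res) (q : nat) (K : realDomainType) (t : K).
Hypotheses (t0 : 0 <= t) (t1 : t < 1).
Notation T := (variables (ac_num A) q).
Notation expo := {ffun T -> nat}.

Lemma Golod_v_prod : (map_poly intr (Golod_v A q)).[t] =
  \prod_(v : T | ~~ odd (tg v)) (1 - t ^+ tg v) :> K.
Proof.
rewrite /Golod_v rmorph_prod horner_prod /=.
have -> : \prod_(v : T | ~~ odd (tg v)) (1 - t ^+ tg v) =
    \prod_(j < q.+1 | ~~ odd j) \prod_(l < ac_num A j) (1 - t ^+ j).
  rewrite (eq_bigr (fun j : 'I_q.+1 => \prod_(l < ac_num A j | ~~ odd j) (1 - t ^+ j))) => [|j ->//].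
  by rewrite sig_big_dep /=; apply: eq_bigl => v; rewrite andbb.
rewrite (prod_even q (g := fun j => \prod_(l < ac_num A j) (1 - t ^+ j))) => [|]; last first.
  by rewrite ac_num0 big_ord0.
apply: eq_bigr => i _.
rewrite prodr_const card_ord rmorphXn rmorphB rmorph1 /= map_polyXn.
by rewrite horner_exp hornerD hornerN hornerXn hornerC.
Qed.

Lemma geom_le m n : (0 < m)%N -> (1 - t ^+ m) * \sum_(i < n) t ^+ (m * i) <= 1.
Proof.
move=> m0; under eq_bigr do rewrite exprM.
rewrite -[1 - _]opprB mulNr -subrX1 opprB lerBlDr lerDl.
by rewrite !exprn_ge0.
Qed.

(** The sum is at most the product of the truncated series of the single variables. Multiplied by
    its factor of v, the geometric series of an even variable is at most 1; an odd variable
    contributes at most 1 + t^j, hence at most 2. *)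
Lemma hiseq_count n : (map_poly intr (Golod_v A q)).[t] * \sum_(mu <- hiseq A q n) t ^+ wt mu
  <= 2 ^+ #|{: T}|.
Proof.
pose Q (v : T) (m : 'I_n.+1) := odd (tg v) ==> (m <= 1)%N.
have step : \sum_(mu <- hiseq A q n) t ^+ wt mu <=
    \prod_(v : T) \sum_(m < n.+1 | Q v m) t ^+ (tg v * m).
  pose phi (mu : expo) : {ffun T -> 'I_n.+1} := [ffun v => inord (mu v)].
  have phiE mu v : mu \in hiseq A q n -> phi mu v = mu v :> nat.
    rewrite mem_hiseq => /and3P[_ _ wmu]; rewrite ffunE inordK // ltnS (leq_trans _ wmu) //.
    rewrite /wt (bigD1 v) //= (leq_trans _ (leq_addr _ _)) // leq_pmull //; exact: tg_gt0.
  pose G (f : {ffun T -> 'I_n.+1}) := \prod_v t ^+ (tg v * f v).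
  rewrite (eq_big_seq (fun mu => G (phi mu))) => [|mu mn]; last first.
    by rewrite /wt /G -prodrXr; apply: eq_bigr => v _; rewrite phiE.
  rewrite -(big_map phi predT G) big_uniq; last first.
    rewrite map_inj_in_uniq ?hiseq_uniq // => mu mu' mn mn' e; apply/ffunP => v.
    by rewrite -(phiE _ _ mn) -(phiE _ _ mn') e.
  rewrite bigA_distr_big_dep /= big_mkcond [leRHS]big_mkcond; apply: ler_sum => f _.
  have G0 : 0 <= G f by apply: prodr_ge0 => v _; rewrite exprn_ge0.
  case: ifPn => [/mapP[mu mn ->]|_]; last by case: ifP.
  rewrite ifT //; apply/familyP => v; rewrite unfold_in /Q phiE //.
  by move: mn; rewrite mem_hiseq => /and3P[_ /forallP/(_ v) ov _]; exact: ov.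
have v0 (v : T) : 0 <= 1 - t ^+ tg v.
  by rewrite subr_ge0 exprn_ile1 // ltW.
rewrite Golod_v_prod; apply: le_trans (ler_wpM2l _ step) _; first by apply: prodr_ge0.
rewrite big_mkcond -big_split -[leRHS]prodr_const.
apply: ler_prod => v _; have S0 : 0 <= \sum_(m < n.+1 | Q v m) t ^+ (tg v * m).
  by apply: sumr_ge0 => m _; rewrite exprn_ge0.
rewrite mulr_ge0 //=; last by case: ifP.
case: ifPn => ov; last first.
  rewrite mul1r /Q negbK in ov *; rewrite ov /=.
  apply: (@le_trans _ _ (\sum_(m < n.+1) (m <= 1)%:R)).
    rewrite big_mkcond; apply: ler_sum => m _; case: ifP => // _.
    by rewrite exprn_ile1 // ltW.
  case: (n) => [|n']; first by rewrite big_ord_recl big_ord0 addr0 ler1n.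
  by rewrite !big_ord_recl big1 // addr0 -natrD.
rewrite /Q (negPf ov) /=; apply: le_trans (geom_le _ (tg_gt0 v)) _.
by rewrite ler1n.
Qed.

End Counting.

Lemma sum_tail_le (kap : nat -> nat) N w n : (forall i, (N < i)%N -> kap i = 0%N) ->
  (\sum_(i < n | w <= i) kap (i - w) <= \sum_(j < N.+1) kap j)%N.
Proof.
move=> kap0; have [nw|wn] := leqP n w.
  by rewrite big1 // => i wi; have := ltn_ord i; lia.
rewrite -(big_mkord (fun i => w <= i)%N (fun i => kap (i - w)%N)).
rewrite -(@big_nat_widenl _ _ _ w 0%N n xpredT) //.
rewrite -{1}[w]add0n big_addn.
under eq_bigr do rewrite addnK.
rewrite -(big_mkord xpredT kap); have [le|lt] := leqP (n - w) N.+1.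
  by rewrite [leqRHS](@big_cat_nat _ _ _ (n - w)%N) //= leq_addr.
rewrite (@big_cat_nat _ _ _ N.+1) /=; [|by []|exact: ltnW].
rewrite [X in (_ + X)%N]big_nat_cond.
by rewrite [X in (_ + X)%N]big1 ?addn0 // => i; rewrite andbT => /andP[Ni _]; exact: kap0.
Qed.

Definition tame (K : numDomainType) (w : K -> K) (s : nat -> K) :=
  exists C, forall t n, 0 <= t -> t < 1 -> w t * \sum_(i < n.+1) `|s i| * t ^+ i <= C.

(** The generating series is the product of the one counting high monomials, controlled by
    [hiseq_count], and the finite sum of the [kap j] t^j, which is at most the sum of the
    [kap j]. *)
Lemma hiseq_tame (R : comUnitRingType) (k : fieldType) (res : {rmorphism R -> k})
    (A : acyclicClosure res) (q : nat) (K : realDomainType) (kap : nat -> nat) N :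
  (forall i, (N < i)%N -> kap i = 0%N) ->
  tame (fun t : K => (map_poly intr (Golod_v A q)).[t])
    (fun n => (\sum_(mu <- hiseq A q n) kap (n - wt mu)%N)%:R).
Proof.
move=> kap0; exists (2 ^+ #|{: variables (ac_num A) q}| * (\sum_(j < N.+1) kap j)%:R) => t n t0 t1.
have v0 : 0 <= (map_poly intr (Golod_v A q)).[t].
  rewrite Golod_v_prod; apply: prodr_ge0 => v _.
  by rewrite subr_ge0 exprn_ile1 // ltW.
have := ler_wpM2r (ler0n K (\sum_(j < N.+1) kap j)) (hiseq_count A q t0 t1 n).
apply: le_trans; rewrite -mulrA ler_wpM2l // mulr_suml.
under eq_bigr => i _.
  rewrite ger0_norm ?ler0n //.
  (* In degree [i] the list [hiseq A q i] is the part of weight at most [i] of [hiseq A q n]; with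
     the latter as common range the two sums can be exchanged. *)
  rewrite (perm_big [seq mu <- hiseq A q n | (wt mu <= i)%N]) /=; last first.
    apply: uniq_perm => [||mu]; [exact: hiseq_uniq|by apply: filter_uniq; exact: hiseq_uniq|].
    by rewrite [in RHS]mem_filter !mem_hiseq; have := ltn_ord i; case: (hi mu == mu); case: (admissible mu) => /=; lia.
  rewrite big_filter big_mkcond natr_sum mulr_suml; over.
rewrite exchange_big /=; apply: ler_sum => mu _.
apply: (@le_trans _ _ (t ^+ wt mu * (\sum_(i < n.+1 | (wt mu <= i)%N) kap (i - wt mu)%N)%:R)).
  rewrite natr_sum mulr_sumr [leRHS]big_mkcond; apply: ler_sum => i _.
  case: ifP => wi; last by rewrite mul0r.
  by rewrite mulrC -{1}(subnKC wi) exprD -mulrA ler_wpM2l ?exprn_ge0 // ler_piMl ?ler0n ?exprn_ile1 // ltW.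
by rewrite ler_wpM2l ?exprn_ge0 // ler_nat sum_tail_le.
Qed.

Lemma exists_residue_resolution (R : comUnitRingType) (k : fieldType)
    (res : {rmorphism R -> k}) : noetherian_local res ->
  exists (F : cx R) (t0 : ix F), [/\ fib F 0 = [:: t0],
    forall c : ix F -> R^o, Bnd 0 c <-> res (c t0) = 0 &
    forall n, exact_at F R^o n.+1].
Proof.
move=> hR; have [|m [g [gP _]]] := min_gens_row hR (n := 1) (Z := fun v => res (v 0 0) = 0).
  by split=> [|a x y x0 y0]; rewrite !mxE ?rmorph0 // rmorphD rmorphM x0 y0 mulr0 addr0.
pose s : syz_state R := existT _ (m, 1%N) g.
have DD n : syz_diff hR s n.+1 *m syz_diff hR s n = 0.
  by apply/row_matrixP => i; rewrite row_mul row0; apply/syz_exact; exists (delta_mx 0 i); rewrite rowE.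
have f0 : mfib (syz_rank hR s) 0 = [:: (0%N, 0%N)].
  by rewrite /mfib (_ : syz_rank hR s 0 = 1%N) // enum_ordSl /= (size0nil (size_enum_ord 0)).
exists (mcx DD), (0%N, 0%N); split=> // [c|n]; last first.
  by apply: exact_at_mcx_row => v /syz_exact.
split=> [[w ew]|c0].
  rewrite ew /= ?f0 ?mem_head // (dn_mcx w (ord0 : 'I_(syz_rank hR s 0))).
  have /gP H : exists w' : 'rV_m, (\row_i w (1%N, val i)) *m g = w' *m g by exists (\row_i w (1%N, val i)).
  rewrite -[RHS]H mxE; congr (res _); apply: eq_bigr => j _.
  by rewrite mxE mulrC.
have /gP[w ew] : res ((const_mx (c (0%N, 0%N)) : 'rV_1) 0 0) = 0 by rewrite mxE.
exists (fun t => oapp (w 0) 0 (insub t.2)) => t; rewrite /= f0 inE => /eqP ->.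
rewrite (dn_mcx _ (ord0 : 'I_(syz_rank hR s 0))).
have /matrixP/(_ 0 0) := ew; rewrite !mxE => ->.
by apply: eq_bigr => j _; rewrite valK /= mulrC.
Qed.

Definition cauchy (K : pzRingType) (a b : nat -> K) n := \sum_(i < n.+1) a i * b (n - i)%N.

Section Cauchy.
Variable K : comNzRingType.
Implicit Types a b c : nat -> K.
Notation trunc N a := (\poly_(i < N) a i).

(** Products of truncated polynomials give the coefficients up to a fixed index, so the ring laws of
    polynomials yield those of the Cauchy product. *)
Lemma cauchy_coef a b N n : (n < N)%N -> cauchy a b n = (trunc N a * trunc N b)`_n.
Proof.
move=> nN; rewrite coefM; apply: eq_bigr => i _; have := ltn_ord i => ii.
by rewrite !coef_poly !ifT //; lia.
Qed.

Lemma coefM_eq (p p' r r' : {poly K}) n : (forall i, (i <= n)%N -> p`_i = p'`_i) ->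
  (forall i, (i <= n)%N -> r`_i = r'`_i) -> (p * r)`_n = (p' * r')`_n.
Proof.
move=> ep er; rewrite !coefM; apply: eq_bigr => i _; have := ltn_ord i => ii.
by rewrite ep ?er //; lia.
Qed.

Lemma trunc_cauchy a b N i : (i < N)%N ->
  (trunc N (cauchy a b))`_i = (trunc N a * trunc N b)`_i.
Proof. by move=> iN; rewrite coef_poly iN (@cauchy_coef _ _ N). Qed.

Lemma cauchyC a b n : cauchy a b n = cauchy b a n.
Proof. by rewrite !(@cauchy_coef _ _ n.+1) // mulrC. Qed.

Lemma cauchyA a b c n : cauchy a (cauchy b c) n = cauchy (cauchy a b) c n.
Proof.
rewrite !(@cauchy_coef _ _ n.+1) //.
rewrite (@coefM_eq _ (trunc n.+1 a) _ (trunc n.+1 b * trunc n.+1 c)) //; last first.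
  by move=> i ii; rewrite trunc_cauchy.
rewrite [RHS](@coefM_eq _ (trunc n.+1 a * trunc n.+1 b) _ (trunc n.+1 c)) // ?mulrA //.
by move=> i ii; rewrite trunc_cauchy.
Qed.

Lemma eq_cauchy a a' b b' n : a =1 a' -> b =1 b' -> cauchy a b n = cauchy a' b' n.
Proof. by move=> ea eb; apply: eq_bigr => i _; rewrite ea eb. Qed.

(** With a = 1 - V and Betti series b and c, this is the relation (1 - V) B'' = B B'. *)
Lemma cauchy_cross a b c n :
  cauchy a (cauchy a (cauchy b c)) n = cauchy (cauchy a b) (cauchy a c) n.
Proof.
rewrite [RHS]cauchyA (eq_cauchy (a' := cauchy a (cauchy a b)) (b' := c) _ (fun m => cauchyC (cauchy a b) a m)) //.
rewrite -[RHS]cauchyA; apply: eq_cauchy => // m; exact: cauchyA.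
Qed.
End Cauchy.

Lemma conv_cauchy (K : comNzRingType) (a b : nat -> nat) n :
  (conv a b n)%:R = cauchy (fun i => (a i)%:R : K) (fun i => (b i)%:R) n.
Proof. by rewrite natr_sum; apply: eq_bigr => i _; rewrite natrM. Qed.

(** Induction on the bound: either the partial sums reach its largest allowed value, after which no
    nonzero term can follow, or a smaller bound holds. *)
Lemma eventually0_of_bounded (a : nat -> nat) m :
  (forall n, (\sum_(i < n) a i < m)%N) -> eventually0 a.
Proof.
elim: m => [/(_ 0%N)//|m IH] H.
have [ge|] := pselect (exists n, m <= \sum_(i < n) a i)%N; last first.
  by move=> ne; apply: IH => n; rewrite ltnNge; apply/negP => mn; apply: ne; exists n.
have [n mn] := ge; exists n => i ni; have := H i.+1.
rewrite big_ord_recr /= -(big_mkord xpredT a) (@big_cat_nat _ _ _ n) //= big_mkord.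
lia.
Qed.

Section NaturalDichotomy.
Notation K := Rdefinitions.R.
Notation PS_mult := PSeries.PS_mult.
Notation sum_f_R0 := Rfunctions.sum_f_R0.
Notation Rmult := Rdefinitions.Rmult.
Notation Rminus := Rdefinitions.Rminus.
Notation Rle := Rdefinitions.Rle.
Notation Rlt := Rdefinitions.Rlt.
Notation pow := Rpow_def.pow.
Variables (W D : {poly int}) (V : nat -> nat).
Notation w := (fun t : K => (map_poly intr W).[t]).
Hypothesis w_pos : forall t : K, 0 <= t -> t < 1 -> 0 < w t.
Hypothesis V0 : V 0 = 0%N.
Hypothesis V_tame : tame w (fun n => (V n)%:R).
Hypothesis DE : forall n, D`_n = cauchy (fun i => W`_i) (fun i => (i == 0%N)%:R - (V i)%:R) n.
Hypothesis D1 : D.[1] != 0.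

(** The sequence required to be tame is B = (1 - V) r. *)
Definition good (r : nat -> nat) := tame w (fun n => (r n)%:R - (conv V r n)%:R).

Let N := maxn (size W) (size D).
Let Wr n : K := (W`_n)%:~R.
Let Dr n : K := (D`_n)%:~R.
Let Vr n : K := (V n)%:R.

Lemma PS_multE (a b : nat -> K) n : PS_mult a b n = cauchy a b n.
Proof. by rewrite /PS_mult sum_f_R0E big_mkord. Qed.

Lemma horner_sum (p : {poly int}) (t : K) : (size p <= N)%N ->
  (map_poly intr p).[t] = \sum_(i < N.+1) (p`_i)%:~R * t ^+ i.
Proof.
move=> sp; rewrite (@horner_coef_wide _ N.+1); last first.
  by rewrite (leq_trans (size_poly _ _)) // ltnW.
by apply: eq_bigr => i _; rewrite coef_map.
Qed.

Lemma wE t : w t = sum_f_R0 (fun i => Rmult (Wr i) (pow t i)) N.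
Proof.
rewrite sum_f_R0E big_mkord horner_sum ?leq_maxl //.
by apply: eq_bigr => i _; rewrite RpowE.
Qed.

Lemma unit_minusE n : unit_minus Vr n = (n == 0%N)%:R - Vr n.
Proof. by case: n. Qed.

Lemma tameRE s : tame w s -> tameR Wr N s.
Proof.
case=> C H; exists C => t n /RleP t0 /RltP t1; apply/RleP.
have := H t n t0 t1; rewrite wE; congr (_ * _ <= _).
rewrite sum_f_R0E big_mkord; apply: eq_bigr => i _.
by rewrite RabsE RpowE.
Qed.

Lemma phi_conv (r : nat -> nat) n :
  (r n)%:R - (conv V r n)%:R = cauchy (unit_minus Vr) (fun i => (r i)%:R) n :> K.
Proof.
rewrite conv_cauchy /cauchy; under [RHS]eq_bigr do rewrite unit_minusE mulrBl.
rewrite sumrB; congr (_ - _); rewrite big_ord_recl mul1r subn0 big1 ?addr0 // => i _.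
by rewrite mul0r.
Qed.

Lemma eventually0_of_sum_bounded (a : nat -> nat) :
  (exists C, forall n, Rle (sum_f_R0 (fun i => (a i)%:R : K) n) C) -> eventually0 a.
Proof.
case=> C H; have C0 : 0 <= C.
  have := H 0%N; move/RleP => H0; apply: le_trans H0; exact: ler0n.
apply: (@eventually0_of_bounded _ (Num.bound C).+1) => -[|n]; first by rewrite big_ord0.
have /RleP := H n; rewrite sum_f_R0E big_mkord -natr_sum => Hn.
have := le_lt_trans Hn (archi_boundP C0); rewrite ltr_nat => lt.
exact: (leq_trans lt).
Qed.

Lemma good_dichotomy a b : good a -> good b -> good (conv a b) -> eventually0 a \/ eventually0 b.
Proof.
move=> ga gb gab.
pose B s n : K := (s n)%:R - (conv V s n)%:R.
have BE s n : B s n = Rminus ((s n)%:R : K) (PS_mult (fun i => (s i)%:R : K) Vr n).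
  by rewrite PS_multE cauchyC /B conv_cauchy.
have BB n : PS_mult (unit_minus Vr) (B (conv a b)) n = PS_mult (B a) (B b) n.
  rewrite !PS_multE (eq_cauchy (a' := unit_minus Vr) (b' := cauchy (unit_minus Vr)
    (cauchy (fun i => (a i)%:R) (fun i => (b i)%:R))) n) // => [|m].
    by rewrite cauchy_cross; apply: eq_cauchy => m; rewrite /B phi_conv.
  by rewrite /B phi_conv; apply: eq_cauchy => // i; exact: conv_cauchy.
have size0 (p : {poly int}) m : (size p <= N)%N -> lt N m -> (p`_m)%:~R = 0 :> K.
  by move=> sp /ssrnat.ltP/ltnW Nm; rewrite nth_default ?rmorph0 // (leq_trans sp).
have DrE n : Dr n = PS_mult Wr (unit_minus Vr) n.
  rewrite PS_multE /Dr DE rmorph_sum; apply: eq_bigr => i _ /=.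
  by rewrite rmorphM rmorphB /= !rmorph_nat unit_minusE.
have D1r : sum_f_R0 Dr N <> 0 :> K.
  rewrite sum_f_R0E big_mkord => e; move: D1; rewrite -(intr_eq0 K) => /eqP; apply.
  rewrite -horner_map /= rmorph1 horner_sum ?leq_maxr // -[RHS]e.
  by apply: eq_bigr => i _; rewrite expr1n mulr1.
have wp t : (Rle 0 t /\ Rlt t 1) -> Rlt 0 (sum_f_R0 (fun i => Rmult (Wr i) (pow t i)) N).
  by case=> /RleP t0 /RltP t1; apply/RltP; rewrite -wE; exact: w_pos.
have nat0 (s : nat -> nat) n : Rle 0 ((s n)%:R : K) by apply/RleP; exact: ler0n.
have := @bounded_dichotomy Wr Vr Dr N wp (fun n => size0 W n (leq_maxl _ _))
  (fun n => size0 D n (leq_maxr _ _)) (nat0 V) _ (tameRE V_tame) DrE D1r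
  (fun n => (a n)%:R) (fun n => (b n)%:R) (B a) (B b) (B (conv a b)) (nat0 a) (nat0 b)
  (BE a) (BE b) BB (tameRE ga) (tameRE gb) (tameRE gab).
case=> [|H|H]; first by rewrite /Vr V0.
  by left; exact: eventually0_of_sum_bounded.
by right; exact: eventually0_of_sum_bounded.
Qed.
End NaturalDichotomy.

(** * Tor-vanishing *)

(** The shift by one index multiplies a weighted sum by [t], which is at most 1; hence the constant
    doubles. *)
Lemma tame_le (K : realDomainType) (w : K -> K) (f s : nat -> K) :
  (forall t, 0 <= t -> t < 1 -> 0 <= w t) -> (forall n, 0 <= f n) ->
  (forall n, `|s n| <= f n + (if n is m.+1 then f m else 0)) -> tame w f -> tame w s.
Proof.
move=> w0 f0 sf [C H]; exists (C + C) => t n t0 t1.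
have wt := w0 t t0 t1; have Hn := H t n t0 t1.
apply: le_trans (lerD Hn Hn); rewrite -mulrDr ler_wpM2l //.
apply: (@le_trans _ _ (\sum_(i < n.+1) f i * t ^+ i +
    \sum_(i < n.+1) (if (i : nat) is m.+1 then f m else 0) * t ^+ i)).
  rewrite -big_split; apply: ler_sum => i _.
  by rewrite /= -mulrDl ler_wpM2r ?exprn_ge0 // sf.
have -> : \sum_(i < n.+1) `|f i| * t ^+ i = \sum_(i < n.+1) f i * t ^+ i.
  by apply: eq_bigr => i _; rewrite ger0_norm.
rewrite lerD2l big_ord_recl mul0r add0r [leRHS]big_ord_recr /=.
rewrite -[leLHS]addr0 lerD ?mulr_ge0 ?exprn_ge0 //; apply: ler_sum => i _.
by rewrite ler_wpM2l // exprS ler_piMl ?exprn_ge0 // ltW.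
Qed.

Section HomologyRanks.
Variables (R : comUnitRingType) (k : fieldType) (res : {rmorphism R -> k}).
Hypothesis hR : noetherian_local res.
Variables (A : acyclicClosure res) (q : nat).
Hypothesis hq : (1 <= q)%N.
Notation tr := (truncation (@ac_var _ _ _ A) q).
Notation U := (@U _ _ _ A q).
Notation d := (dg_diff A).
Variable h : nat -> nat.
Hypothesis hh : forall i, dim_residue res (cycles tr i) (boundaries tr i) (h i).

(** In degree 0 the truncation consists of the multiples of 1, so the class of 1 spans; it is
    nonzero because boundaries lie in the augmentation kernel. *)
Lemma homology0 : h 0 = 1%N.
Proof.
have [phi [_ scal srj ker]] := hh 0.
have C1 : cycles tr 0 1.
  by split; [rewrite truncationE; exact: U1|exact: dg_one|exact: diff1].
have phiE a : cycles tr 0 a -> exists r : R, phi a = res r *: phi 1.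
  case; rewrite truncationE => /U_comp0[r er] ha _; exists r.
  by rewrite -scal // -er ha.
have phi1 : phi 1 != 0.
  apply/eqP => /(ker _ C1)[b [Ub _ e1]].
  have := augk_diff (A := A) (q := q) (a := b); rewrite -truncationE -e1 => /(_ Ub).
  by rewrite -[1]scale1r => /(augk_scalar A q) /eqP; rewrite rmorph1 oner_eq0.
case eh : (h 0) phi scal srj ker phiE phi1 => [|[//|m]] phi scal srj ker phiE phi1.
  by case/eqP: phi1; apply/rowP => -[].
have [a Ca ea] := srj (delta_mx 0 ord0); have [b Cb eb] := srj (delta_mx 0 (lift ord0 ord0)).
have [r er] := phiE a Ca; have [s es] := phiE b Cb.
have /rowP ea' := etrans (esym er) ea; have /rowP eb' := etrans (esym es) eb.
have := ea' (lift ord0 ord0); rewrite !mxE /= => /eqP; rewrite mulf_eq0 => /orP[/eqP r0|/eqP p0].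
  by have := ea' ord0; rewrite !mxE /= r0 mul0r => /eqP; rewrite eq_sym oner_eq0.
by have := eb' (lift ord0 ord0); rewrite !mxE /= p0 mulr0 => /eqP; rewrite eq_sym oner_eq0.
Qed.

Notation UU := (UP (@closed_predT _ _ _ A q)).
Variable z : letter h -> A.
Hypothesis zC : forall v, cycles tr (ldeg v) (z v).
Hypothesis z_indep : forall j (c : 'I_(h j.+1) -> R),
  boundaries tr j.+1 (\sum_l c l *: z (mkletter l)) -> forall l, res (c l) = 0.

(** The coordinates of the basis cycles [z] form an independent family of cycles with coefficients
    R. The estimate for modules thus also controls [h], and with it V. *)
Lemma homology_rank_le j H : dimle res (@Cyc R UU R^o j.+1) (@Bnd R UU R^o j.+1) H ->
  (h j.+1 <= H)%N.
Proof.
move=> D; pose g (l : 'I_(h j.+1)) : {ffun variables (ac_num A) q -> nat} -> R^o :=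
  coefU j.+1 (z (mkletter l)).
have zP (l : 'I_(h j.+1)) : U (z (mkletter l)) /\ homogeneous j.+1 (z (mkletter l)).
  by have [Uz hz _] := zC (mkletter l); split=> //; move: Uz; rewrite truncationE.
have zE (l : 'I_(h j.+1)) : z (mkletter l) = \sum_(m <- fibU A q j.+1) g l m *: monomial (@ac_var _ _ _ A) m.
  by have [Uz hz] := zP l; exact: coefUE.
have := D _ [set: 'I_(h j.+1)] g; rewrite cardsT card_ord; apply=> [l _|c [w ew] l _].
  move=> m; rewrite fibUU => mj; have [_ _ dz] := zC (mkletter l).
  have := diff_comb j (g l); rewrite -zE dz => /esym/fibU_free; exact.
apply: (z_indep (c := c)); exists (\sum_(m <- fibU A q j.+2) w m *: monomial (@ac_var _ _ _ A) m).
have hs := submod_homogeneous A j.+2; split.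
- by rewrite truncationE; apply: (submod_sum_seq (sU A q)) => m mn; apply: (submodZ (sU A q)); have [] := fibU_mono mn.
- by apply: (submod_sum_seq hs) => m mn; apply: (submodZ hs); have [] := fibU_mono mn.
rewrite diff_comb; under eq_bigr do rewrite zE scaler_sumr.
rewrite exchange_big /=; apply: eq_big_seq => m mj; under eq_bigr do rewrite scalerA.
rewrite -scaler_suml; congr (_ *: _); rewrite -ew ?fibUU // fct_sumE.
by apply: eq_big => // l'; rewrite inE.
Qed.
End HomologyRanks.

(** Since h_0 = 1, one has 1 + t - t h(t) = 1 - t (h(t) - 1) = 1 - V(t), so that d = v (1 - V). *)
Lemma Golod_polynomial_coef (W u : {poly int}) (h : nat -> nat) n : h 0 = 1%N ->
  (forall n, u`_n = (W * \poly_(i < n.+1) (h i)%:R)`_n) ->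
  ((1 + 'X) * W - 'X * u)`_n = cauchy (fun i => W`_i)
    (fun i => (i == 0%N)%:R - (if i is i'.+2 then h i'.+1 else 0%N)%:R) n.
Proof.
move=> h0 hu; rewrite coefB mulrDl mul1r coefD !coefXM /cauchy.
case: n => [|n] /=; first by rewrite big_ord1 /= !subr0 mulr1.
rewrite big_ord_recr /= subnn subr0 mulr1 -addrA addrC; congr (_ + _).
have -> : W`_n = \sum_(i < n.+1) W`_i * (n - i == 0)%N%:R.
  rewrite big_ord_recr /= subnn mulr1 big1 ?add0r // => i _.
  by rewrite subn_eq0 leqNgt ltn_ord mulr0.
rewrite hu coefM -sumrB; apply: eq_bigr => i _; have ii := ltn_ord i.
rewrite coef_poly ifT; last by lia.
rewrite -mulrBr subSn; last by lia.
by congr (_ * _); case: (n - i)%N => [|j] //=; rewrite h0.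
Qed.

Theorem corollary3p6 (R : comUnitRingType) (k : fieldType)
    (res : {rmorphism R -> k}) (hR : noetherian_local res)
    (A : acyclicClosure res) (q : nat) (hG : generalized_Golod A q)
    (d : {poly int}) (hd : is_Golod_polynomial A q d)
    (hd1 : d.[1] != 0) :
  Tor_vanishing R.
Proof.
have [hq [gamma [gamma_aug gamma_class gamma_diff]]] := hG.
have [u [h [hh hu]] dE] := hd.
have [z [zC z_span z_indep]] := homology_basis hR hh.
have [F [t0 [F0 FB0 F_exact]]] := exists_residue_resolution hR.
(* The coefficient is the value at [t0] of the boundary of the basis vector [s]. *)
have F1 (s : ix F) : s \in fib F 1 -> res (cD s t0) = 0.
  move=> s1; have /FB0 : Bnd 0 (@dn R F R^o 0 (fun s' => (s' == s)%:R)) by exists (fun s' => (s' == s)%:R).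
  rewrite /dn (bigD1_seq s) ?fib_uniq //= eqxx big1 => [|s' /negPf ->]; last exact: mulr0.
  by rewrite addr0 [_ *: _]mulr1.
have [Psi [PsiU Psi_diff Psi_t0]] := exists_Psi hq (Ga_aug zC gamma_aug) (dGa zC gamma_diff)
  (cycle_decomp zC z_span gamma_class) (Ga_indep zC z_indep gamma_class) F0 F1 (@ldeg h).
(* [Ga [:: v]] represents the class of [z v], so they differ by a boundary, of which the component
   of degree [ldeg v] is taken. *)
have Psi0 v : exists b, [/\ U q b, homogeneous (ldeg v).+1 b & Psi v 0%N t0 = - z v + dg_diff A b].
  have [b Ub eb] := Ga1 zC gamma_class v; have [_ hz _] := zC v.
  have hs := submod_homogeneous A (ldeg v).+1.
  exists (- dg_comp A (ldeg v).+1 b); split.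
  - by apply: (submodN (sU A q)); exact: U_comp.
  - by apply: (submodN hs); exact: comp_homogeneous.
  by rewrite Psi_t0 eb linearD /= hz opprD linearN /= comp_diff.
pose V i := if i is i'.+2 then h i'.+1 else 0%N.
pose w (t : Rdefinitions.R) := (map_poly intr (Golod_v A q)).[t].
have w_pos t : 0 <= t -> t < 1 -> 0 < w t.
  move=> t0' t1; rewrite /w Golod_v_prod; apply: prodr_gt0 => v _.
  by rewrite subr_gt0 exprn_ilt1 // -lt0n tg_gt0.
(* This is the estimate for M = R; V_n is a rank of homology in degree n - 1, the shifted term
   allowed by [tame_le]. *)
have V_tame : tame w (fun n => (V n)%:R).
  have fgR : finitely_generated (R^o : lmodType R).
    by exists 1%N, (fun=> 1) => x; exists (fun=> x); rewrite big_ord1 [_ *: _]mulr1.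
  have [kap [kap0 HP]] := UP_bound hR A hq fgR.
  apply: tame_le (hiseq_tame A q _ kap0) => [t ? ?|n|n]; [by rewrite ltW ?w_pos|exact: ler0n|].
  case: n => [|[|n]]; rewrite ?normr0 ?addr_ge0 ?ler0n //.
  rewrite ger0_norm ?ler0n // -natrD ler_nat /=.
  by apply: leq_trans (leq_addl _ _); exact: (homology_rank_le zC z_indep (HP n.+1)).
have DE n : d`_n = cauchy (fun i => (Golod_v A q)`_i) (fun i => (i == 0%N)%:R - (V i)%:R) n.
  rewrite dE; exact: Golod_polynomial_coef (homology0 hh) hu.
apply: (Tor_vanishing_of_betti hR (Good := good (Golod_v A q) V)); last first.
  by move=> a b; exact: (good_dichotomy w_pos (erefl _) V_tame DE hd1).
move=> P minP; have [M [eP [resP fgM]]] := exists_coker minP.2.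
have [kap [kap0 HP]] := UP_bound hR A hq fgM.
apply: tame_le (hiseq_tame A q _ kap0) => [t ? ?|n|n]; [by rewrite ltW ?w_pos|exact: ler0n|].
have le1 := betti_le_conv hR hq zC z_span z_indep F0 FB0 F_exact PsiU Psi_diff Psi0 resP minP.1 HP n.
have le2 := conv_le_betti hR hq zC z_span z_indep F0 FB0 F_exact PsiU Psi_diff Psi0 resP minP.1 HP.
rewrite -/V in le1 le2.
set Hn := (\sum_(mu <- _) _)%N in le1 *.
set e := (X in _ <= _ + X).
(* Here [e] is the contribution of the preceding degree, equal to 0 for n = 0, where the convolution
   vanishes as well because V_0 = 0. *)
have [m [em le]] : exists m : nat, e = m%:R /\ (conv V (betti P) n <= betti P n + m)%N.
  rewrite /e; case: (n) => [|n']; last by eexists; split; [|exact: le2].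
  by exists 0%N; rewrite /conv big_ord1 mul0n.
have le1' : (betti P n <= Hn + m + conv V (betti P) n)%N.
  by apply: leq_trans le1 _; rewrite leq_add2r leq_addr.
have le' : (conv V (betti P) n <= Hn + m + betti P n)%N.
  by apply: leq_trans le _; rewrite -addnA [(m + _)%N]addnC leq_addl.
by rewrite em ler_norml lerNl opprB !lerBlDr -!natrD !ler_nat le' le1'.
Qed.
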